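(* It is decidable, given an MCFTG $G$ with terminal alphabet $\Sigma$ and a subset $\Delta\subseteq\Sigma$, whether or not $G$ has finite $\Delta$-ambiguity; and if it does, then there is a $\Delta$-growing MCFTG $G'$ that is $\mathrm{LDT}^{\mathrm R}$-equivalent to $G$. Moreover, $\theta(G')=\theta(G)$ and $\mu(G')=\mu(G)$.
   Context: **Sequences and trees.** $\mathbb N_0$ is the set of nonnegative integers, $[n]=\{1,\dots,n\}$. $A^*$ (resp. $A^+$) is the set of finite (resp. nonempty finite) sequences over $A$; a sequence of length 1 is identified with its element; juxtaposition is concatenation; $\mathrm{occ}(w)$ is the set of elements occurring in the sequence $w$; $w$ is repetition-free if no element occurs twice in it. A ranked alphabet is a set $\Sigma$ with a rank map $\mathrm{rk}\colon\Sigma\to\mathbb N_0$ (applied elementwise to sequences); $\Sigma^{(k)}$ is the set of symbols of rank $k$; for finite $\Sigma$, $\mathrm{mr}_\Sigma$ is the maximal rank of its symbols. $T_\Sigma$ is the set of trees over $\Sigma$: the smallest set of strings over $\Sigma$ containing $\sigma t_1\cdots t_k$ (also written $\sigma(t_1,\dots,t_k)$) for all $\sigma\in\Sigma^{(k)}$ and $t_i\in T_\Sigma$. A forest is a finite sequence of trees. $X=\{x_1,x_2,\dots\}$ is a set of variables (of rank 0, disjoint from other alphabets), $X_k=\{x_1,\dots,x_k\}$. A pattern of rank $k$ over $\Sigma$ is a tree over $\Sigma\cup X_k$ in which each of $x_1,\dots,x_k$ occurs exactly once; $P_\Sigma(X_k)$ is the set of these and $P_\Sigma(X)=\bigcup_k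 P_\Sigma(X_k)$. For a forest $t$, $\mathrm{occ}_\Omega(t)$ is the set of symbols of $\Omega$ occurring in $t$; $t$ is uniquely $\Omega$-labeled if each symbol of $\Omega$ occurs at most once in $t$. **Substitution.** For a repetition-free sequence of symbols $\sigma=(\sigma_1,\dots,\sigma_n)$ and patterns $u=(u_1,\dots,u_n)$ with $\mathrm{rk}(u)=\mathrm{rk}(\sigma)$, $t[\sigma\gets u]$ is obtained from $t$ by replacing, recursively, each subtree $\sigma_i(s_1,\dots,s_k)$ by $u_i$ in which $x_j$ is replaced by the transformed $s_j$ (componentwise on forests). For $\mathcal L=\{B_1,\dots,B_k\}$ with $B_1\cdots B_k$ repetition-free and forests $f(B_i)$ with $\mathrm{rk}(f(B_i))=\mathrm{rk}(B_i)$, $t[B\gets f(B)\mid B\in\mathcal L]$ means $t[B_1\cdots B_k\gets f(B_1)\cdots f(B_k)]$. **MCFTG.** A multiple context-free tree grammar (MCFTG) is $G=(N,\mathcal N,\Sigma,S,R)$ where $N$ is a finite ranked alphabet of nonterminals; $\mathcal N\subseteq N^+$ is a finite set of repetition-free sequences (big nonterminals) with $\mathrm{occ}(A)\ne\mathrm{occ}(A')$ for distinct $A,A'\in\mathcal N$; $\Sigma$ is a finite ranked alphabet of terminals, disjoint from $N$, with $\mathrm{mr}_\Sigma\ge1$; $S\in\mathcal N\cap N^{(0)}$ is the initial nonterminal; $R$ is a finite set of rules $A\to(u,\mathcal L)$ with $A\in\mathcal N$, $u\in P_{N\cup\Sigma}(X)^+$ a uniquely $N$-labeled forest with $\mathrm{rk}(u)=\mathrm{rk}(A)$,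 and $\mathcal L\subseteq\mathcal N$ (the links) such that the sets $\mathrm{occ}(B)$, $B\in\mathcal L$, are pairwise disjoint with union $\mathrm{occ}_N(u)$. The sets $L(G,A)$, $A\in\mathcal N$, are simultaneously the smallest sets of forests such that for every rule $A\to(u,\mathcal L)$ and all $f(B)\in L(G,B)$ ($B\in\mathcal L$), $u[B\gets f(B)\mid B\in\mathcal L]\in L(G,A)$. $L(G)=L(G,S)\subseteq T_\Sigma$. The multiplicity is $\mu(G)=\max\{|A|: A\in\mathcal N\}$; the width is $\theta(G)=\max\{\mathrm{rk}(C): C\in N\}$. Convention: every MCFTG is start-separated, i.e. $S$ does not occur in right-hand sides of rules. **Derivation trees.** For every rule fix a linear order on its links; a rule with $k$ links has rank $k$, so $R$ is a ranked alphabet. The sets $L(G_{\mathrm{der}},A)\subseteq T_R$ are the smallest sets such that $\rho(d_1,\dots,d_k)\in L(G_{\mathrm{der}},A)$ whenever $\rho=A\to(u,\{B_1,\dots,B_k\})\in R$ (links in their order) and $d_i\in L(G_{\mathrm{der}},B_i)$; and $\mathrm{val}(\rho(d_1,\dots,d_k))=u[B_i\gets\mathrm{val}(d_i)\mid 1\le i\le k]$. $L(G_{\mathrm{der}})=L(G_{\mathrm{der}},S)$. **$\mathrm{LDT}^{\mathrm R}$-equivalence.** A linear deterministic top-down tree transducer with regular look-ahead ($\mathrm{LDT}^{\mathrm R}$-transducer) from $\Omega$ to $\Sigma$ has a finite state set $Q$, an initial state $q_0$, and finitely many rules $\langle q,\omega(y_1{:}L_1,\dots,y_k{:}L_k){:}L_0\rangle\to\zeta$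 with $q\in Q$, $\omega\in\Omega^{(k)}$, $L_0,\dots,L_k$ regular tree languages over $\Omega$, and $\zeta$ a tree over $\Sigma$ and rank-0 symbols $\langle q',y_i\rangle$ ($q'\in Q$, $i\in[k]$) in which each $y_i$ occurs at most once; for two distinct rules with the same $q,\omega$ and look-ahead languages $L_i$, $L_i'$ there is $0\le i\le k$ with $L_i\cap L_i'=\emptyset$. For $s=\omega(s_1,\dots,s_k)$, $M_q(s)=\zeta[\langle q',y_i\rangle\gets M_{q'}(s_i)]$ if there is a rule $\langle q,\omega(y_1{:}L_1,\dots,y_k{:}L_k){:}L_0\rangle\to\zeta$ with $s\in L_0$, $s_i\in L_i$ for all $i\in[k]$ (undefined if there is no such rule or some needed $M_{q'}(s_i)$ is undefined); it realizes the partial function $M=M_{q_0}\colon T_\Omega\to T_\Sigma$. MCFTGs $G,G'$ with the same terminal alphabet and rule sets $R,R'$ are $\mathrm{LDT}^{\mathrm R}$-equivalent if there are such transductions $M\colon T_R\to T_{R'}$, $M'\colon T_{R'}\to T_R$ with $M(d)\in L(G'_{\mathrm{der}})$ and $\mathrm{val}(M(d))=\mathrm{val}(d)$ for all $d\in L(G_{\mathrm{der}})$, and $M'(d')\in L(G_{\mathrm{der}})$ and $\mathrm{val}(M'(d'))=\mathrm{val}(d')$ for all $d'\in L(G'_{\mathrm{der}})$ (so $L(G)=L(G')$). **Lexical notions.** For $\Delta\subseteq\Sigma$, $\mathrm{yd}_\Delta(t)$ is the string obtained from the string $t$ by erasing all symbols not in $\Delta$. $G$ has finite $\Delta$-ambiguity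 if $\{t\in L(G):\mathrm{yd}_\Delta(t)=w\}$ is finite for every $w\in\Delta^*$. A rule $A\to(u,\mathcal L)$ is initial if $A=S$, terminal if $\mathcal L=\emptyset$, monic if $|\mathcal L|=1$. $G$ is $\Delta$-growing if the right-hand side of each non-initial terminal rule contains at least two occurrences of symbols of $\Delta$, and the right-hand side of each monic rule contains at least one occurrence of a symbol of $\Delta$. *)

(* Defs.v *)
From Stdlib Require List.
From mathcomp Require Import all_boot.
From mathcomp Require Import classical_sets cardinality.

Set Implicit Arguments.
Unset Strict Implicit.
Unset Printing Implicit Defensive.

Record ralph := Ralph { rsort :> finType; rk : rsort -> nat }.

Inductive tree (A : Type) := Node of A & seq (tree A).

Fixpoint tmap (A B : Type) (f : A -> B) (t : tree A) : tree B :=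
  let: Node a ts := t in Node (f a) (map (tmap f) ts).

(* The tree as a string, in prefix notation. *)
Fixpoint str (A : Type) (t : tree A) : seq A :=
  let: Node a ts := t in a :: flatten (map (@str A) ts).

Definition fstr (A : Type) (u : seq (tree A)) : seq A := flatten (map (@str A) u).

Fixpoint wr (A : Type) (r : A -> nat) (t : tree A) : bool :=
  let: Node a ts := t in (size ts == r a) && all (wr r) ts.

Definition T_ (O : ralph) : set (tree O) := [set t | wr (@rk O) t]%classic.
Arguments T_ : clear implicits.

Definition lefts (A B : Type) (s : seq (A + B)) : seq A :=
  pmap (fun x => if x is inl a then Some a else None) s.
Definition rights (A B : Type) (s : seq (A + B)) : seq B :=
  pmap (fun x => if x is inr b then Some b else None) s.

Definition rank_sum (A B : Type) (ra : A -> nat) (rb : B -> nat) (x : A + B) :=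
  match x with inl a => ra a | inr b => rb b end.

(* In a tree over [A + nat], the label [inr j] is the variable x_(j+1). *)
Definition pattern (A : Type) (r : A -> nat) (k : nat) (t : tree (A + nat)) :=
  wr (rank_sum r (fun=> 0)) t && perm_eq (rights (str t)) (iota 0 k).

(* Replaces the variable x_(j+1) by the j-th tree of [ts]. *)
Fixpoint inst (A : Type) (ts : seq (tree (A + nat))) (t : tree (A + nat)) :=
  let: Node a us := t in
  match a with
  | inl _ => Node a (map (inst ts) us)
  | inr j => nth t ts j
  end.

(* [subst s u t] is t[s <- u]. *)
Fixpoint subst (A : eqType) (s : seq A) (u : seq (tree (A + nat)))
    (t : tree (A + nat)) : tree (A + nat) :=
  let: Node a ts := t in
  let ts' := map (subst s u) ts in
  match a with
  | inl b => if b \in s then inst ts' (nth t u (index b s)) else Node a ts'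
  | inr _ => Node a ts'
  end.

(* Trees over N, Sigma and X; the sum makes the three sets disjoint. *)
Notation ptree N T := (tree (Finite.sort (rsort N) + Finite.sort (rsort T) + nat)%type).

Definition nts (N T : ralph) (u : seq (ptree N T)) : seq N := lefts (lefts (fstr u)).
Definition tms (N T : ralph) (u : seq (ptree N T)) : seq T := rights (lefts (fstr u)).

(* Finite sets of sequences of nonterminals are duplicate-free lists.  The set
   of rules is the finite type [rule]; the list [links r] carries the fixed
   linear order on the links of [r], and [rule_inj] says that distinct elements
   of [rule] are distinct as rules, i.e., regardless of the order of links. *)
Record mcftg (T : ralph) := Mcftg {
  nt : ralph;
  bignt : seq (seq nt);
  start : nt;
  rule : finType;
  lhs : rule -> seq nt;
  rhs : rule -> seq (ptree nt T);
  links : rule -> seq (seq nt);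
  terminal_rank : exists a : T, 0 < rk a;
  bignt_uniq : uniq bignt;
  bignt_neq0 : forall A, A \in bignt -> A != [::];
  bignt_repfree : forall A, A \in bignt -> uniq A;
  bignt_occ : forall A B, A \in bignt -> B \in bignt -> A =i B -> A = B;
  start_bignt : [:: start] \in bignt;
  start_rank : rk start = 0;
  rule_inj : forall r r', lhs r = lhs r' -> rhs r = rhs r' ->
    perm_eq (links r) (links r') -> r = r';
  lhs_bignt : forall r, lhs r \in bignt;
  rhs_pattern : forall r,
    all2 (fun A t => pattern (rank_sum (@rk nt) (@rk T)) (rk A) t) (lhs r) (rhs r);
  rhs_uniq : forall r, uniq (nts (rhs r));
  links_uniq : forall r, uniq (links r);
  links_bignt : forall r, {subset links r <= bignt};
  links_disjoint : forall r, pairwise (fun B C : seq nt => [disjoint B & C]) (links r);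
  links_cover : forall r, flatten (links r) =i nts (rhs r);
  start_separated : forall r, start \notin nts (rhs r)
}.

Arguments start {T} _.
Arguments rule {T} _.
Arguments bignt {T} _.
Arguments nt {T} _.

(* t[B <- f(B) | B in Bs], with [fs] the list of the forests f(B). *)
Definition subst_links (N T : ralph) (Bs : seq (seq N)) (fs : seq (seq (ptree N T)))
    (u : seq (ptree N T)) : seq (ptree N T) :=
  map (subst (map inl (flatten Bs)) (flatten fs)) u.

Inductive lang_from (T : ralph) (G : mcftg T) : seq (nt G) -> seq (ptree (nt G) T) -> Prop :=
| lang_rule (r : rule G) (f : seq (nt G) -> seq (ptree (nt G) T)) :
    (forall B, B \in links r -> lang_from B (f B)) ->
    lang_from (lhs r) (subst_links (links r) (map f (links r)) (rhs r)).

(* A tree over the terminals, as a tree over N, Sigma and X. *)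
Definition emb (N T : ralph) (t : tree T) : ptree N T := tmap (fun a => inl (inr a)) t.

Definition lang (T : ralph) (G : mcftg T) : set (tree T) :=
  [set t | lang_from (G := G) [:: start G] [:: emb (nt G) t]]%classic.
Arguments lang {T} G _.

Definition multiplicity (T : ralph) (G : mcftg T) : nat := \max_(A <- bignt G) size A.
Definition width (T : ralph) (G : mcftg T) : nat := \max_(C : nt G) rk C.

Definition rules_ralph (T : ralph) (G : mcftg T) : ralph :=
  @Ralph (rule G) (fun r => size (links r)).

Inductive der_from (T : ralph) (G : mcftg T) : seq (nt G) -> tree (rules_ralph G) -> Prop :=
| der_rule (r : rules_ralph G) (ds : seq (tree (rules_ralph G))) :
    size ds = size (links r) ->
    (forall i, i < size ds ->
       der_from (nth [::] (links r) i) (nth (Node r [::]) ds i)) ->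
    der_from (lhs r) (Node r ds).

Definition der (T : ralph) (G : mcftg T) : set (tree (rules_ralph G)) :=
  [set d | der_from (G := G) [:: start G] d]%classic.
Arguments der {T} G _.

Fixpoint dval (T : ralph) (G : mcftg T) (d : tree (rules_ralph G)) : seq (ptree (nt G) T) :=
  let: Node r ds := d in subst_links (links r) (map (@dval T G) ds) (rhs r).

(* val(d) = val(d'); the two values live over different nonterminal alphabets
   and are compared as terminal trees. *)
Definition same_val (T : ralph) (G G' : mcftg T)
    (d : tree (rules_ralph G)) (d' : tree (rules_ralph G')) : Prop :=
  exists t : tree T, dval d = [:: emb (nt G) t] /\ dval d' = [:: emb (nt G') t].

Record dfta (O : ralph) := Dfta {
  astate : finType;
  astep : O -> seq astate -> astate;
  afinal : pred astate
}.

Fixpoint arun (O : ralph) (A : dfta O) (t : tree O) : astate A :=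
  let: Node a ts := t in astep a (map (arun A) ts).

(* Recognizability by a deterministic bottom-up finite tree automaton. *)
Definition regular (O : ralph) (L : set (tree O)) : Prop :=
  exists A : dfta O, forall t, L t <-> T_ O t /\ afinal (arun A t).

(* The rule <q, w(y_1:L_1, ..., y_k:L_k):L_0> -> zeta, with [look] the list
   L_0, L_1, ..., L_k; the label [inr (q', i)] in zeta is <q', y_(i+1)>. *)
Record trule (Q : finType) (O T : ralph) := Trule {
  tstate : Q;
  tsym : O;
  look : seq (set (tree O));
  trhs : tree (T + Q * nat)
}.

Record trule_ok (Q : finType) (O T : ralph) (r : trule Q O T) : Prop := {
  look_size : size (look r) = (rk (tsym r)).+1;
  look_regular : forall i, i <= rk (tsym r) -> regular (nth set0 (look r) i);
  trhs_wr : wr (rank_sum (@rk T) (fun=> 0)) (trhs r);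
  trhs_arg : all (fun c => c.2 < rk (tsym r)) (rights (str (trhs r)));
  trhs_linear : uniq (map snd (rights (str (trhs r))))
}.

Record ldtr (O T : ralph) := Ldtr {
  state : finType;
  init : state;
  trules : seq (trule state O T);
  trules_ok : forall r, List.In r trules -> trule_ok r;
  trules_det : forall r r', List.In r trules -> List.In r' trules -> r <> r' ->
    tstate r = tstate r' -> tsym r = tsym r' ->
    exists2 i, i <= rk (tsym r) &
      (nth set0 (look r) i `&` nth set0 (look r') i = set0)%classic
}.

Fixpoint plug (T C : Type) (g : C -> tree T) (z : tree (T + C)) : tree T :=
  let: Node a zs := z in
  match a with
  | inl b => Node b (map (plug g) zs)
  | inr c => g c
  end.

Inductive trans_from (O T : ralph) (M : ldtr O T) : state M -> tree O -> tree T -> Prop :=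
| trans_rule (r : trule (state M) O T) (ss : seq (tree O))
      (g : state M * nat -> tree T) :
    let s := Node (tsym r) ss in
    List.In r (trules M) ->
    nth set0 (look r) 0 s ->
    (forall i, i < rk (tsym r) -> nth set0 (look r) i.+1 (nth s ss i)) ->
    (forall c, c \in rights (str (trhs r)) -> trans_from c.1 (nth s ss c.2) (g c)) ->
    trans_from (tstate r) s (plug g (trhs r)).

Definition trans (O T : ralph) (M : ldtr O T) : tree O -> tree T -> Prop :=
  trans_from (init M).

Definition ldtr_simulated (T : ralph) (G G' : mcftg T) : Prop :=
  exists M : ldtr (rules_ralph G) (rules_ralph G'),
    forall d, der G d -> exists d', [/\ trans M d d', der G' d' & same_val d d'].

Definition ldtr_equivalent (T : ralph) (G G' : mcftg T) : Prop :=
  ldtr_simulated G G' /\ ldtr_simulated G' G.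

Definition yd (T : finType) (D : {set T}) (t : tree T) : seq T :=
  [seq a <- str t | a \in D].

Definition finite_ambiguity (T : ralph) (G : mcftg T) (D : {set T}) : Prop :=
  forall w : seq T, all (mem D) w ->
    finite_set [set t | lang G t /\ yd D t = w]%classic.

Definition growing (T : ralph) (G : mcftg T) (D : {set T}) : Prop :=
  forall r : rule G,
    (lhs r <> [:: start G] -> links r = [::] -> 2 <= count (mem D) (tms (rhs r))) /\
    (size (links r) = 1 -> 1 <= count (mem D) (tms (rhs r))).

(* The model of computation is the language WHILE of N. D. Jones, a
   Turing-complete imperative language over binary trees, in variable-free
   form: a program transforms a single value, in which a store is coded as a
   list, and [Nil] is the only false value. *)
Inductive data := Nil | Cons of data & data.

Inductive prog :=
| PId
| PNil
| PCons of prog & prog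
| PHd
| PTl
| PSeq of prog & prog
| PIf of prog & prog & prog
| PWhile of prog & prog.

Inductive run : prog -> data -> data -> Prop :=
| run_id x : run PId x x
| run_nil x : run PNil x Nil
| run_cons p q x y z : run p x y -> run q x z -> run (PCons p q) x (Cons y z)
| run_hd_cons x y : run PHd (Cons x y) x
| run_hd_nil : run PHd Nil Nil
| run_tl_cons x y : run PTl (Cons x y) y
| run_tl_nil : run PTl Nil Nil
| run_seq p q x y z : run p x y -> run q y z -> run (PSeq p q) x z
| run_if_true c p q x u v y :
    run c x (Cons u v) -> run p x y -> run (PIf c p q) x y
| run_if_false c p q x y : run c x Nil -> run q x y -> run (PIf c p q) x y
| run_while_stop c p x : run c x Nil -> run (PWhile c p) x x
| run_while_step c p x u v y z :
    run c x (Cons u v) -> run p x y -> run (PWhile c p) y z ->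
    run (PWhile c p) x z.

Fixpoint enc_nat (n : nat) : data := if n is m.+1 then Cons Nil (enc_nat m) else Nil.

Definition enc_bool (b : bool) : data := enc_nat b.

Definition enc_list : seq data -> data := foldr Cons Nil.

Definition enc_fin (A : finType) (a : A) : data := enc_nat (enum_rank a).

Fixpoint enc_tree (A : Type) (e : A -> data) (t : tree A) : data :=
  let: Node a ts := t in Cons (e a) (enc_list (map (enc_tree e) ts)).

Definition enc_sym (N T : finType) (x : N + T + nat) : data :=
  match x with
  | inl (inl A) => Cons (enc_nat 0) (enc_fin A)
  | inl (inr a) => Cons (enc_nat 1) (enc_fin a)
  | inr j => Cons (enc_nat 2) (enc_nat j)
  end.

Definition enc_ralph (O : ralph) : data :=
  enc_list [seq enc_nat (rk a) | a <- enum O].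

Definition enc_big (N : finType) (A : seq N) : data := enc_list (map (@enc_fin N) A).

Definition enc_rule (T : ralph) (G : mcftg T) (r : rule G) : data :=
  enc_list [:: enc_big (lhs r);
               enc_list (map (enc_tree (@enc_sym (nt G) T)) (rhs r));
               enc_list (map (@enc_big (nt G)) (links r))].

Definition enc_mcftg (T : ralph) (G : mcftg T) : data :=
  enc_list [:: enc_ralph (nt G);
               enc_list (map (@enc_big (nt G)) (bignt G));
               enc_ralph T;
               enc_fin (start G);
               enc_list (map (@enc_rule T G) (enum (rule G)))].

Record input := Input {
  in_alph : ralph;
  in_gram : mcftg in_alph;
  in_sub : {set in_alph}
}.

Definition enc_input (x : input) : data :=
  Cons (enc_mcftg (in_gram x)) (enc_list [seq enc_fin a | a <- enum (in_sub x)]).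

Definition decidable_pred (I : Type) (enc : I -> data) (P : I -> Prop) : Prop :=
  exists p : prog, forall x : I,
    (P x -> run p (enc x) (enc_bool true)) /\
    (~ P x -> run p (enc x) (enc_bool false)).

(* Main.v *)
Require Import Defs.
From mathcomp Require Import all_boot.
From mathcomp Require Import classical_sets cardinality.
From Stdlib Require List.
From HB Require Import structures.
From mathcomp Require Import zify boolp.

(* A derivation tree carries two additive weights: the number of symbols of
   Delta and the number of terminals in its value.  Finite Delta-ambiguity means
   that the derivation trees of bounded Delta-weight have bounded size.  It fails
   iff some reachable and productive big nonterminal A has a derivation context
   from A to A of Delta-weight 0 and positive size: such a context can be pumped,
   and without one a derivation tree that is minimal for its two weights never
   repeats a pair (big nonterminal, Delta-weight of the subtree) on a path.  The
   existence of such a context is a least fixpoint over a finite set of facts,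
   which a WHILE program computes by iteration.

   For the growing grammar, every subtree of Delta-weight at most 1 is evaluated
   into the rule above it, and a Delta-free rule that then has a single link is
   composed with the rule below it.  The forests that arise are values of partial
   derivation trees, and finite ambiguity bounds their size.  So G' can have all
   rules of bounded size that are realized by a partial derivation tree and
   satisfy the growth conditions, over the nonterminals of G.  One transducer
   expands each rule of G' into a partial derivation tree; the other one
   recognizes the subtrees of Delta-weight at most 1 by look-ahead and keeps in
   its state the Delta-free context that it has not yet output. *)

(** The two halves differ in kind: ambiguity is decided by a program, whereas [G'] is only asked to
    exist, so the size bound, the list of candidate rules and the partial derivation tree behind
    each rule are chosen classically. A cycle of rules without terminals may be repeated at will, so
    bounded values can have infinitely many derivation trees. Hence the passage to minimal trees in
    the bound, and hence the rules of [G'] are indexed by values of partial derivation trees, of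
    which finitely many are small, and not by these trees. The bound is first known for derivation
    trees of the initial nonterminal. A context carries it over to reachable nonterminals, and
    filling the holes carries it over to partial trees, provided that the holes are productive.
    Therefore reachability and productivity accompany the whole contraction. *)

Set Implicit Arguments.
Unset Strict Implicit.
Unset Printing Implicit Defensive.

(** * Functions computed by WHILE programs *)

Class encodable (A : Type) := encode : A -> data.

#[global] Instance encodable_data : encodable data := id.
(** With [Nil] as the code of [tt], a nested pair that ends in [tt] has the code of a heterogeneous
    list, such as those in [enc_rule] and [enc_mcftg]. *)
#[global] Instance encodable_unit : encodable unit := fun=> Defs.Nil.
#[global] Instance encodable_nat : encodable nat := enc_nat.
#[global] Instance encodable_bool : encodable bool := enc_bool.
#[global] Instance encodable_prod (A B : Type) `{encodable A} `{encodable B} :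
  encodable (A * B) := fun x => Defs.Cons (encode x.1) (encode x.2).
#[global] Instance encodable_seq (A : Type) `{encodable A} :
  encodable (seq A) := fun s => enc_list (map encode s).
#[global] Instance encodable_tree (A : Type) `{encodable A} :
  encodable (tree A) := enc_tree encode.

Definition computable (A B : Type) `{encodable A} `{encodable B} (f : A -> B) :=
  exists p, forall a, run p (encode a) (encode (f a)).

Lemma run_const (d : data) : exists p, forall x, run p x d.
Proof.
elim: d => [|x [p Hp] y [q Hq]]; first by exists PNil; constructor.
by exists (PCons p q); constructor.
Qed.

Section Computable.
Context {E A B C : Type} `{encodable E} `{encodable A} `{encodable B} `{encodable C}.

Lemma computable_id : computable (@id A).
Proof. by exists PId => a; constructor. Qed.

Lemma computable_const (b : B) : computable (fun _ : A => b).
Proof.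
by have [p Hp] := run_const (encode b); exists p.
Qed.

Lemma computable_comp (f : A -> B) (g : E -> A) :
  computable f -> computable g -> computable (fun e => f (g e)).
Proof. by move=> [p Hp] [q Hq]; exists (PSeq q p) => e; econstructor. Qed.

Lemma computable_pair (f : E -> A) (g : E -> B) :
  computable f -> computable g -> computable (fun e => (f e, g e)).
Proof. by move=> [p Hp] [q Hq]; exists (PCons p q) => e; constructor. Qed.

Lemma computable_fst (f : E -> A * B) : computable f -> computable (fun e => (f e).1).
Proof.
by move=> [p Hp]; exists (PSeq p PHd) => e; econstructor; [exact: Hp|constructor].
Qed.

Lemma computable_snd (f : E -> A * B) : computable f -> computable (fun e => (f e).2).
Proof.
by move=> [p Hp]; exists (PSeq p PTl) => e; econstructor; [exact: Hp|constructor].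
Qed.

Lemma computable_if (c : E -> bool) (f g : E -> A) :
  computable c -> computable f -> computable g ->
  computable (fun e => if c e then f e else g e).
Proof.
move=> [p Hp] [q Hq] [r Hr]; exists (PIf p q r) => e.
have := Hp e; case: (c e) => /= He.
  by apply: run_if_true He _.
by apply: run_if_false He _.
Qed.

Lemma computable_cons (f : E -> A) (g : E -> seq A) :
  computable f -> computable g -> computable (fun e => f e :: g e).
Proof. by move=> [p Hp] [q Hq]; exists (PCons p q) => e; constructor. Qed.

(** A nonempty list has the same code as the pair of its head and tail. So the code of the list is
    its own test, and the branch runs on the input paired with that code. *)
Lemma computable_seq_case (l : E -> seq A) (f : E -> B) (g : E -> A -> seq A -> B) :
  computable l -> computable f ->
  computable (fun p : E * (A * seq A) => g p.1 p.2.1 p.2.2) ->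
  computable (fun e => if l e is x :: s then g e x s else f e).
Proof.
move=> [p Hp] [q Hq] [r Hr]; exists (PIf p (PSeq (PCons PId p) r) q) => e.
have := Hp e; case: (l e) => [|x s] /= He; first exact: run_if_false He _.
apply: run_if_true (He) _; econstructor; first by constructor; [constructor|exact: He].
exact: (Hr (e, (x, s))).
Qed.

Lemma computable_data_case (l : E -> data) (f : E -> B) (g : E -> data -> data -> B) :
  computable l -> computable f ->
  computable (fun p : E * (data * data) => g p.1 p.2.1 p.2.2) ->
  computable (fun e => if l e is Defs.Cons x s then g e x s else f e).
Proof.
move=> [p Hp] [q Hq] [r Hr]; exists (PIf p (PSeq (PCons PId p) r) q) => e.
have := Hp e; case: (l e) => [|x s] /= He; first exact: run_if_false He _.
apply: run_if_true (He) _; econstructor; first by constructor; [constructor|exact: He].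
exact: (Hr (e, (x, s))).
Qed.

Lemma computable_node (t : E -> tree A) :
  computable t -> computable (fun e => let: Node a ts := t e in (a, ts)).
Proof. by move=> [p Hp]; exists p => e; have := Hp e; case: (t e). Qed.

(** [f] is specified by the unfolding equation of the loop, and the measure provides the induction
    along which the finite execution is built. *)
Lemma computable_while (c : A -> bool) (b f : A -> A) (m : A -> nat) :
  computable c -> computable b ->
  (forall s, f s = if c s then f (b s) else s) ->
  (forall s, c s -> m (b s) < m s) -> computable f.
Proof.
move=> [p Hp] [q Hq] Hf Hm; exists (PWhile p q) => s.
have [n Hn] := ubnP (m s); elim: n s Hn => // n IHn s Hn.
have := Hp s; rewrite Hf; case Hc: (c s) => Hr.
  apply: run_while_step Hr (Hq s) _.
  by apply: IHn; exact: leq_trans (Hm _ Hc) Hn.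
exact: run_while_stop Hr.
Qed.

End Computable.

Ltac computable_core :=
  cbv beta;
  lazymatch goal with
  | |- computable (fun e => e) => apply: computable_id
  | |- computable (fun _ => ?b) => apply: computable_const
  | |- computable (fun e => (@?f e, @?g e)) =>
      apply: (@computable_pair _ _ _ _ _ _ f g)
  | |- computable (fun e => (@?f e).1) => apply: (@computable_fst _ _ _ _ _ _ f)
  | |- computable (fun e => (@?f e).2) => apply: (@computable_snd _ _ _ _ _ _ f)
  | |- computable (fun e => @?f e :: @?g e) => apply: (@computable_cons _ _ _ _ f g)
  | |- computable fst => apply: (@computable_fst _ _ _ _ _ _ id)
  | |- computable snd => apply: (@computable_snd _ _ _ _ _ _ id)
  | |- computable id => apply: computable_id
  end.
Ltac computable := repeat computable_core.

Section Library.
Context {E A B C : Type} `{encodable E} `{encodable A} `{encodable B} `{encodable C}.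

(** Programs have no variables, so the environment travels in the store next to the rest of the list
    and the accumulator. This is the basic loop over lists; operations that build a list fold over
    the reversed list. *)
Lemma computable_foldl (g : E -> B -> A -> B) (z : E -> B) (l : E -> seq A) :
  computable l -> computable z ->
  computable (fun p : E * (B * A) => g p.1 p.2.1 p.2.2) ->
  computable (fun e => foldl (g e) (z e) (l e)).
Proof.
move=> Hl Hz Hg; 
have Hloop : computable (fun s : E * (seq A * B) =>
    (s.1, ([::] : seq A, foldl (g s.1) s.2.2 s.2.1))).
  apply: (@computable_while (E * (seq A * B)) _
    (fun s => if s.2.1 is _ :: _ then true else false)
    (fun s => if s.2.1 is x :: l then (s.1, (l, g s.1 s.2.2 x)) else s) _
    (fun s => size s.2.1)).
  - by apply: computable_seq_case; computable.
  - apply: computable_seq_case; computable.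
    by apply: (computable_comp Hg (g := fun p : (E * (seq A * B)) * (A * seq A) =>
      (p.1.1, (p.1.2.2, p.2.1)))); computable.
  - by move=> [e [[|x l'] z']].
  - by move=> [e [[|x l'] z']] //=.
have : computable (fun e => (fun s : E * (seq A * B) =>
    (s.1, ([::] : seq A, foldl (g s.1) s.2.2 s.2.1)))
    (e, (l e, z e))) by apply: computable_comp Hloop _; computable.
by move=> /computable_snd /computable_snd.
Qed.

Lemma computable_ext (f g : A -> B) : f =1 g -> computable f -> computable g.
Proof. by move=> fg [p Hp]; exists p => a; rewrite -fg. Qed.

Lemma computable_negb (f : A -> bool) : computable f -> computable (fun a => ~~ f a).
Proof. by move=> Hf; apply: computable_if => //; apply: computable_const. Qed.

Lemma computable_andb (f g : A -> bool) :
  computable f -> computable g -> computable (fun a => f a && g a).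
Proof. by move=> Hf Hg; apply: computable_if => //; apply: computable_const. Qed.

Lemma computable_orb (f g : A -> bool) :
  computable f -> computable g -> computable (fun a => f a || g a).
Proof. by move=> Hf Hg; apply: computable_if => //; apply: computable_const. Qed.

End Library.

Ltac computable_bool :=
  lazymatch goal with
  | |- computable (fun e => ~~ @?f e) => apply: (@computable_negb _ _ f)
  | |- computable (fun e => @?f e && @?g e) => apply: (@computable_andb _ _ f g)
  | |- computable (fun e => @?f e || @?g e) => apply: (@computable_orb _ _ f g)
  end.
Ltac computable ::= repeat first [computable_core | computable_bool].

Lemma computable_rev (E A : Type) `{encodable E} `{encodable A} (l : E -> seq A) :
  computable l -> computable (fun e => rev (l e)).
Proof.
move=> Hl; apply: (@computable_ext _ _ _ _ (fun e => foldl (fun s x => x :: s) [::] (l e))).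
  by move=> e; rewrite /rev; elim: (l e) [::] => //=.
by apply: computable_foldl => //; computable.
Qed.

Lemma computable_cat (E A : Type) `{encodable E} `{encodable A} (l m : E -> seq A) :
  computable l -> computable m -> computable (fun e => l e ++ m e).
Proof.
move=> Hl Hm.
apply: (@computable_ext _ _ _ _ (fun e => foldl (fun s x => x :: s) (m e) (rev (l e)))).
  by move=> e; rewrite foldl_rev; elim: (l e) => //= x s ->.
by apply: computable_foldl => //; [exact: computable_rev|computable].
Qed.

Section Sequences.
Context {E A B : Type} `{encodable E} `{encodable A} `{encodable B}.

Lemma computable_map (f : E -> A -> B) (l : E -> seq A) :
  computable l -> computable (fun p : E * A => f p.1 p.2) ->
  computable (fun e => map (f e) (l e)).
Proof.
move=> Hl Hf.
apply: (@computable_ext _ _ _ _ (fun e => foldl (fun s x => f e x :: s) [::] (rev (l e)))).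
  by move=> e; rewrite foldl_rev; elim: (l e) => //= x s ->.
apply: computable_foldl; [exact: computable_rev|computable|computable].
by apply: (computable_comp Hf (g := fun p : E * (seq B * A) => (p.1, p.2.2))); computable.
Qed.

Lemma computable_filter (f : E -> A -> bool) (l : E -> seq A) :
  computable l -> computable (fun p : E * A => f p.1 p.2) ->
  computable (fun e => filter (f e) (l e)).
Proof.
move=> Hl Hf.
apply: (@computable_ext _ _ _ _
  (fun e => foldl (fun s x => if f e x then x :: s else s) [::] (rev (l e)))).
  by move=> e; rewrite foldl_rev; elim: (l e) => //= x s ->.
apply: computable_foldl; [exact: computable_rev|computable|].
apply: computable_if; try by computable.
by apply: (computable_comp Hf (g := fun p : E * (seq A * A) => (p.1, p.2.2))); computable.
Qed.

Lemma computable_has (f : E -> A -> bool) (l : E -> seq A) :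
  computable l -> computable (fun p : E * A => f p.1 p.2) ->
  computable (fun e => has (f e) (l e)).
Proof.
move=> Hl Hf.
apply: (@computable_ext _ _ _ _ (fun e => foldl (fun s x => f e x || s) false (rev (l e)))).
  by move=> e; rewrite foldl_rev; elim: (l e) => //= x s ->.
apply: computable_foldl; [exact: computable_rev|computable|computable].
by apply: (computable_comp Hf (g := fun p : E * (bool * A) => (p.1, p.2.2))); computable.
Qed.

Lemma computable_all (f : E -> A -> bool) (l : E -> seq A) :
  computable l -> computable (fun p : E * A => f p.1 p.2) ->
  computable (fun e => all (f e) (l e)).
Proof.
move=> Hl Hf.
apply: (@computable_ext _ _ _ _ (fun e => ~~ has (fun x => ~~ f e x) (l e))).
  by move=> e; rewrite -all_predC; apply: eq_all => x /=; rewrite negbK.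
by computable; apply: computable_has => //; computable.
Qed.

Lemma computable_flatten (l : E -> seq (seq A)) :
  computable l -> computable (fun e => flatten (l e)).
Proof.
move=> Hl.
apply: (@computable_ext _ _ _ _ (fun e => foldl (fun s x => x ++ s) [::] (rev (l e)))).
  by move=> e; rewrite foldl_rev.
apply: computable_foldl; [exact: computable_rev|computable|].
by apply: computable_cat; computable.
Qed.

Lemma computable_fstr (l : E -> seq (tree A)) :
  computable l -> computable (fun e => fstr (l e)).
Proof.
move=> Hl; 
(* The tree recursion runs on an explicit stack of forests and collects the labels in reverse.
   Reading a label replaces one forest by two, the children and the right siblings, with one node
   less in total. Weighting a forest by twice its size plus one makes this step decrease the
   measure, and also the removal of an empty forest. *)
pose step (s : seq (seq (tree A)) * seq A) : seq (seq (tree A)) * seq A :=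
  if s.1 is u :: us then
    if u is t :: ts then
      (((let: Node a vs := t in (a, vs)).2 :: ts :: us),
       (let: Node a vs := t in (a, vs)).1 :: s.2)
    else (us, s.2)
  else s.
pose m (u : seq (tree A)) := (size (fstr u)).*2.+1.
have Hloop : computable (fun s : seq (seq (tree A)) * seq A => ([::] : seq (seq (tree A)),
    rev (flatten (map (@fstr A) s.1)) ++ s.2)); last first.
  have Hl' : computable (fun e => ([:: l e], [::]) : seq (seq (tree A)) * seq A) by computable.
  move: (computable_comp Hloop Hl') => /computable_snd /computable_rev.
  by apply: computable_ext => e; rewrite /= !cats0 revK.
apply: (@computable_while (seq (seq (tree A)) * seq A) _
  (fun s => if s.1 is _ :: _ then true else false) step _
  (fun s => sumn (map m s.1))).
- by apply: computable_seq_case; computable.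
- apply: computable_seq_case; computable.
  eapply computable_seq_case; computable; apply: computable_node; computable.
- case=> [[|[|[a vs] ts] us] acc] //=.
  by rewrite /fstr /= rev_cons cat_rcons catA.
- case=> [[|[|[a vs] ts] us] acc] //= _; rewrite /m /fstr /= ?size_cat.
  by lia.
Qed.

End Sequences.

Fixpoint data_eqb (x y : data) : bool :=
  match x, y with
  | Defs.Nil, Defs.Nil => true
  | Defs.Cons a b, Defs.Cons c d => data_eqb a c && data_eqb b d
  | _, _ => false
  end.

Lemma data_eqP : Equality.axiom data_eqb.
Proof.
elim=> [|a IHa b IHb] [|c d] /=; try by constructor.
by apply: (iffP andP) => [[/IHa -> /IHb ->]|[/IHa -> /IHb ->]].
Qed.

Fixpoint data_size (x : data) : nat :=
  if x is Defs.Cons a b then (data_size a + data_size b).+1 else 1.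

(** A work list of pairs replaces the double recursion, and a mismatch empties it. A leaf has size
    1, so discarding two equal leaves also decreases the measure. *)
Lemma computable_data_eqb : computable (fun p : data * data => data_eqb p.1 p.2).
Proof.
pose step (s : seq (data * data) * bool) : seq (data * data) * bool :=
  if s.1 is p :: ps then
    if p.1 is Defs.Cons a b then
      if p.2 is Defs.Cons c d then ((a, c) :: (b, d) :: ps, s.2) else ([::], false)
    else if p.2 is Defs.Cons c d then ([::], false) else (ps, s.2)
  else s.
have Hloop : computable (fun s : seq (data * data) * bool => ([::] : seq (data * data),
    s.2 && all (fun p => data_eqb p.1 p.2) s.1)); last first.
  have Hp : computable (fun p => ([:: p], true) : seq (data * data) * bool) by computable.
  move: (computable_comp Hloop Hp) => /computable_snd.
  by apply: computable_ext => p; rewrite /= andbT.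
apply: (@computable_while (seq (data * data) * bool) _
  (fun s => if s.1 is _ :: _ then true else false) step _
  (fun s => sumn [seq (data_size p.1 + data_size p.2) | p <- s.1])).
- by apply: computable_seq_case; computable.
- by repeat (first [eapply computable_seq_case|eapply computable_data_case]; computable).
- by case=> [[|[[|a b] [|c d]] ps] [|]] //=; rewrite ?andbA.
- by case=> [[|[[|a b] [|c d]] ps] acc] //= _;
    rewrite /= ?addnA; lia.
Qed.

Lemma computable_eq (E : Type) (A : eqType) `{encodable E} `{encodable A}
    (f g : E -> A) :
  injective (@encode A _) -> computable f -> computable g -> computable (fun e => f e == g e).
Proof.
move=> inj [p Hp] [q Hq].
have [r Hr] : computable (fun e => data_eqb (encode (f e)) (encode (g e))).
  apply: (computable_comp computable_data_eqb (g := fun e => (encode (f e), encode (g e)))).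
  by exists (PCons p q) => e; constructor; [exact: Hp|exact: Hq].
exists r => e; have -> // : (f e == g e) = data_eqb (encode (f e)) (encode (g e)).
by apply/idP/idP => [/eqP ->|/data_eqP /inj ->]; [exact/data_eqP|exact: eqxx].
Qed.

Lemma computable_mem (E : Type) (A : eqType) `{encodable E} `{encodable A}
    (f : E -> A) (l : E -> seq A) : injective (@encode A _) ->
  computable f -> computable l -> computable (fun e => f e \in l e).
Proof.
move=> inj Hf Hl; apply: (@computable_ext _ _ _ _ (fun e => has (eq_op^~ (f e)) (l e))).
  by move=> e; rewrite -has_pred1; apply: eq_has => x.
apply: computable_has => //; apply: computable_eq => //; computable.
by apply: computable_comp => //; computable.
Qed.

Lemma encode_nat_inj : injective (@encode nat _).
Proof. by elim=> [|m IHm] [|n] //= [/IHm ->]. Qed.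

Lemma encode_prod_inj (A B : Type) (eA : encodable A) (eB : encodable B) :
  injective (@encode A _) -> injective (@encode B _) -> injective (@encode (A * B) _).
Proof. by move=> iA iB [a b] [c d] [/iA /= -> /iB /= ->]. Qed.

Lemma encode_seq_inj (A : Type) (eA : encodable A) :
  injective (@encode A _) -> injective (@encode (seq A) _).
Proof. by move=> iA; elim=> [|a s IHs] [|b t] //= [/iA -> /IHs ->]. Qed.

(** * Weighted regular tree grammars *)

(** Equality and choice on trees are classical. They give access to membership in lists of trees and
    to the finite types [seq_sub] of triples. *)
HB.instance Definition _ (A : Type) := gen_eqMixin (tree A).
HB.instance Definition _ (A : Type) := gen_choiceMixin (tree A).

Lemma tree_nested_ind (A : Type) (P : tree A -> Prop) :
  (forall a ts, {in ts, forall t, P t} -> P (Node a ts)) -> forall t, P t.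
Proof.
move=> IH; fix rec 1 => -[a ts]; apply: IH.
have: foldr (fun t Q => P t /\ Q) True ts.
  by elim: ts => [|t ts IHts]; [exact: I|split; [exact: rec|exact: IHts]].
clear rec; elim: ts => [|t ts IHts] //= [Pt Pts] u; rewrite in_cons => /predU1P[-> //|].
exact: IHts.
Qed.

Section RegularTreeGrammars.
Variables (R : finType) (V : eqType) (lhs : R -> V) (links : R -> seq V).
Implicit Types (r : R) (A B : V) (d e : tree R) (f : R -> nat).

Definition dtop d := let: Node r _ := d in lhs r.

Fixpoint dwf d : bool :=
  let: Node r ds := d in (map dtop ds == links r) && all dwf ds.

Fixpoint dsum f d : nat := let: Node r ds := d in f r + sumn (map (dsum f) ds).

Lemma dwf_node r ds1 d ds2 : dwf (Node r (ds1 ++ d :: ds2)) =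
  [&& map dtop ds1 ++ dtop d :: map dtop ds2 == links r, all dwf ds1, dwf d & all dwf ds2].
Proof. by rewrite /= map_cat all_cat. Qed.

Lemma dsum_node f r ds1 d ds2 : dsum f (Node r (ds1 ++ d :: ds2)) =
  f r + sumn (map (dsum f) ds1) + sumn (map (dsum f) ds2) + dsum f d.
Proof. by rewrite /= map_cat sumn_cat /=; lia. Qed.

Variables wD wS : R -> nat.

(** A derivation context is represented by its end points and its two weights alone, which is all
    that composing, plugging and pumping depend on. *)
Inductive ctx : V -> V -> nat -> nat -> Prop :=
| ctx_refl A : ctx A A 0 0
| ctx_step r ds1 B ds2 C x y :
    map dtop ds1 ++ B :: map dtop ds2 = links r -> all dwf ds1 -> all dwf ds2 ->
    ctx B C x y ->
    ctx (lhs r) C (wD r + sumn (map (dsum wD) ds1) + sumn (map (dsum wD) ds2) + x)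
      (wS r + sumn (map (dsum wS) ds1) + sumn (map (dsum wS) ds2) + y).

Lemma ctx_trans A B C x y x' y' :
  ctx A B x y -> ctx B C x' y' -> ctx A C (x + x') (y + y').
Proof.
move=> HAB HBC; elim: HAB HBC => // r ds1 B' ds2 B'' x1 y1 e1 w1 w2 _ IH /IH HC.
by rewrite -!(addnA _ x1) -!(addnA _ y1); apply: ctx_step HC.
Qed.

Lemma ctx_child r ds1 d ds2 : dwf (Node r (ds1 ++ d :: ds2)) ->
  exists x y, [/\ ctx (lhs r) (dtop d) x y,
    dsum wD (Node r (ds1 ++ d :: ds2)) = x + dsum wD d &
    dsum wS (Node r (ds1 ++ d :: ds2)) = y + dsum wS d].
Proof.
rewrite dwf_node => /and4P[/eqP e1 w1 _ w2]; rewrite !dsum_node.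
have := ctx_step e1 w1 w2 (ctx_refl _); rewrite !addn0 => H.
by do 2!eexists; split; first exact: H.
Qed.

Lemma ctx_plug A x y d : ctx A (dtop d) x y -> dwf d ->
  exists e, [/\ dwf e, dtop e = A, dsum wD e = x + dsum wD d & dsum wS e = y + dsum wS d].
Proof.
move=> H wd; have [B eB] : {B | B = dtop d} by exists (dtop d).
rewrite -eB in H; elim: H eB => [B'|r ds1 B' ds2 C x1 y1 e1 w1 w2 _ IH] eB; first by exists d.
have [e [we te De Se]] := IH eB.
exists (Node r (ds1 ++ e :: ds2)); rewrite !dsum_node De Se; split=> //; try by lia.
by rewrite dwf_node te e1 eqxx w1 we.
Qed.

(** The weights do not bound the number of rules, because a context may have both weights 0.
    Minimality in the number of rules excludes such detours without changing the weights. *)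
Definition dmin d := forall d', dwf d' -> dtop d' = dtop d ->
  dsum wD d' = dsum wD d -> dsum wS d' = dsum wS d -> dsum (fun=> 1) d <= dsum (fun=> 1) d'.

Lemma dmin_exists d : dwf d -> exists d', [/\ dwf d', dmin d', dtop d' = dtop d,
  dsum wD d' = dsum wD d & dsum wS d' = dsum wS d].
Proof.
have [n] := ubnP (dsum (fun=> 1) d); elim: n d => // n IH d lt_n wd.
have [|] := pselect (dmin d); first by exists d.
move=> /existsNP[d' /not_implyP[wd' /not_implyP[td' /not_implyP[Dd' /not_implyP[Sd']]]]].
move=> /negP; rewrite -ltnNge => lt_d'.
by have [|e [we me te De Se]] := IH d' _ wd'; [lia|exists e; split=> //; congruence].
Qed.

Lemma dmin_child r ds1 d ds2 : dwf (Node r (ds1 ++ d :: ds2)) ->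
  dmin (Node r (ds1 ++ d :: ds2)) -> dmin d.
Proof.
rewrite dwf_node => /and4P[e1 w1 wd w2] m d' wd' td' Dd' Sd'.
have := m (Node r (ds1 ++ d' :: ds2)); rewrite dwf_node td' e1 w1 wd' !dsum_node Dd' Sd'.
by rewrite leq_add2l; apply.
Qed.

Definition reachable S A := exists x y, ctx S A x y.
Definition productive A := exists2 d, dwf d & dtop d = A.

Definition pumpable S := exists A y,
  [/\ reachable S A, productive A, ctx A A 0 y & 0 < y].

Definition weight_bounded S := forall K, exists n, forall d,
  dwf d -> dtop d = S -> dsum wD d <= K -> dsum wS d <= n.

Lemma reachable_child S r ds1 d ds2 : dwf (Node r (ds1 ++ d :: ds2)) ->
  reachable S (lhs r) -> reachable S (dtop d).
Proof.
move=> /ctx_child[x [y [c _ _]]] [x' [y' c']].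
by exists (x' + x), (y' + y); apply: ctx_trans c' c.
Qed.

Lemma pumpable_unbounded S : pumpable S -> ~ weight_bounded S.
Proof.
move=> [A [y [[x0 [y0 cS]] [d wd tA] cA y_gt0]]] bd.
have pump n : exists e, [/\ dwf e, dtop e = A, dsum wD e = dsum wD d & n <= dsum wS e].
  elim: n => [|n [e [we te De Se]]]; first by exists d.
  have [|e' [we' te' De' Se']] := @ctx_plug A 0 y e _ we; first by rewrite te.
  by exists e'; split=> //; [rewrite De'|lia].
have [n Hn] := bd (x0 + dsum wD d); have [e [we te De Se]] := pump n.+1.
have [|e' [we' te' De' Se']] := @ctx_plug S x0 y0 e _ we; first by rewrite te.
by have := Hn e' we' te'; rewrite De' De Se'; lia.
Qed.

Section Bound.
Variables (Vs : seq V) (S : V) (K : nat).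
Hypothesis lhs_Vs : forall r, lhs r \in Vs.
Hypothesis no_pump : ~ pumpable S.

Let w := \max_r wS r.
Let a := \max_r size (links r).
Let bound := fix bound n := if n is m.+1 then w + a * bound m else 0.

(* The pair recorded for an ancestor [e] consists of its nonterminal and its
   [wD]-weight.  It cannot recur below [e]: the context in between would have
   [wD]-weight 0, hence [wS]-weight 0 for want of pumping, and cutting it out
   would contradict the minimality of [e]. *)
Let ancestor d (h : V * nat) := exists e y,
  [/\ dmin e, dtop e = h.1, dsum wD e = h.2 & h.2 <= K] /\
  [/\ ctx h.1 (dtop d) (h.2 - dsum wD d) y, dsum wS e = y + dsum wS d,
      dsum wD d <= h.2 & dsum (fun=> 1) d < dsum (fun=> 1) e].

(** The pairs of the proper ancestors are distinct elements of a set of size [size Vs * K.+1]. So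
    [n] bounds the pairs still available further down and plays the role of a height: [bound n] is
    the usual estimate for trees with at most [n] levels, at most [a] children per node and weight
    at most [w] per rule. *)
Lemma minimal_bound n d (hist : seq (V * nat)) :
  dwf d -> dmin d -> reachable S (dtop d) -> dsum wD d <= K -> uniq hist ->
  (forall h, h \in hist -> ancestor d h) ->
  size Vs * K.+1 <= size hist + n -> dsum wS d <= bound n.
Proof.
elim: n d hist => [|n IHn] d hist wd md rd Kd uh ah szh.
  all: have newh : (dtop d, dsum wD d) \notin hist.
  1,3: apply/negP => /ah[e [y [[me te De _] [c Se _]]]] /=; rewrite subnn in c.
  1,2: have y0 : y = 0.
  1,3: by have [//|y_gt0] := posnP y; case: no_pump; exists (dtop d), y; split=> //;
         exists d.
  1,2: by apply/negP; rewrite -leqNgt; apply: me; rewrite // Se y0.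
(* For [n = 0] the history already exhausts all pairs, and the current pair, which is new, is one
   too many. *)
- have sub : {subset (dtop d, dsum wD d) :: hist <=
      [seq (A, k) | A <- Vs, k <- iota 0 K.+1]}.
    have top_Vs e : dtop e \in Vs by case: e => r ds; exact: lhs_Vs.
    move=> h; rewrite in_cons => /predU1P[->|/ah[e [y [[_ te _ leK] _]]]].
      by apply: allpairs_f => //; rewrite mem_iota.
    by rewrite [h]surjective_pairing -te; apply: allpairs_f => //; rewrite mem_iota.
  have := uniq_leq_size _ sub; rewrite size_allpairs size_iota cons_uniq newh uh.
  by move=> /(_ isT) /=; lia.
case: d wd md rd Kd ah newh => r ds wd md rd Kd ah newh.
have bd d : d \in ds -> dsum wS d <= bound n.
  move=> d_ds; have [ds1 [ds2 eds]] : exists ds1 ds2, ds = ds1 ++ d :: ds2.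
    by case/splitPr: d_ds => ds1 ds2; exists ds1, ds2.
  rewrite {d_ds}eds in wd md rd Kd ah newh *.
  have [x [y [c Dx Sy]]] := ctx_child wd.
  have wd' : dwf d by move: wd; rewrite dwf_node => /and4P[].
  have nd := dsum_node (fun=> 1) r ds1 d ds2.
  apply: (IHn d ((lhs r, dsum wD (Node r (ds1 ++ d :: ds2))) :: hist)) => //.
  - exact: dmin_child md.
  - exact: reachable_child wd rd.
  - by lia.
  - by rewrite /= newh.
  - move=> h; rewrite in_cons => /predU1P[->|].
      exists (Node r (ds1 ++ d :: ds2)), y; split; split=> //.
      - by rewrite /fst /snd Dx addnK.
      - by rewrite /snd Dx leq_addl.
      - by rewrite nd; lia.
    move=> /ah[e [z [[me te De leK] [c' Se leh lt_e]]]]; exists e, (z + y).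
    split; split=> //; try by lia.
    have -> : h.2 - dsum wD d = h.2 - dsum wD (Node r (ds1 ++ d :: ds2)) + x.
      have aux u v w' : v + w' <= u -> u - w' = u - (v + w') + v by lia.
      by move: leh; rewrite Dx; apply: aux.
    exact: ctx_trans c' c.
  - by rewrite /= addSnnS.
rewrite /=; apply: leq_add; first exact: (leq_bigmax r).
apply: (@leq_trans (size ds * bound n)).
  by elim: ds bd {wd md rd Kd ah newh} => //= d ds IHds bd; rewrite mulSn leq_add //;
    [apply: bd; rewrite mem_head|apply: IHds => e e_ds; apply: bd; rewrite in_cons e_ds orbT].
rewrite leq_mul2r; apply/orP; right.
by case/andP: wd => /eqP/(congr1 size); rewrite size_map => -> _; exact: (leq_bigmax r).
Qed.

End Bound.

Theorem unbounded_pumpable (Vs : seq V) S : (forall r, lhs r \in Vs) ->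
  ~ pumpable S -> weight_bounded S.
Proof.
move=> lhs_Vs np K.
exists ((fix bound n := if n is m.+1 then
  \max_r wS r + (\max_r size (links r)) * bound m else 0) (size Vs * K.+1)).
(* The minimal tree has both weights of [d], so its bound is a bound for [d]. *)
move=> d wd td Kd; have [d' [wd' md' td' De <-]] := dmin_exists wd.
apply: (@minimal_bound Vs S K _ _ _ _ [::]) => //; last by rewrite De.
by exists 0, 0; rewrite td' td; exact: ctx_refl.
Qed.

End RegularTreeGrammars.

(** * Deciding pumpability *)

Section Saturation.
Variables (T : eqType) (univ : seq T) (cond : seq T -> pred T).
Hypothesis cond_mono : forall F F' x, {subset F <= F'} -> cond F x -> cond F' x.

(** Folding over [univ] makes its length the number of rounds, so the fixpoint iteration is a plain
    [foldl] and needs no test for stability. *)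
Definition saturate : seq T :=
  foldl (fun F _ => [seq x <- univ | cond F x]) [::] univ.

Let stage n := iter n (fun F => [seq x <- univ | cond F x]) [::].

Lemma saturateE : saturate = stage (size univ).
Proof.
have E (s : seq T) g (F : seq T) : foldl (fun F _ => g F) F s = iter (size s) g F.
  by elim: s F => //= x s IHs F; rewrite IHs -iterSr.
exact: E.
Qed.

Lemma saturate_ind (P : T -> Prop) :
  (forall F, {in F, forall x, P x} -> forall x, cond F x -> P x) ->
  {in saturate, forall x, P x}.
Proof.
move=> IH; rewrite saturateE; elim: (size univ) => // n IHn x /=.
by rewrite mem_filter => /andP[cx _]; apply: IH cx.
Qed.

Let stage_sub n : {subset stage n <= stage n.+1}.
Proof.
elim: n => [|n IHn] //= x; rewrite !mem_filter => /andP[cx ->]; rewrite andbT.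
exact: cond_mono cx.
Qed.

(** A round that is not yet stable puts at least one more position of [univ] into the stage.
    Counting positions of [univ] works also when lists have repetitions. *)
Let stage_grows n : {subset stage n.+1 <= stage n} \/ n < count (mem (stage n.+1)) univ.
Proof.
have grow m : ~ {subset stage m.+1 <= stage m} ->
    count (mem (stage m)) univ < count (mem (stage m.+1)) univ.
  move=> /existsNP[x /not_implyP[x1 /negP x0]].
  rewrite -[X in _ < X]size_filter -(count_predC (mem (stage m))) count_filter.
  have -> : count (predI (mem (stage m)) (mem (stage m.+1))) univ = count (mem (stage m)) univ.
    by apply: eq_count => y; apply: (@andb_idr (y \in stage m)); exact: stage_sub.
  rewrite -[ltnLHS]addn0 ltn_add2l -has_count; apply/hasP; exists x => //.
  by rewrite mem_filter /= x1; move: x1; rewrite mem_filter => /andP[].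
elim: n => [|n IHn].
  have [|nsub] := pselect {subset stage 1 <= stage 0}; first by left.
  by right; exact: leq_ltn_trans (grow 0 nsub).
have [|nsub] := pselect {subset stage n.+2 <= stage n.+1}; first by left.
right; apply: leq_ltn_trans (grow n.+1 nsub).
case: IHn => // sub; case: nsub => x.
by rewrite [x \in stage n.+2]mem_filter [x \in stage n.+1]mem_filter => /andP[cx ->];
  rewrite andbT; exact: cond_mono cx.
Qed.

Lemma saturate_closed x : x \in univ -> cond saturate x -> x \in saturate.
Proof.
rewrite saturateE => ux cx; case: (stage_grows (size univ)) => [|lt_n].
  by apply; rewrite /= mem_filter cx.
by have := leq_trans lt_n (count_size _ _); rewrite ltnn.
Qed.

End Saturation.

Notation fact V := (nat * (V * V))%type.

(* The facts (k, (a, b)) stand for: b is productive (0); b has a derivation of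
   wD-weight 0 (1), even with positive wS-weight (2); a is productive and
   occurs in a derivation context of b (3), of wD-weight 0 (4), even with
   positive wS-weight (5). *)
Definition rule_infers (V : eqType) (f : nat -> V -> bool) (k : nat)
    (r : seq V * (bool * bool)) : bool :=
  [|| (k == 0) && all (f 0) r.1,
      (k == 1) && (~~ r.2.1 && all (f 1) r.1),
      (k == 2) && (~~ r.2.1 && (all (f 1) r.1 && (r.2.2 || has (f 2) r.1))),
      (k == 3) && has (fun B => f 3 B && all (fun C => (C == B) || f 0 C) r.1) r.1,
      (k == 4) && (~~ r.2.1 &&
        has (fun B => f 4 B && all (fun C => (C == B) || f 1 C) r.1) r.1) |
      (k == 5) && (~~ r.2.1 &&
        has (fun B => (f 5 B || f 4 B && (r.2.2 || has (fun C => (C != B) && f 2 C) r.1)) &&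
                      all (fun C => (C == B) || f 1 C) r.1) r.1)].

(** The two axioms describe the empty context. Of a grammar rule only the left-hand side, the links
    and the signs of the weights matter, since the facts ask whether a weight is zero, never how
    large it is. *)
Definition infers (V : eqType) (rs : seq (V * (seq V * (bool * bool))))
    (F : seq (fact V)) (x : fact V) : bool :=
  [|| (x.1 == 4) && (x.2.1 == x.2.2),
      (x.1 == 3) && ((x.2.1 == x.2.2) && ((0, (x.2.1, x.2.1)) \in F)) |
      has (fun r => (r.1 == x.2.2) &&
                    rule_infers (fun k B => (k, (x.2.1, B)) \in F) x.1 r.2) rs].

Definition facts (V : eqType) (Vs : seq V) : seq (fact V) :=
  flatten [seq flatten [seq [seq (k, (a, b)) | b <- Vs] | a <- Vs] | k <- iota 0 6].

Definition pumps (V : eqType) (rs : seq (V * (seq V * (bool * bool)))) (Vs : seq V)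
    (S : V) : bool :=
  has (fun a => ((3, (a, S)) \in saturate (facts Vs) (infers rs)) &&
                ((5, (a, a)) \in saturate (facts Vs) (infers rs))) Vs.

Lemma mem_facts (V : eqType) (Vs : seq V) k a b :
  k < 6 -> a \in Vs -> b \in Vs -> (k, (a, b)) \in facts Vs.
Proof.
move=> k6 Va Vb; apply/flattenP; eexists; first by apply: map_f; rewrite mem_iota; exact: k6.
apply/flattenP; eexists; first by apply: map_f; exact: Va.
by apply/mapP; exists b.
Qed.

Lemma rule_infers_mono (V : eqType) (f f' : nat -> V -> bool) k r :
  (forall k B, f k B -> f' k B) -> rule_infers f k r -> rule_infers f' k r.
Proof.
move=> sub; have sub1 B0 k' : subpred (fun C => (C == B0) || f k' C)
    (fun C => (C == B0) || f' k' C) by move=> C /orP[->//|/sub ->]; rewrite orbT.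
move=> /or4P[/andP[k0 h]|/andP[k1 /andP[d h]]|/andP[k2 /and3P[d h h']]|
  /or3P[/andP[k3 h]|/andP[k4 /andP[d h]]|/andP[k5 /andP[d h]]]]; apply/or4P.
- by apply/Or41; rewrite k0 (sub_all (sub 0)).
- by apply/Or42; rewrite k1 d (sub_all (sub 1)).
- apply/Or43; rewrite k2 d (sub_all (sub 1)) //=.
  by case/orP: h' => [->//|/(sub_has (sub 2)) ->]; rewrite orbT.
- apply/Or44/or3P/Or31; rewrite k3; apply: sub_has h => B /andP[/sub -> /=].
  exact: sub_all.
- apply/Or44/or3P/Or32; rewrite k4 d; apply: sub_has h => B /andP[/sub -> /=].
  exact: sub_all.
- apply/Or44/or3P/Or33; rewrite k5 d; apply: sub_has h => B /andP[h /(sub_all (sub1 _ _)) ->].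
  rewrite andbT; case/orP: h => [/sub ->//|/andP[/sub -> h]]; apply/orP; right.
  case/orP: h => [->//|h]; apply/orP; right; apply: sub_has h => C /andP[-> /sub].
  exact.
Qed.

Lemma infers_mono (V : eqType) (rs : seq (V * (seq V * (bool * bool))))
    (F F' : seq (fact V)) x : {subset F <= F'} -> infers rs F x -> infers rs F' x.
Proof.
move=> sub /or3P[h|/and3P[h1 h2 /sub h3]|h]; apply/or3P; [exact: Or31|apply: Or32|apply: Or33].
  by rewrite h1 h2 h3.
by apply: sub_has h => r /andP[-> h]; apply: rule_infers_mono h => k B; exact: sub.
Qed.

Lemma sumn_map_eq0 (R : finType) (f : tree R -> nat) (ds : seq (tree R)) :
  {in ds, forall d, f d = 0} -> sumn (map f ds) = 0.
Proof.
by elim: ds => //= d ds IH H; rewrite H ?mem_head ?IH // => e He; rewrite H // in_cons He orbT.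
Qed.

Lemma sumn_map_gt0 (R : finType) (f : tree R -> nat) (ds : seq (tree R)) d :
  d \in ds -> 0 < f d -> 0 < sumn (map f ds).
Proof. by case/splitPr => ds1 ds2 Hd; rewrite map_cat sumn_cat /=; lia. Qed.

Lemma sumn_map_le (R : finType) (f : tree R -> nat) (ds : seq (tree R)) d :
  d \in ds -> f d <= sumn (map f ds).
Proof. by case/splitPr => ds1 ds2; rewrite map_cat sumn_cat /=; lia. Qed.

Lemma sumn_map_gt0P (R : finType) (f : tree R -> nat) (ds : seq (tree R)) :
  0 < sumn (map f ds) -> exists2 d, d \in ds & 0 < f d.
Proof.
elim: ds => //= d ds IH; case: (posnP (f d)) => [->|f_gt0 _].
  by move=> /IH[e He Hf]; exists e => //; rewrite in_cons He orbT.
by exists d => //; rewrite mem_head.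
Qed.

Section Decision.
Variables (R : finType) (V : eqType) (lhs : R -> V) (links : R -> seq V) (wD wS : R -> nat).
Variables (Vs : seq V) (S : V).
Hypotheses (links_uniq : forall r, uniq (links r)) (S_Vs : S \in Vs).
Hypotheses (lhs_Vs : forall r, lhs r \in Vs) (links_Vs : forall r, {subset links r <= Vs}).

Let rs := [seq (lhs r, (links r, (0 < wD r, 0 < wS r))) | r <- enum R].
Let der d A := dwf lhs links d /\ dtop lhs d = A.
Let dctx := ctx lhs links wD wS.

Definition fact_holds (x : fact V) : Prop :=
  let: (k, (a, b)) := x in
  match k with
  | 0 => exists d, der d b
  | 1 => exists d, der d b /\ dsum wD d = 0
  | 2 => exists d, der d b /\ (dsum wD d = 0 /\ 0 < dsum wS d)
  | 3 => (exists d, der d a) /\ exists x y, dctx b a x y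
  | 4 => exists y, dctx b a 0 y
  | 5 => exists y, dctx b a 0 y /\ 0 < y
  | _ => False
  end.

Lemma choose_children (P : tree R -> Prop) Bs :
  {in Bs, forall B, exists d, der d B /\ P d} ->
  exists ds, [/\ map (dtop lhs) ds = Bs, all (dwf lhs links) ds & {in ds, forall d, P d}].
Proof.
elim: Bs => [|B Bs IH] H; first by exists [::].
have [d [[wd td] Pd]] := H B (mem_head _ _).
have [|ds [<- wds Pds]] := IH; first by move=> C HC; apply: H; rewrite in_cons HC orbT.
exists (d :: ds); rewrite /= td wd wds; split=> // e.
by rewrite in_cons => /predU1P[->|/Pds].
Qed.

(** The links of a rule are distinct, so [C != B] describes exactly the siblings of the chosen link
    [B], and a tree may be picked for each of them separately. *)
Lemma fill_context (P : tree R -> Prop) r B A x y : B \in links r ->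
  {in links r, forall C, C != B -> exists d, der d C /\ P d} -> dctx B A x y ->
  exists ds1 ds2,
    [/\ {in ds1 ++ ds2, forall d, P d},
        forall C, C \in links r -> C != B -> C \in map (dtop lhs) (ds1 ++ ds2) &
        dctx (lhs r) A (wD r + sumn (map (dsum wD) ds1) + sumn (map (dsum wD) ds2) + x)
          (wS r + sumn (map (dsum wS) ds1) + sumn (map (dsum wS) ds2) + y)].
Proof.
move=> B_r H c; have [Bs1 [Bs2 eB]] : exists Bs1 Bs2, links r = Bs1 ++ B :: Bs2.
  by case/splitPr: B_r => Bs1 Bs2; exists Bs1, Bs2.
have := links_uniq r; rewrite eB uniq_catC /= mem_cat negb_or -andbA => /and3P[B2 B1 _].
have [|ds1 [e1 w1 P1]] := @choose_children P Bs1.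
  by move=> C HC; apply: H; rewrite ?eB ?mem_cat ?HC //; apply: contraNneq B1 => <-.
have [|ds2 [e2 w2 P2]] := @choose_children P Bs2.
  move=> C HC; apply: H; first by rewrite ?eB mem_cat in_cons HC !orbT.
  by apply: contraNneq B2 => <-.
exists ds1, ds2; split.
- by move=> d; rewrite mem_cat => /orP[/P1|/P2].
- move=> C; rewrite map_cat e1 e2 !mem_cat in_cons.
  by case: eqVneq => // _; rewrite orbF.
- by apply: ctx_step c => //; rewrite e1 e2 -eB.
Qed.

Lemma fact_holds_infers F : {in F, forall x, fact_holds x} ->
  forall x, infers rs F x -> fact_holds x.
Proof.
move=> HF [k [a b]] /or3P[/andP[/eqP /= -> /eqP ->]|/and3P[/eqP /= -> /eqP <- /HF /= Ha]|].
- by exists 0; exact: ctx_refl.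
- by split=> //; exists 0, 0; exact: ctx_refl.
case/hasP => _ /mapP[r _ ->] /= /andP[/eqP <-].
have HF' k' B : (k', (a, B)) \in F -> fact_holds (k', (a, B)) by move=> /HF.
(* The condition on [dtop] singles out the sibling [C], whose tree must have positive [wS]-weight;
   any tree of [wD]-weight 0 serves for the others. *)
have zero (B C : V) :
    (forall D, D \in links r -> D != B -> (1, (a, D)) \in F) -> (2, (a, C)) \in F ->
    {in links r, forall D, D != B -> exists d, der d D /\
      (dsum wD d = 0 /\ (dtop lhs d = C -> 0 < dsum wS d))}.
  move=> H1 /HF' /= [d [[wd td] [d0 d1]]] D rD nD.
  have [eC|ne] := eqVneq D C; first by exists d; rewrite td eC.
  have [e [[we te] e0]] := HF' _ _ (H1 D rD nD).
  by exists e; rewrite te; split=> //; split=> // eC; rewrite eC eqxx in ne.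
have zero' (B : V) : (forall D, D \in links r -> D != B -> (1, (a, D)) \in F) ->
    {in links r, forall D, D != B -> exists d, der d D /\ dsum wD d = 0}.
  by move=> H1 D rD nD; apply: HF' _ _ (H1 D rD nD).
have sums0 (ds : seq (tree R)) : {in ds, forall d, dsum wD d = 0} ->
    sumn (map (dsum wD) ds) = 0 by exact: sumn_map_eq0.
have oth B (f : V -> bool) : all (fun C => (C == B) || f C) (links r) ->
    forall D, D \in links r -> D != B -> f D.
  by move=> /allP H D /H /orP[->|].
rewrite /rule_infers /=.
move=> /or4P[/andP[/eqP -> /allP h]|/andP[/eqP -> /andP[d /allP h]]|
  /andP[/eqP -> /and3P[d /allP h h']]|
  /or3P[/andP[/eqP -> /hasP[B rB /andP[/HF' [da [x [y c]]] /oth h]]]|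
    /andP[/eqP -> /andP[d /hasP[B rB /andP[/HF' [y c] /oth h]]]]|
    /andP[/eqP -> /andP[d /hasP[B rB /andP[h' /oth h]]]]]] /=.
- have [|ds [e1 w1 _]] := @choose_children (fun=> True) (links r).
    by move=> B /h /HF' [e He]; exists e.
  by exists (Node r ds); split=> //; rewrite /= e1 w1 eqxx.
- have [|ds [e1 w1 P1]] := @choose_children (fun d => dsum wD d = 0) (links r).
    by move=> B /h /HF'.
  by exists (Node r ds); split; [split=> //; rewrite /= e1 w1 eqxx|rewrite /= sums0 //; lia].
- case/orP: h' => [s|/hasP[C rC hC]].
    have [|ds [e1 w1 P1]] := @choose_children (fun d => dsum wD d = 0) (links r).
      by move=> B /h /HF'.
    exists (Node r ds); split; first by split=> //; rewrite /= e1 w1 eqxx.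
    by rewrite /= sums0 //; lia.
  have [|ds [e1 w1 P1]] := @choose_children
      (fun d => dsum wD d = 0 /\ (dtop lhs d = C -> 0 < dsum wS d)) (links r).
    move=> B rB; have [->|nC] := eqVneq B C.
      by have [e [[we te] [e0 e1']]] := HF' _ _ hC; exists e; rewrite te.
    have [e [[we te] e0]] := HF' _ _ (h B rB); exists e; split=> //; split=> //.
    by rewrite te => eC; rewrite eC eqxx in nC.
  exists (Node r ds); split; first by split=> //; rewrite /= e1 w1 eqxx.
  have /mapP[e e_ds eC] : C \in map (dtop lhs) ds by rewrite e1.
  have := sumn_map_gt0 e_ds ((P1 e e_ds).2 (esym eC)).
  by rewrite /= sums0 => [|e' /P1[]//]; lia.
- have oB : {in links r, forall D, D != B -> exists e, der e D /\ True}.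
    by move=> D rD nD; have [e He] := HF' _ _ (h D rD nD); exists e.
  have [ds1 [ds2 [_ _ c']]] := fill_context rB oB c.
  by split=> //; do 2!eexists; exact: c'.
- have [ds1 [ds2 [P12 _ c']]] := fill_context rB (zero' B h) c.
  eexists; move: c'; rewrite !sums0; try by move=> e He; apply: P12; rewrite mem_cat He ?orbT.
  by rewrite (_ : _ + _ = 0) //; [exact|lia].
(* The positive [wS]-weight comes from the context below, from the rule or from a sibling; all three
   cases give a context of this form. *)
- have [ds1 [ds2 [y [z_gt0 P12 c]]]] : exists ds1 ds2 y, [/\ 0 < y,
      {in ds1 ++ ds2, forall d, dsum wD d = 0} &
      dctx (lhs r) a (wD r + sumn (map (dsum wD) ds1) + sumn (map (dsum wD) ds2) + 0) y].
    case/orP: h' => [/HF' [y [c y_gt0]]|/andP[/HF' [y c] /orP[s|/hasP[C rC /andP[nC hC]]]]].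
    - have [ds1 [ds2 [P12 _ c']]] := fill_context rB (zero' B h) c.
      by exists ds1, ds2; eexists; split; [|exact: P12|exact: c']; lia.
    - have [ds1 [ds2 [P12 _ c']]] := fill_context rB (zero' B h) c.
      by exists ds1, ds2; eexists; split; [|exact: P12|exact: c']; lia.
    have [ds1 [ds2 [P12 hasC c']]] := fill_context rB (zero B C h hC) c.
    have /mapP[e e_ds eC] := hasC C rC nC.
    have gt0 : 0 < sumn (map (dsum wS) ds1) + sumn (map (dsum wS) ds2).
      by rewrite -sumn_cat -map_cat; apply: sumn_map_gt0 e_ds ((P12 e e_ds).2 (esym eC)).
    exists ds1, ds2; eexists; split; [|by move=> e' /P12[]|exact: c'].
    by lia.
  exists y; split=> //; move: c.
  rewrite !sums0; try by move=> e He; apply: P12; rewrite mem_cat He ?orbT.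
  by rewrite (_ : _ + _ = 0) //; lia.
Qed.

Let F := saturate (facts Vs) (infers rs).

(** Completeness follows the shape of a witness: one inference for each rule of a tree, or for each
    rule on the path of a context, whose side trees supply the facts 0, 1 and 2. *)
Let infer k a r : k < 6 -> a \in Vs ->
  rule_infers (fun k B => (k, (a, B)) \in F) k (links r, (0 < wD r, 0 < wS r)) ->
  (k, (a, lhs r)) \in F.
Proof.
move=> k6 Va h; apply: saturate_closed.
- by move=> F1 F2 x; exact: infers_mono.
- exact: mem_facts.
- apply/or3P/Or33/hasP; exists (lhs r, (links r, (0 < wD r, 0 < wS r))); last by rewrite eqxx.
  by apply: map_f; rewrite mem_enum.
Qed.

Lemma productive_fact a d : a \in Vs -> dwf lhs links d -> (0, (a, dtop lhs d)) \in F.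
Proof.
move=> Va; elim/tree_nested_ind: d => r ds IH /= /andP[/eqP e1 /allP wds].
apply: infer => //; apply/or4P/Or41/allP => B; rewrite -e1 => /mapP[d d_ds ->].
by apply: IH => //; exact: wds.
Qed.

Lemma null_fact a d : a \in Vs -> dwf lhs links d -> dsum wD d = 0 ->
  (1, (a, dtop lhs d)) \in F.
Proof.
move=> Va; elim/tree_nested_ind: d => r ds IH /= /andP[/eqP e1 /allP wds] D0.
apply: infer => //; apply/or4P/Or42; rewrite /= -leqNgt; apply/andP; split; first by lia.
apply/allP => B; rewrite -e1 => /mapP[d d_ds ->]; apply: IH => //; first exact: wds.
by have := sumn_map_le (dsum wD) d_ds; lia.
Qed.

Lemma positive_null_fact a d : a \in Vs -> dwf lhs links d -> dsum wD d = 0 ->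
  0 < dsum wS d -> (2, (a, dtop lhs d)) \in F.
Proof.
move=> Va; elim/tree_nested_ind: d => r ds IH /= /andP[/eqP e1 /allP wds] D0 S_gt0.
have D0' d : d \in ds -> dsum wD d = 0.
  by move=> d_ds; have := sumn_map_le (dsum wD) d_ds; lia.
apply: infer => //; apply/or4P/Or43; rewrite /= -leqNgt; apply/and3P; split; first by lia.
  apply/allP => B; rewrite -e1 => /mapP[d d_ds ->].
  by apply: null_fact => //; [exact: wds|exact: D0'].
case: (posnP (wS r)) => [r0|//].
have [|d d_ds d_gt0] := @sumn_map_gt0P _ (dsum wS) ds; first by lia.
apply/orP; right; apply/hasP; exists (dtop lhs d); first by rewrite -e1 map_f.
by apply: IH => //; [exact: wds|exact: D0'].
Qed.

Let base x : x \in facts Vs -> infers rs F x -> x \in F.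
Proof. by apply: saturate_closed => F1 F2 y; exact: infers_mono. Qed.

Let split_links r ds1 B ds2 C :
  map (dtop lhs) ds1 ++ B :: map (dtop lhs) ds2 = links r -> C \in links r ->
  C = B \/ exists2 d, d \in ds1 ++ ds2 & C = dtop lhs d.
Proof.
move=> <-; rewrite mem_cat in_cons orbCA => /predU1P[->|]; first by left.
by rewrite -mem_cat -map_cat => /mapP[d Hd ->]; right; exists d.
Qed.

Lemma context_fact a b x y : a \in Vs -> (exists d, der d a) -> dctx b a x y ->
  (3, (a, b)) \in F.
Proof.
move=> Va pa c; elim: c Va pa => [A VA [d [wd td]]|r ds1 B ds2 C x' y' e1 w1 w2 _ IH VC pC].
  apply: base; first exact: mem_facts.
  by apply/or3P/Or32; rewrite /= eqxx -td productive_fact ?td.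
apply: infer => //; apply/or4P/Or44/or3P/Or31/hasP => /=; exists B.
  by rewrite -e1 mem_cat mem_head orbT.
rewrite IH //=; apply/allP => D /(split_links e1)[->|[d Hd ->]]; first by rewrite eqxx.
by rewrite productive_fact ?orbT //; apply: (@allP _ _ (ds1 ++ ds2)) Hd; rewrite all_cat w1.
Qed.

Lemma null_context_fact a b x y : a \in Vs -> dctx b a x y -> x = 0 -> (4, (a, b)) \in F.
Proof.
move=> Va c; elim: c Va => [A VA _|r ds1 B ds2 C x' y' e1 w1 w2 _ IH VC x0].
  by apply: base; [exact: mem_facts|apply/or3P/Or31; rewrite /= eqxx].
apply: infer => //; apply/or4P/Or44/or3P/Or32 => /=; rewrite -leqNgt.
apply/andP; split; first by lia.
apply/hasP; exists B; first by rewrite -e1 mem_cat mem_head orbT.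
rewrite IH //=; last by lia.
apply/allP => D /(split_links e1)[->|[d Hd ->]]; first by rewrite eqxx.
have := sumn_map_le (dsum wD) Hd; rewrite map_cat sumn_cat => le_d.
rewrite null_fact ?orbT //; last by lia.
by apply: (@allP _ _ (ds1 ++ ds2)) Hd; rewrite all_cat w1.
Qed.

Lemma positive_null_context_fact a b x y :
  a \in Vs -> dctx b a x y -> x = 0 -> 0 < y -> (5, (a, b)) \in F.
Proof.
move=> Va c; elim: c Va => [//|r ds1 B ds2 C x' y' e1 w1 w2 c IH VC x0 y_gt0].
have x'0 : x' = 0 by lia.
have Hds d : d \in ds1 ++ ds2 -> dwf lhs links d /\ dsum wD d = 0.
  move=> Hd; split; first by apply: (@allP _ _ (ds1 ++ ds2)) Hd; rewrite all_cat w1.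
  by have := sumn_map_le (dsum wD) Hd; rewrite map_cat sumn_cat; lia.
apply: infer => //; apply/or4P/Or44/or3P/Or33 => /=; rewrite -leqNgt.
apply/andP; split; first by lia.
apply/hasP; exists B; first by rewrite -e1 mem_cat mem_head orbT.
apply/andP; split; last first.
  apply/allP => D /(split_links e1)[->|[d /Hds[wd D0] ->]]; first by rewrite eqxx.
  by rewrite null_fact ?orbT.
have [y'0|y'_gt0] := posnP y'; last by rewrite IH.
rewrite (null_context_fact VC c x'0) orbC /=.
case: (posnP (wS r)) => [r0|//] /=.
have [|d Hd d_gt0] := @sumn_map_gt0P _ (dsum wS) (ds1 ++ ds2).
  by rewrite map_cat sumn_cat; lia.
have [wd D0] := Hds d Hd.
apply/orP; left; apply/hasP; exists (dtop lhs d).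
  by rewrite -e1; move: Hd; rewrite !mem_cat in_cons => /orP[] Hd; rewrite (map_f _ Hd) ?orbT.
rewrite positive_null_fact // andbT.
have := links_uniq r; rewrite -e1 uniq_catC /= mem_cat negb_or -andbA => /and3P[B2 B1 _].
by move: Hd; rewrite mem_cat => /orP[] Hd; [apply: contraNneq B1|apply: contraNneq B2] => <-;
  rewrite map_f.
Qed.

Lemma ctx_target a b x y : b \in Vs -> dctx b a x y -> a \in Vs.
Proof.
move=> Vb c; elim: c Vb => // r ds1 B ds2 C x' y' e1 _ _ _ IH _; apply: IH.
by apply: (@links_Vs r); rewrite -e1 mem_cat mem_head orbT.
Qed.

Theorem pumpsP : reflect (pumpable lhs links wD wS S) (pumps rs Vs S).
Proof.
have sound := saturate_ind fact_holds_infers.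
apply: (iffP hasP) => [[a Va /andP[/sound[pa [x [y c]]] /sound[z [ca z_gt0]]]]|].
  exists a, z; split=> //; first by exists x, y.
  by case: pa => d [wd td]; exists d.
move=> [a [z [[x [y c]] [d wd td] ca z_gt0]]]; have Va := ctx_target S_Vs c.
exists a => //; apply/andP; split; last exact: positive_null_context_fact ca _ z_gt0.
by apply: context_fact c => //; exists d.
Qed.

End Decision.

(** * Inputs as nested lists of numbers *)

Notation raw_rule := (seq nat * (seq (tree (nat * nat)) * (seq (seq nat) * unit)))%type.
Notation raw_input :=
  ((seq nat * (seq (seq nat) * (seq nat * (nat * (seq raw_rule * unit))))) * seq nat)%type.

Definition raw_sym (N T : finType) (x : N + T + nat) : nat * nat :=
  match x with
  | inl (inl A) => (0, nat_of_ord (enum_rank A))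
  | inl (inr a) => (1, nat_of_ord (enum_rank a))
  | inr j => (2, j)
  end.

Definition raw_big (N : finType) (A : seq N) : seq nat := [seq nat_of_ord (enum_rank C) | C <- A].

(** The types in an input depend on its alphabets. Replacing symbols by their ranks in the
    enumerations puts all inputs into one encodable type without changing their codes, so that the
    decision procedure is a single function. *)
Definition raw (x : input) : raw_input :=
  let G := in_gram x in
  (([seq rk a | a <- enum (nt G)], (map (@raw_big (nt G)) (bignt G),
    ([seq rk a | a <- enum (in_alph x)], (nat_of_ord (enum_rank (start G)),
      ([seq (raw_big (lhs r), (map (tmap (@raw_sym (nt G) (in_alph x))) (rhs r),
          (map (@raw_big (nt G)) (links r), tt))) | r <- enum (rule G)], tt))))),
   [seq nat_of_ord (enum_rank a) | a <- enum (in_sub x)]).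

Lemma encode_tmap (A B : Type) (eB : encodable B) (e : A -> data) (f : A -> B) t :
  (forall a, encode (f a) = e a) -> encode (tmap f t) = enc_tree e t.
Proof.
move=> ef; elim/tree_nested_ind: t => a ts IH.
have -> : encode (tmap f (Node a ts)) =
  Defs.Cons (encode (f a)) (enc_list (map encode (map (tmap f) ts))) by [].
rewrite ef -map_comp /=; congr (Defs.Cons _ (enc_list _)).
by apply/eq_in_map => t /IH.
Qed.

Lemma encode_map (A B : Type) (eB : encodable B) (e : A -> data) (f : A -> B) s :
  (forall a, encode (f a) = e a) -> encode (map f s) = enc_list (map e s).
Proof. by move=> ef; rewrite /encode /encodable_seq -map_comp; congr enc_list; apply: eq_map. Qed.

Lemma encode_raw_big (N : finType) (A : seq N) : encode (raw_big A) = enc_big A.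
Proof. exact: encode_map. Qed.

Lemma encode_raw x : encode (raw x) = enc_input x.
Proof.
have Epair A B (eA : encodable A) (eB : encodable B) (p : A * B) :
  encode p = Defs.Cons (encode p.1) (encode p.2) by [].
have Esym (N T : finType) (l : N + T + nat) : encode (raw_sym l) = enc_sym l by case: l => [[]|].
rewrite /raw /enc_input /enc_mcftg !Epair /=.
congr (Defs.Cons (Defs.Cons _ (Defs.Cons _ (Defs.Cons _
  (Defs.Cons _ (Defs.Cons _ _))))) _); try exact: encode_map.
  by apply: encode_map => A; exact: encode_raw_big.
apply: encode_map => r; rewrite !Epair /=.
congr (Defs.Cons _ (Defs.Cons _ (Defs.Cons _ _))); first exact: encode_raw_big.
  by apply: encode_map => t; exact: encode_tmap.
by apply: encode_map => B; exact: encode_raw_big.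
Qed.

(** The tag 1 marks terminals, as in [raw_sym]. *)
Definition rule_weights (Dl : seq nat) (r : raw_rule) : seq nat * (seq (seq nat) * (bool * bool)) :=
  (r.1, (r.2.2.1, (has (fun l => (l.1 == 1) && (l.2 \in Dl)) (fstr r.2.1),
                   has (fun l => l.1 == 1) (fstr r.2.1)))).

Definition decide (x : raw_input) : bool :=
  ~~ pumps [seq rule_weights x.2 r | r <- x.1.2.2.2.2.1] x.1.2.1 [:: x.1.2.2.2.1].

Ltac encode_inj :=
  repeat first [exact: encode_nat_inj | apply: encode_seq_inj | apply: encode_prod_inj].

Ltac computable_seq :=
  lazymatch goal with
  | |- computable (fun e => has (@?f e) (@?l e)) => apply: (@computable_has _ _ _ _ f l)
  | |- computable (fun e => all (@?f e) (@?l e)) => apply: (@computable_all _ _ _ _ f l)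
  | |- computable (fun e => filter (@?f e) (@?l e)) => apply: (@computable_filter _ _ _ _ f l)
  | |- computable (fun e => map (@?f e) (@?l e)) => apply: (@computable_map _ _ _ _ _ _ f l)
  | |- computable (fun e => flatten (@?l e)) => apply: (@computable_flatten _ _ _ _ l)
  | |- computable (fun e => fstr (@?l e)) => apply: (@computable_fstr _ _ _ _ l)
  | |- computable (fun e => foldl (@?f e) (@?z e) (@?l e)) =>
      apply: (@computable_foldl _ _ _ _ _ _ f z l)
  | |- computable (fun e => @?f e == @?g e) =>
      apply: (@computable_eq _ _ _ _ f g); [by encode_inj | | ]
  | |- computable (fun e => @?f e \in @?g e) =>
      apply: (@computable_mem _ _ _ _ f g); [by encode_inj | | ]
  end.
Ltac computable ::= repeat first [computable_core | computable_bool | computable_seq].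

Lemma computable_decide : computable decide.
Proof.
rewrite /decide /pumps /saturate /infers /rule_infers /facts /rule_weights.
by computable.
Qed.

(** * Second-order substitution *)

(** Substitution moves the arguments of a symbol around, so labels are tracked up to permutation.
    The variables, nonterminals and terminals of a tree are all instances of this one function. *)
Definition collect (A X : Type) (f : A -> seq X) (t : tree A) : seq X :=
  flatten (map f (str t)).

Lemma collect_node (A X : Type) (f : A -> seq X) a ts :
  collect f (Node a ts) = f a ++ flatten (map (collect f) ts).
Proof.
rewrite /collect /=; congr cat; elim: ts => //= t ts IH.
by rewrite map_cat flatten_cat IH.
Qed.

Lemma collect_forest (A X : Type) (f : A -> seq X) u :
  flatten (map f (fstr u)) = flatten (map (collect f) u).
Proof. by rewrite /fstr; elim: u => //= t u IH; rewrite map_cat flatten_cat IH. Qed.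

Lemma perm_flatten_map_cat (A X : eqType) (F G H : A -> seq X) s :
  {in s, forall a, perm_eq (F a) (G a ++ H a)} ->
  perm_eq (flatten (map F s)) (flatten (map G s) ++ flatten (map H s)).
Proof.
elim: s => //= a s IH Hs; rewrite perm_sym perm_catACA perm_sym.
apply: perm_cat; first by apply: Hs; rewrite mem_head.
by apply: IH => b Hb; apply: Hs; rewrite in_cons Hb orbT.
Qed.

Lemma perm_flatten_map (A X : eqType) (F G : A -> seq X) s :
  {in s, forall a, perm_eq (F a) (G a)} ->
  perm_eq (flatten (map F s)) (flatten (map G s)).
Proof.
move=> FG; have := @perm_flatten_map_cat A X F G (fun=> [::]) s.
have -> : flatten [seq [::] | _ <- s] = [::] :> seq X by elim: s {FG}.
by rewrite cats0; apply=> a /FG; rewrite cats0.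
Qed.

Lemma perm_flatten_seq (A X : eqType) (F : A -> seq X) s t :
  perm_eq s t -> perm_eq (flatten (map F s)) (flatten (map F t)).
Proof. by move=> st; apply: perm_flatten; apply: perm_map. Qed.

Definition vars (A : Type) : A + nat -> seq nat := fun a => if a is inr j then [:: j] else [::].

Lemma rightsE (A B : Type) (s : seq (A + B)) :
  rights s = flatten (map (fun a => if a is inr b then [:: b] else [::]) s).
Proof. by elim: s => //= -[a|b] s IH //=; rewrite IH. Qed.

Lemma leftsE (A B : Type) (s : seq (A + B)) :
  lefts s = flatten (map (fun a => if a is inl b then [:: b] else [::]) s).
Proof. by elim: s => //= -[a|b] s IH //=; rewrite IH. Qed.

Lemma rights_str (A : Type) (t : tree (A + nat)) : rights (str t) = collect (@vars A) t.
Proof. exact: rightsE. Qed.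

Lemma all_collect (A X : Type) (P : pred X) (f : A -> seq X) a ts :
  all P (collect f (Node a ts)) = all P (f a) && all (fun t => all P (collect f t)) ts.
Proof.
rewrite collect_node all_cat; congr andb.
by elim: ts => //= t ts IH; rewrite all_cat IH.
Qed.

Section Instances.
Variables (A : Type) (r : A -> nat).
Notation PT := (tree (A + nat)).
Notation wrp := (wr (rank_sum r (fun=> 0))).
Implicit Types (p t : PT) (ts : seq PT).

Lemma wr_node a ts : wrp (Node a ts) = (size ts == rank_sum r (fun=> 0) a) && all wrp ts.
Proof. by []. Qed.

Lemma inst_inst ts us p : all (fun j => j < size us) (collect (@vars A) p) ->
  inst ts (inst us p) = inst (map (inst ts) us) p.
Proof.
elim/tree_nested_ind: p => -[a|j] vs IH; rewrite all_collect /=.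
  move=> /allP H; congr Node; rewrite -map_comp; apply/eq_in_map => v v_vs /=.
  by apply: IH => //; exact: H.
by rewrite andbT => /andP[lt_j _]; rewrite (nth_map (Node (inr j) vs)).
Qed.

Lemma wr_inst ts p : all (fun j => j < size ts) (collect (@vars A) p) ->
  all wrp ts -> wrp p -> wrp (inst ts p).
Proof.
move=> + wts; elim/tree_nested_ind: p => -[a|j] vs IH; rewrite all_collect wr_node.
  move=> /allP H /andP[sz /allP wvs]; rewrite /= size_map sz /=.
  by apply/allP => _ /mapP[v v_vs ->]; apply: IH => //; [exact: H|exact: wvs].
by move=> /andP[/= /andP[lt_j _] _ _]; apply: (allP wts); exact: mem_nth.
Qed.

(** Each variable occurs exactly once in a pattern, so each tree of [ts] contributes its labels
    exactly once. *)
Lemma collect_inst (X : eqType) (f : A + nat -> seq X) ts p :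
  pattern r (size ts) p ->
  perm_eq (collect f (inst ts p))
    (collect (fun a => if a is inl _ then f a else [::]) p ++ flatten (map (collect f) ts)).
Proof.
case/andP => wp; rewrite rights_str => vp.
set f0 := fun a : A + nat => _.
have lt_p : all (fun j => j < size ts) (collect (@vars A) p).
  by rewrite (perm_all _ vp); apply/allP => j; rewrite mem_iota.
(* A proper subtree contains only some of the variables, so the induction sums over those that occur
   in it. *)
suff H d q : wrp q -> all (fun j => j < size ts) (collect (@vars A) q) ->
    perm_eq (collect f (inst ts q))
    (collect f0 q ++ flatten [seq collect f (nth d ts j) | j <- collect (@vars A) q]).
  apply: perm_trans (H p p wp lt_p) _; rewrite perm_cat2l.
  apply: perm_trans (perm_flatten_seq _ vp) _.
  have -> // : map (collect f) ts = [seq collect f (nth p ts j) | j <- iota 0 (size ts)].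
  by rewrite -[in LHS](mkseq_nth p ts) /mkseq -map_comp.
elim/tree_nested_ind: q {wp lt_p} => -[a|j] vs IH wp lt_p.
  rewrite /= !collect_node /= -catA perm_cat2l.
  have -> : flatten [seq collect f (nth d ts j)
                    | j <- flatten [seq collect (@vars A) i | i <- vs]] =
      flatten [seq flatten [seq collect f (nth d ts j) | j <- collect (@vars A) v] | v <- vs].
    by elim: (vs) => //= v vs' IH'; rewrite map_cat flatten_cat IH'.
  rewrite -map_comp; apply: perm_flatten_map_cat => v v_vs /=; apply: IH => //.
    by move: wp; rewrite wr_node => /andP[_ /allP/(_ _ v_vs)].
  by move: lt_p; rewrite all_collect => /= /allP/(_ _ v_vs).
move: wp lt_p; rewrite wr_node all_collect => /andP[/eqP/size0nil -> _] /=.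
rewrite !andbT => lt_j; rewrite /collect /= cats0.
by rewrite (set_nth_default d).
Qed.

End Instances.

Section Substitution.
Variables N T : ralph.
Notation P := (ptree N T).
Notation rs := (rank_sum (@rk N) (@rk T)).
Notation wrs := (wr (rank_sum rs (fun=> 0))).
Implicit Types (t : P) (u : seq P) (psi phi : N -> P).

Definition collect_nts (a : N + T + nat) : seq N := if a is inl (inl C) then [:: C] else [::].
Definition collect_tms (a : N + T + nat) : seq T := if a is inl (inr b) then [:: b] else [::].

Lemma ntsE u : nts u = flatten (map (collect collect_nts) u).
Proof.
rewrite -collect_forest /nts; elim: (fstr u) => //= -[[C|b]|j] s IH //=.
by rewrite IH.
Qed.

Lemma tmsE u : tms u = flatten (map (collect collect_tms) u).
Proof.
rewrite -collect_forest /tms; elim: (fstr u) => //= -[[C|b]|j] s IH //=.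
by rewrite IH.
Qed.

(** Replacing the two lists of [subst] by a total function makes the composition of two
    substitutions a substitution again, see [sb_sb]. *)
Fixpoint sb psi t : P :=
  let: Node a ts := t in
  if a is inl (inl C) then inst (map (sb psi) ts) (psi C) else Node a (map (sb psi) ts).

Definition patterns psi := forall C, pattern rs (rk C) (psi C).

Definition idt (C : N) : P := Node (inl (inl C)) (mkseq (fun j => Node (inr j) [::]) (rk C)).

Lemma pattern_vars k t : pattern rs k t -> all (fun j => j < k) (collect (@vars _) t).
Proof.
case/andP => _; rewrite rights_str => H; rewrite (perm_all _ H).
by apply/allP => j; rewrite mem_iota.
Qed.

Lemma idt_patterns : patterns idt.
Proof.
move=> C; rewrite /pattern rights_str wr_node size_mkseq eqxx collect_node /=.
apply/andP; split; first by apply/allP => _ /mapP[j _ ->].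
suff -> : flatten (map (collect (@vars _)) (mkseq (fun j => Node (inr j) [::] : P) (rk C))) =
    iota 0 (rk C) by [].
by rewrite /mkseq -map_comp; elim: (iota _ _) => //= j s ->.
Qed.

Lemma inst_idt C ts : size ts = rk C -> inst ts (idt C) = Node (inl (inl C)) ts.
Proof.
move=> sz; rewrite /idt /=; congr Node; rewrite /mkseq -map_comp -sz.
rewrite -[RHS](mkseq_nth (idt C)) /mkseq; apply/eq_in_map => j; rewrite mem_iota /= => lt_j.
exact: set_nth_default.
Qed.

Lemma sb_wr psi t : patterns psi -> wrs t -> wrs (sb psi t).
Proof.
move=> Hpsi; elim/tree_nested_ind: t => a ts IH /=; rewrite -/(wrs _) => /andP[/eqP sz /allP wts].
have wts' : all wrs (map (sb psi) ts).
  by apply/allP => _ /mapP[t t_ts ->]; apply: IH => //; exact: wts.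
have H : wrs (Node a (map (sb psi) ts)) by rewrite wr_node size_map sz eqxx.
case: a sz {H} (H) => [[C|b]|j] //= sz _.
apply: wr_inst => //; last by case/andP: (Hpsi C).
by rewrite size_map sz; exact: pattern_vars.
Qed.

Lemma collect_sb (X : eqType) (f : N + T + nat -> seq X) psi t :
  patterns psi -> wrs t ->
  perm_eq (collect f (sb psi t))
    (collect (fun a => if a is inl (inl C)
       then collect (fun b => if b is inl _ then f b else [::]) (psi C) else f a) t).
Proof.
move=> Hpsi; elim/tree_nested_ind: t => a ts IH; rewrite wr_node => /andP[/eqP sz /allP wts].
have {}H := perm_flatten_map (fun t Ht => IH t Ht (wts t Ht)).
case: a sz => [[C|b]|j] sz; rewrite /= !collect_node.
- apply: perm_trans (collect_inst _ _) _; first by rewrite size_map sz; exact: Hpsi.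
  by rewrite perm_cat2l -map_comp.
- by rewrite perm_cat2l -map_comp.
- by rewrite perm_cat2l -map_comp.
Qed.

Lemma sb_pattern psi k t : patterns psi -> pattern rs k t -> pattern rs k (sb psi t).
Proof.
move=> Hpsi /andP[wt vt]; rewrite /pattern sb_wr //= rights_str.
apply: perm_trans (collect_sb _ Hpsi wt) _; rewrite rights_str in vt.
suff -> : forall t, collect (fun a => if a is inl (inl C) then
   collect (fun b : N + T + nat => if b is inl _ then vars b else [::]) (psi C) else vars a) t =
   collect (@vars _) t by [].
move=> {wt vt}t; rewrite /collect; congr flatten; apply: eq_map => -[[C|b]|j] //=.
by elim: (str _) => // -[b|j] s.
Qed.

Lemma sb_inst psi ts t : patterns psi -> wrs t ->
  sb psi (inst ts t) = inst (map (sb psi) ts) (sb psi t).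
Proof.
move=> Hpsi; elim/tree_nested_ind: t => a us IH; rewrite wr_node => /andP[/eqP sz /allP wus].
have E : map (sb psi) (map (inst ts) us) = map (inst (map (sb psi) ts)) (map (sb psi) us).
  by rewrite -!map_comp; apply/eq_in_map => t Ht /=; rewrite IH // wus.
case: a sz => [[C|b]|j] sz /=.
- rewrite E -inst_inst // size_map sz; exact: pattern_vars (Hpsi C).
- by rewrite E.
(* For an index beyond [ts], the default in [inst] is the node itself, so both sides leave it in
   place. *)
- have [lt_j|le_j] := ltnP j (size ts).
    by rewrite (nth_map (Node (inr j) us)).
  by rewrite !nth_default ?size_map.
Qed.

(** This associativity lets parts of a derivation tree be evaluated in advance. *)
Lemma sb_sb psi phi t : patterns psi -> patterns phi -> wrs t ->
  sb psi (sb phi t) = sb (fun C => sb psi (phi C)) t.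
Proof.
move=> Hpsi Hphi; elim/tree_nested_ind: t => a ts IH; rewrite wr_node => /andP[_ /allP wts].
have E : map (sb psi) (map (sb phi) ts) = map (sb (fun C => sb psi (phi C))) ts.
  by rewrite -map_comp; apply/eq_in_map => t Ht /=; rewrite IH // wts.
case: a => [[C|b]|j] /=; rewrite -?E //.
by rewrite sb_inst //; case/andP: (Hphi C).
Qed.

Lemma eq_in_sb psi phi t : {in collect collect_nts t, psi =1 phi} -> sb psi t = sb phi t.
Proof.
elim/tree_nested_ind: t => a ts IH; rewrite collect_node => H /=.
have -> : map (sb psi) ts = map (sb phi) ts.
  apply/eq_in_map => t Ht; apply: IH => // C HC; apply: H; rewrite mem_cat; apply/orP; right.
  by apply/flattenP; exists (collect collect_nts t) => //; exact: map_f.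
by case: a H => [[C|b]|j] // -> //; rewrite mem_head.
Qed.

(** With the default [idt C], a nonterminal outside [L] is substituted by itself. *)
Definition lookup (L : seq N) (us : seq P) (C : N) : P := nth (idt C) us (index C L).

Lemma subst_sb L us t : size us = size L -> wrs t ->
  subst (map inl L) us t = sb (lookup L us) t.
Proof.
move=> sz; elim/tree_nested_ind: t => a ts IH; rewrite wr_node => /andP[/eqP szt /allP wts] /=.
have E : map (subst (map inl L) us) ts = map (sb (lookup L us)) ts.
  by apply/eq_in_map => t Ht; apply: IH => //; exact: wts.
have inl_inj : injective (@inl N T) by move=> x y [].
rewrite E; case: a szt => [[C|b]|j] szt //; last first.
  by case: ifP => // /mapP[].
rewrite mem_map // index_map // /lookup; case: ifP => [CL|/negbT CL].
  by rewrite (set_nth_default (idt C)) // sz index_mem.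
by rewrite nth_default ?inst_idt ?size_map // sz leqNgt index_mem.
Qed.

End Substitution.

Arguments idt {N T} C.

(** * Values of partial derivation trees *)

Fixpoint bind (A B C : Type) (g : B -> tree (A + C)) (t : tree (A + B)) : tree (A + C) :=
  let: Node a ts := t in
  match a with
  | inl b => Node (inl b) (map (bind g) ts)
  | inr c => g c
  end.

Lemma inst_id (A : Type) (r : A -> nat) k (t : tree (A + nat)) :
  wr (rank_sum r (fun=> 0)) t -> all (fun j => j < k) (collect (@vars A) t) ->
  inst (mkseq (fun j => Node (inr j) [::]) k) t = t.
Proof.
elim/tree_nested_ind: t => -[a|j] ts IH; rewrite wr_node all_collect.
  move=> /andP[_ /allP wts] /= /allP vts; congr Node.
  by rewrite -[RHS]map_id; apply/eq_in_map => t Ht; apply: IH; [|exact: wts|exact: vts].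
move=> /andP[/eqP/size0nil -> _] /= /andP[/andP[lt_j _] _].
by rewrite nth_mkseq.
Qed.

Section Lookup.
Variables N T : ralph.
Notation P := (ptree N T).
Notation rs := (rank_sum (@rk N) (@rk T)).
Implicit Types (L : seq N) (us u : seq P) (psi : N -> P).

Definition fpat L us := all2 (fun C t => pattern rs (rk C) t) L us.

Lemma fpat_size L us : fpat L us -> size us = size L.
Proof. by elim: L us => [|C L IH] [|t us] //= /andP[_ /IH ->]. Qed.

Lemma fpat_wr L us t : fpat L us -> t \in us -> wr (rank_sum rs (fun=> 0)) t.
Proof.
elim: L us => [|C L IH] [|t' us] //= /andP[/andP[wt _] /IH H].
by rewrite in_cons => /predU1P[->|/H].
Qed.

Lemma fpat_cat L1 L2 us1 us2 : fpat L1 us1 -> fpat L2 us2 -> fpat (L1 ++ L2) (us1 ++ us2).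
Proof. by elim: L1 us1 => [|C L1 IH] [|t us1] //= /andP[-> /IH H] /H. Qed.

Lemma fpat_map L psi : patterns psi -> fpat L (map psi L).
Proof. by move=> H; elim: L => //= C L ->; rewrite H. Qed.

Lemma fpat_sb psi L us : patterns psi -> fpat L us -> fpat L (map (sb psi) us).
Proof. by move=> H; elim: L us => [|C L IH] [|t us] //= /andP[pt /IH ->]; rewrite sb_pattern. Qed.

Lemma lookup_patterns L us : fpat L us -> patterns (lookup L us).
Proof.
move=> H C; rewrite /lookup; elim: L us H => [|C' L IH] [|t us] //=.
  by move=> _; exact: idt_patterns.
by move=> /andP[pt H]; case: eqVneq => [<-|_] //=; exact: IH.
Qed.

Lemma map_lookup L us : uniq L -> size us = size L -> map (lookup L us) L = us.
Proof.
elim: L us => [|C L IH] [|t us] //= /andP[CL uL] [sz]; rewrite /lookup /= eqxx /=.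
congr cons; rewrite -[RHS](IH us) //; apply/eq_in_map => C' HC' /=.
by case: eqVneq => // eC; rewrite eC HC' in CL.
Qed.

Lemma sb_lookup psi L us C : C \in L -> size us = size L ->
  sb psi (lookup L us C) = lookup L (map (sb psi) us) C.
Proof. by move=> CL sz; rewrite /lookup (nth_map (idt C)) // sz index_mem. Qed.

Lemma sb_idt psi C : patterns psi -> sb psi (idt C) = psi C.
Proof.
move=> H; rewrite /idt /= /mkseq -map_comp.
by apply: (@inst_id _ rs); [case/andP: (H C)|exact: pattern_vars (H C)].
Qed.

Lemma nts_idt (B : seq N) : nts (map (@idt N T) B) = B.
Proof.
rewrite ntsE -map_comp (eq_map (g := fun C => [:: C])) ?flatten_map1 ?map_id // => C.
rewrite /= /idt collect_node.
suff -> : flatten (map (collect (@collect_nts N T)) (mkseq (fun j => Node (inr j) [::]) (rk C)))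
  = [::] by [].
by rewrite /mkseq -map_comp; elim: (iota _ _).
Qed.

Lemma tms_idt (B : seq N) : tms (map (@idt N T) B) = [::].
Proof.
rewrite tmsE -map_comp (eq_map (g := fun C => [::])) => [|C]; first by elim: B.
rewrite /= /idt collect_node.
suff -> : flatten (map (collect (@collect_tms N T)) (mkseq (fun j => Node (inr j) [::]) (rk C)))
  = [::] by [].
by rewrite /mkseq -map_comp; elim: (iota _ _).
Qed.

Lemma collect_sb_forest (X : eqType) (f : N + T + nat -> seq X) psi u :
  patterns psi -> all (wr (rank_sum rs (fun=> 0))) u ->
  perm_eq (flatten (map (collect f) (map (sb psi) u)))
    (flatten (map (collect (fun a => if a is inl (inl C) then [::] else f a)) u) ++
     flatten [seq collect (fun b => if b is inl _ then f b else [::]) (psi C) | C <- nts u]).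
Proof.
move=> H /allP wu; set f' := fun a => if a is inl (inl C) then _ else _.
set k := fun C => collect _ (psi C).
have split s : perm_eq
    (flatten (map (fun a => if a is inl (inl C) then k C else f a) s))
    (flatten (map f' s) ++ flatten (map k (flatten (map (@collect_nts N T) s)))).
  elim: s => //= a s IH; rewrite map_cat flatten_cat perm_sym perm_catACA perm_sym.
  by apply: perm_cat IH; case: a => [[C|b]|j] //=; rewrite cats0.
rewrite ntsE -map_comp.
have -> : flatten (map k (flatten (map (collect (@collect_nts N T)) u))) =
    flatten [seq flatten (map k (collect (@collect_nts N T) t)) | t <- u].
  by elim: u {wu} => //= t u IH; rewrite map_cat flatten_cat IH.
apply: perm_flatten_map_cat => t /wu wt.
exact: perm_trans (collect_sb _ H wt) (split _).
Qed.

Lemma eq_collect (A X : Type) (f g : A -> seq X) t : f =1 g -> collect f t = collect g t.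
Proof. by move=> fg; rewrite /collect (eq_map fg). Qed.

Lemma nts_sb psi u : patterns psi -> all (wr (rank_sum rs (fun=> 0))) u ->
  perm_eq (nts (map (sb psi) u)) (flatten [seq collect (@collect_nts N T) (psi C) | C <- nts u]).
Proof.
move=> H wu; rewrite [X in perm_eq X]ntsE; apply: perm_trans (collect_sb_forest _ H wu) _.
set f' := fun a => if a is inl (inl C) then _ else _.
have -> : flatten (map (collect f') u) = [::].
  elim: u {wu} => //= t u ->; rewrite cats0 /collect.
  by elim: (str t) => //= -[[C|b]|j] s ->.
suff -> : [seq collect (fun b => if b is inl _ then collect_nts b else [::]) (psi C)
  | C <- nts u] = [seq collect (@collect_nts N T) (psi C) | C <- nts u] by [].
by apply: eq_map => C; apply: eq_collect => -[[C'|b]|j].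
Qed.

Lemma tms_sb psi u : patterns psi -> all (wr (rank_sum rs (fun=> 0))) u ->
  perm_eq (tms (map (sb psi) u))
    (tms u ++ flatten [seq collect (@collect_tms N T) (psi C) | C <- nts u]).
Proof.
move=> H wu; rewrite [X in perm_eq X]tmsE; apply: perm_trans (collect_sb_forest _ H wu) _.
rewrite tmsE; set f' := fun a => if a is inl (inl C) then _ else _.
have -> : map (collect f') u = map (collect (@collect_tms N T)) u.
  by apply: eq_map => t; apply: eq_collect => -[[C'|b]|j].
suff -> : [seq collect (fun b => if b is inl _ then collect_tms b else [::]) (psi C)
  | C <- nts u] = [seq collect (@collect_tms N T) (psi C) | C <- nts u] by [].
by apply: eq_map => C; apply: eq_collect => -[[C'|b]|j].
Qed.

Lemma subst_links_sb (Bs : seq (seq N)) fs u :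
  fpat (flatten Bs) (flatten fs) -> all (wr (rank_sum rs (fun=> 0))) u ->
  subst_links Bs fs u = map (sb (lookup (flatten Bs) (flatten fs))) u.
Proof.
move=> H /allP wu; apply/eq_in_map => t /wu; apply: subst_sb; exact: fpat_size H.
Qed.

End Lookup.

(* A partial derivation tree is a derivation tree over the rules with leaves
   [inr B], called holes, that stand for missing derivation trees of [B]. *)
Section PartialDerivations.
Variables (T : ralph) (G : mcftg T).
Notation N := (nt G).
Notation P := (ptree (nt G) T).
Notation rs := (rank_sum (@rk (nt G)) (@rk T)).
Implicit Types (B : seq N) (p : tree (rule G + seq N)) (d : tree (rule G)).

Lemma uniq_flatten_links (r : rule G) : uniq (flatten (links r)).
Proof.
have := links_disjoint r; have : forall B, B \in links r -> uniq B.
  by move=> B /(@links_bignt _ _ r) /bignt_repfree.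
elim: (links r) => //= B Bs IH uB /andP[/allP dB pB].
rewrite cat_uniq uB ?mem_head // IH // => [|C HC]; last by rewrite uB // in_cons HC orbT.
rewrite andbT; apply/hasPn => C /flattenP[D HD CD].
by apply/negP => CB; have := dB D HD; rewrite disjoint_has => /hasPn/(_ _ CB)/negP.
Qed.

Lemma perm_nts_rhs (r : rule G) : perm_eq (nts (rhs r)) (flatten (links r)).
Proof.
apply: uniq_perm; [exact: rhs_uniq|exact: uniq_flatten_links|].
by move=> C; rewrite links_cover.
Qed.

Lemma fpat_rhs (r : rule G) : fpat (lhs r) (rhs r).
Proof. exact: rhs_pattern. Qed.

Lemma all_wr_rhs (r : rule G) : all (wr (rank_sum rs (fun=> 0))) (rhs r).
Proof. by apply/allP => t; exact: fpat_wr (fpat_rhs r). Qed.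

Definition ptop p : seq N := let: Node a _ := p in match a with inl r => lhs r | inr B => B end.

Fixpoint pwf p : bool :=
  let: Node a ps := p in
  match a with
  | inl r => (map ptop ps == links r) && all pwf ps
  | inr B => (B \in bignt G) && nilp ps
  end.

Definition holes p : seq (seq N) := rights (str p).

(** A hole for [B] evaluates to the nonterminals of [B] themselves, so the value of a partial
    derivation tree has the form of a right-hand side whose links are the holes. *)
Fixpoint pval p : seq P :=
  let: Node a ps := p in
  match a with
  | inl r => subst_links (links r) (map pval ps) (rhs r)
  | inr B => map idt B
  end.

Lemma holes_node r ps : holes (Node (inl r) ps) = flatten (map holes ps).
Proof.
rewrite /holes rightsE -/(collect _ _) collect_node /=; congr flatten.
by apply: eq_map => q; rewrite rightsE.
Qed.

Lemma ptop_bignt p : pwf p -> ptop p \in bignt G.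
Proof. by case: p => -[r|B] ps /=; [rewrite lhs_bignt|case/andP]. Qed.

Lemma fpat_flatten ps : {in ps, forall p, fpat (ptop p) (pval p)} ->
  fpat (flatten (map ptop ps)) (flatten (map pval ps)).
Proof.
elim: ps => //= p ps IH H; apply: fpat_cat; first by apply: H; rewrite mem_head.
by apply: IH => q Hq; apply: H; rewrite in_cons Hq orbT.
Qed.

Lemma fpat_pval p : pwf p -> fpat (ptop p) (pval p).
Proof.
elim/tree_nested_ind: p => -[r|B] ps IH /=; last by move=> _; apply/fpat_map/idt_patterns.
move=> /andP[/eqP <- /allP wps].
have Hps : fpat (flatten (map ptop ps)) (flatten (map pval ps)).
  by apply: fpat_flatten => q Hq; apply: IH => //; exact: wps.
rewrite subst_links_sb ?all_wr_rhs //; apply: fpat_sb; last exact: fpat_rhs.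
exact: lookup_patterns.
Qed.

Lemma pvalE r ps : pwf (Node (inl r) ps) ->
  [/\ map ptop ps = links r, {in ps, forall p, pwf p},
     fpat (flatten (links r)) (flatten (map pval ps)) &
     pval (Node (inl r) ps) =
     map (sb (lookup (flatten (links r)) (flatten (map pval ps)))) (rhs r)].
Proof.
move=> /= /andP[/eqP <- /allP wps].
have Hps : fpat (flatten (map ptop ps)) (flatten (map pval ps)).
  by apply: fpat_flatten => q /wps; exact: fpat_pval.
by split=> //; rewrite subst_links_sb ?all_wr_rhs.
Qed.

Lemma nts_pval p : pwf p -> perm_eq (nts (pval p)) (flatten (holes p)).
Proof.
elim/tree_nested_ind: p => -[r|B] ps IH wp; last first.
  move: wp => /= /andP[_ /nilP ->]; rewrite nts_idt /holes /= cats0.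
  exact: perm_refl.
have [_ wps Hps ->] := pvalE wp.
apply: perm_trans (nts_sb (lookup_patterns Hps) (all_wr_rhs r)) _.
apply: perm_trans (perm_flatten_seq _ (perm_nts_rhs r)) _.
rewrite (map_comp (collect _)) map_lookup ?uniq_flatten_links ?(fpat_size Hps) //.
rewrite holes_node -ntsE; elim: ps wps IH {wp Hps} => //= q ps IHps wps IH.
rewrite ntsE map_cat flatten_cat -!ntsE flatten_cat; apply: perm_cat.
  by apply: IH; rewrite ?wps ?mem_head.
by apply: IHps => [q' Hq|q' Hq]; [apply: wps|apply: IH]; rewrite in_cons Hq orbT.
Qed.

(** Nonterminals occur once in a right-hand side and patterns are linear, so evaluation neither
    copies nor erases terminals. This is why both weights are additive over the rules of a tree. *)
Lemma tms_pval p : pwf p ->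
  perm_eq (tms (pval p)) (flatten [seq tms (rhs r) | r <- lefts (str p)]).
Proof.
elim/tree_nested_ind: p => -[r|B] ps IH wp; last first.
  by move: wp => /= /andP[_ /nilP ->]; rewrite tms_idt.
have [_ wps Hps ->] := pvalE wp.
apply: perm_trans (tms_sb (lookup_patterns Hps) (all_wr_rhs r)) _.
rewrite /= perm_cat2l.
apply: perm_trans (perm_flatten_seq _ (perm_nts_rhs r)) _.
rewrite (map_comp (collect _)) map_lookup ?uniq_flatten_links ?(fpat_size Hps) //.
rewrite -tmsE; elim: ps wps IH {wp Hps} => //= q ps IHps wps IH.
rewrite tmsE map_cat flatten_cat -!tmsE !leftsE !map_cat !flatten_cat map_cat flatten_cat -!leftsE.
apply: perm_cat; first by apply: IH; rewrite ?wps ?mem_head.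
by apply: IHps => [q' Hq|q' Hq]; [apply: wps|apply: IH]; rewrite in_cons Hq orbT.
Qed.

Lemma ptop_bind g p : pwf p -> {in holes p, forall B, ptop (g B) = B} -> ptop (bind g p) = ptop p.
Proof. by case: p => -[r|B] ps //= _; apply; rewrite /holes /= mem_head. Qed.

Lemma pwf_bind g p : pwf p -> {in holes p, forall B, pwf (g B) /\ ptop (g B) = B} ->
  pwf (bind g p).
Proof.
elim/tree_nested_ind: p => -[r|B] ps IH; last first.
  by move=> _ H; case: (H B) => //; rewrite /holes /= mem_head.
rewrite holes_node => /= /andP[/eqP <- /allP wps] H.
have Hq q : q \in ps -> {in holes q, forall B, pwf (g B) /\ ptop (g B) = B}.
  by move=> Hq B HB; apply: H; apply/flattenP; exists (holes q) => //; exact: map_f.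
apply/andP; split.
  rewrite -map_comp; apply/eqP/eq_in_map => q Hq' /=; apply: ptop_bind; first exact: wps.
  by move=> B /(Hq q Hq')[].
by apply/allP => _ /mapP[q Hq' ->]; apply: IH => //; [exact: wps|exact: Hq].
Qed.

Lemma holes_bind g p : pwf p -> holes (bind g p) = flatten [seq holes (g B) | B <- holes p].
Proof.
elim/tree_nested_ind: p => -[r|B] ps IH; last first.
  by move=> /= /andP[_ /nilP ->]; rewrite /= cats0.
move=> /= /andP[_ /allP wps]; rewrite !holes_node -map_comp.
elim: ps IH wps => //= q ps IHps IH wps; rewrite map_cat flatten_cat -IH ?wps ?mem_head //.
by congr cat; apply: IHps => q' Hq'; [apply: IH|apply: wps]; rewrite in_cons Hq' orbT.
Qed.

Definition prules p : seq (rule G) := lefts (str p).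

Lemma prules_node r ps : prules (Node (inl r) ps) = r :: flatten (map prules ps).
Proof.
rewrite /prules leftsE -/(collect _ _) collect_node /=; congr (_ :: flatten _).
by apply: eq_map => q; rewrite leftsE.
Qed.

Lemma prules_bind g p : pwf p ->
  perm_eq (prules (bind g p)) (prules p ++ flatten [seq prules (g B) | B <- holes p]).
Proof.
elim/tree_nested_ind: p => -[r|B] ps IH; last first.
  by move=> /= /andP[_ /nilP ->]; rewrite /= cats0.
move=> /andP[_ /allP wps]; rewrite [bind _ _]/= !prules_node holes_node cat_cons perm_cons.
have -> : flatten [seq prules (g B) | B <- flatten (map holes ps)] =
    flatten [seq flatten [seq prules (g B) | B <- holes q] | q <- ps].
  by elim: (ps) => //= q qs IHq; rewrite map_cat flatten_cat IHq.
by rewrite -map_comp; apply: perm_flatten_map_cat => q Hq; apply: IH => //; exact: wps.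
Qed.

(** By [sb_sb], filling the holes before or after the evaluation makes no difference. One
    substitution [psi] for the whole tree keeps the induction uniform, while the lookup tables
    change from node to node. *)
Lemma pval_bind g p psi : pwf p -> {in holes p, forall B, pwf (g B) /\ ptop (g B) = B} ->
  patterns psi -> {in holes p, forall B, map psi B = pval (g B)} ->
  map (sb psi) (pval p) = pval (bind g p).
Proof.
move=> + + Hpsi; elim/tree_nested_ind: p => -[r|B] ps IH wp Hg Hpg.
  have wp' := pwf_bind wp Hg.
  have [_ wps Hps ->] := pvalE wp; have [_ _ Hps' ->] := pvalE wp'.
  rewrite holes_node in Hg Hpg.
  have in_holes q B : q \in ps -> B \in holes q -> B \in flatten (map holes ps).
    by move=> Hq HB; apply/flattenP; exists (holes q) => //; exact: map_f.
  have E : map pval (map (bind g) ps) = map (map (sb psi)) (map pval ps).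
    rewrite -!map_comp; apply/eq_in_map => q Hq /=; symmetry; apply: IH => //.
    - exact: wps.
    - by move=> B HB; apply: Hg; apply: in_holes HB.
    - by move=> B HB; apply: Hpg; apply: in_holes HB.
  rewrite -map_comp; apply/eq_in_map => t Ht /=.
  rewrite sb_sb //; [|exact: lookup_patterns|exact: (allP (all_wr_rhs r))].
  apply: eq_in_sb => C HC; rewrite sb_lookup ?(fpat_size Hps) ?E ?map_flatten //.
  rewrite -(perm_mem (perm_nts_rhs r)) ntsE.
  by apply/flattenP; exists (collect (@collect_nts _ _) t) => //; exact: map_f.
rewrite -Hpg ?/holes /= ?mem_head // -map_comp; apply: eq_map => C /=; exact: sb_idt.
Qed.

Definition ground d : tree (rule G + seq N) := tmap inl d.

Lemma ptop_ground d : ptop (ground d) = dtop (@lhs T G) d.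
Proof. by case: d. Qed.

Lemma pwf_ground d : pwf (ground d) = dwf (@lhs T G) (@links T G) d.
Proof.
elim/tree_nested_ind: d => r ds IH /=; rewrite -map_comp (eq_map ptop_ground) all_map.
by congr andb; apply: eq_in_all => d /IH.
Qed.

Lemma holes_ground d : holes (ground d) = [::].
Proof.
elim/tree_nested_ind: d => r ds IH; rewrite holes_node -map_comp.
by elim: ds IH => //= d ds IHds IH; rewrite IH ?mem_head // IHds // => e He;
  rewrite IH // in_cons He orbT.
Qed.

Lemma prules_ground d : prules (ground d) = str d.
Proof.
elim/tree_nested_ind: d => r ds IH; rewrite prules_node -map_comp /=; congr (_ :: flatten _).
by apply/eq_in_map => d /IH.
Qed.

Lemma dval_ground (d : tree (rules_ralph G)) : dval d = pval (ground d).
Proof.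
elim/tree_nested_ind: d => r ds IH /=; congr subst_links.
by rewrite -map_comp; apply/eq_in_map => d /IH.
Qed.

Lemma dsum_str f d : dsum f d = sumn (map f (str d)).
Proof.
elim/tree_nested_ind: d => r ds IH /=; congr addn.
elim: ds IH => //= d ds IHds IH; rewrite map_cat sumn_cat -IH ?mem_head // IHds // => e He.
by rewrite IH // in_cons He orbT.
Qed.

Lemma count_tms_pval (P : pred T) p : pwf p ->
  count P (tms (pval p)) = sumn [seq count P (tms (rhs r)) | r <- prules p].
Proof.
by move=> /tms_pval /permP ->; rewrite count_flatten -map_comp.
Qed.

Lemma count_tms_dval (P : pred T) d : dwf (@lhs T G) (@links T G) d ->
  count P (tms (pval (ground d))) = dsum (fun r : rule G => count P (tms (rhs r))) d.
Proof. by rewrite -pwf_ground => /(count_tms_pval P) ->; rewrite prules_ground dsum_str. Qed.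

Lemma der_fromP A (d : tree (rules_ralph G)) :
  der_from A d <-> dwf (@lhs T G) (@links T G) d /\ dtop (@lhs T G) d = A.
Proof.
split.
  elim=> {A d} r ds sz _ IH; split=> //=; apply/andP; split.
    apply/eqP/(@eq_from_nth _ [::]); first by rewrite size_map.
    move=> i; rewrite size_map => lt_i.
    by rewrite (nth_map (Node r [::])) //; case: (IH i lt_i).
  by apply/(all_nthP (Node r [::])) => i lt_i; case: (IH i lt_i).
move=> [+ <-]; elim/tree_nested_ind: d => r ds IH /= /andP[/eqP e1 /allP wds].
apply: der_rule => [|i lt_i]; first by rewrite -e1 size_map.
rewrite -e1 (nth_map (Node r [::])) //; apply: IH; first exact: mem_nth.
exact/wds/mem_nth.
Qed.

Lemma derE (d : tree (rules_ralph G)) :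
  der G d <-> dwf (@lhs T G) (@links T G) d /\ dtop (@lhs T G) d = [:: start G].
Proof. exact: der_fromP. Qed.

Lemma T_dwf (d : tree (rules_ralph G)) :
  dwf (@lhs T G) (@links T G) d -> T_ (rules_ralph G) d.
Proof.
rewrite /T_ /=; elim/tree_nested_ind: d => r ds IH /= /andP[/eqP e1 /allP wds].
rewrite -e1 size_map eqxx; apply/allP => d Hd; apply: IH => //; exact: wds.
Qed.

End PartialDerivations.

Lemma tms_emb (N T : ralph) (t : tree T) : tms [:: emb N t] = str t.
Proof.
rewrite tmsE /= cats0; elim/tree_nested_ind: t => a ts IH.
rewrite [emb _ _]/= collect_node -map_comp /=; congr (_ :: flatten _).
by apply/eq_in_map => t /IH.
Qed.

Lemma closed_emb (N T : ralph) (t : ptree N T) :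
  pattern (rank_sum (@rk N) (@rk T)) 0 t -> nts [:: t] = [::] -> exists t', t = emb N t'.
Proof.
move=> /andP[_]; rewrite rights_str ntsE /= cats0 => /perm_nilP.
elim/tree_nested_ind: t => -[[C|b]|j] ts IH; rewrite !collect_node //= => v0 n0.
suff [ts' ->] : exists ts', ts = map (@emb N T) ts' by exists (Node b ts').
elim: ts IH v0 n0 => [|t ts IHts] IH /=; first by exists [::].
move=> /(introT nilP); rewrite cat_nilp => /andP[/nilP v0 /nilP vs0] /(introT nilP).
rewrite cat_nilp => /andP[/nilP n0 /nilP ns0].
have [t' ->] := IH t (mem_head _ _) v0 n0.
have [|ts' ->] := IHts _ vs0 ns0; first by move=> u Hu; apply: IH; rewrite in_cons Hu orbT.
by exists (t' :: ts').
Qed.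

Section Ambiguity.
Variables (T : ralph) (G : mcftg T).
Notation N := (nt G).
Notation dwf := (dwf (@lhs T G) (@links T G)).
Notation dtop := (dtop (@lhs T G)).

Lemma der_emb (d : tree (rules_ralph G)) : der G d -> exists t, dval d = [:: emb N t].
Proof.
move=> /derE[wd td]; rewrite dval_ground.
have wp : pwf (ground d) by rewrite pwf_ground.
have := fpat_pval wp; have := nts_pval wp; rewrite ptop_ground td holes_ground.
move: (pval _) => u /perm_nilP n0 pt; have := fpat_size pt.
case: u n0 pt => [|t [|t' u]] // n0; rewrite /fpat /= andbT start_rank => pt _.
by have [t' ->] := closed_emb pt n0; exists t'.
Qed.

Lemma lang_from_dval A u : lang_from (G := G) A u ->
  exists d : tree (rules_ralph G), [/\ dwf d, dtop d = A & dval d = u].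
Proof.
elim=> {A u} r f _ IH.
have [ds [e1 wds vds]] : exists ds : seq (tree (rules_ralph G)),
    [/\ map dtop ds = links r, all dwf ds & map (@dval T G) ds = map f (links r)].
  elim: (links r) IH => [|B Bs IHB] IH; first by exists [::].
  have [d [wd td vd]] := IH B (mem_head _ _).
  have [|ds [e1 wds vds]] := IHB; first by move=> C HC; apply: IH; rewrite in_cons HC orbT.
  by exists (d :: ds); rewrite /= td wd vd e1 wds vds.
by exists (Node r ds); rewrite /= e1 wds eqxx vds.
Qed.

Lemma dval_lang_from (d : tree (rules_ralph G)) : dwf d -> lang_from (dtop d) (dval d).
Proof.
elim/tree_nested_ind: d => r ds IH /= /andP[/eqP e1 /allP wds].
pose f B := nth [::] (map (@dval T G) ds) (index B (links r)).
have -> : map (@dval T G) ds = map f (links r).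
  apply: (@eq_from_nth _ [::]); first by rewrite -e1 !size_map.
  move=> i; rewrite size_map => lt_i; have lt_i' : i < size (links r) by rewrite -e1 size_map.
  by rewrite (nth_map [::] _ f lt_i') /f index_uniq // links_uniq.
apply: lang_rule => B HB; have lt_i : index B (links r) < size ds.
  by rewrite -(size_map dtop) e1 index_mem.
rewrite /f (nth_map (Node r [::])) //.
have eB : dtop (nth (Node r [::]) ds (index B (links r))) = B.
  by rewrite -(nth_map _ [::]) // e1 nth_index.
rewrite -[X in lang_from X]eB.
by apply: IH; [exact: mem_nth|exact/wds/mem_nth].
Qed.

Lemma langP t : lang G t <-> exists2 d, der G d & dval d = [:: emb N t].
Proof.
split=> [/lang_from_dval[d [wd td vd]]|[d /derE[wd td] vd]]; first by exists d; first exact/derE.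
by rewrite /lang /= -td -vd; exact: dval_lang_from.
Qed.

Variable D : {set T}.
Let wD (r : rule G) := count (mem D) (tms (rhs r)).
Let wS (r : rule G) := count predT (tms (rhs r)).

Lemma der_weights (d : tree (rules_ralph G)) t : der G d -> dval d = [:: emb N t] ->
  dsum wD d = size (yd D t) /\ dsum wS d = size (str t).
Proof.
move=> /derE[wd _] vd; rewrite -!count_tms_dval // -dval_ground vd tms_emb.
by rewrite count_predT size_filter.
Qed.

End Ambiguity.

(** * Finite ambiguity and derivation trees *)

(** A forest is read as a binary tree of children and right siblings. Both branches get the full
    budget, so the list is only a finite superset of the forests with at most [n] nodes. *)
Fixpoint forests (A : Type) (al : seq A) (n : nat) : seq (seq (tree A)) :=
  if n is m.+1 then
    [::] :: flatten [seq flatten [seq [seq Node a ts :: u | u <- forests al m]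
                                 | ts <- forests al m] | a <- al]
  else [:: [::]].

Lemma mem_forests (A : eqType) (al : seq A) n u :
  size (fstr u) <= n -> {subset fstr u <= al} -> u \in forests al n.
Proof.
elim: n u => [|n IH] [|[a ts] u]; rewrite ?mem_head //.
rewrite /fstr /= -/(fstr ts) -/(fstr u) size_cat ltnS => le_n sub.
rewrite in_cons /=; apply/flattenP; eexists; first by apply: map_f; apply: sub; exact: mem_head.
apply/flattenP; eexists; first apply: map_f (IH ts _ _).
- by lia.
- by move=> b Hb; apply: sub; rewrite in_cons mem_cat Hb orbT.
apply: map_f; apply: IH; first by lia.
by move=> b Hb; apply: sub; rewrite in_cons mem_cat Hb !orbT.
Qed.

Fixpoint words (A : Type) (al : seq A) (n : nat) : seq (seq A) :=
  if n is m.+1 then [::] :: flatten [seq [seq a :: w | w <- words al m] | a <- al]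
  else [:: [::]].

Lemma mem_words (A : eqType) (al : seq A) n w :
  size w <= n -> {subset w <= al} -> w \in words al n.
Proof.
elim: n w => [|n IH] [|a w]; rewrite ?mem_head //.
move=> /= le_n sub; rewrite in_cons /=; apply/flattenP.
eexists; first by apply: map_f; apply: sub; exact: mem_head.
by apply: map_f; apply: IH => // b Hb; apply: sub; rewrite in_cons Hb orbT.
Qed.

Section FiniteAmbiguity.
Variables (T : ralph) (G : mcftg T) (D : {set T}).
Notation N := (nt G).

Definition dweight (r : rule G) := count (mem D) (tms (rhs r)).
Definition tweight (r : rule G) := count predT (tms (rhs r)).

(** There are finitely many words of length at most [K], so finite ambiguity makes the trees of
    Delta-weight at most [K] a finite union of finite sets, and their sizes have a maximum.
    Conversely, a finite alphabet has finitely many trees of bounded size. *)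
Lemma finite_ambiguityP : finite_ambiguity G D <->
  weight_bounded (@lhs T G) (@links T G) dweight tweight [:: start G].
Proof.
split=> [fa K|wb w _].
  pose W := [set w : seq T | all (mem D) w && (size w <= K)]%classic.
  have fW : finite_set W.
    apply: (sub_finite_set _ (finite_seq (words (enum D) K))) => w /= /andP[/allP Dw szw].
    by apply: mem_words => // a /Dw; rewrite mem_enum.
  pose L := (\bigcup_(w in W) [set t | lang G t /\ yd D t = w])%classic.
  have /finite_seqP[s Es] : finite_set L.
    by apply: bigcup_finite => // w /andP[Dw _]; exact: fa.
  exists (\max_(t <- s) size (str t)) => d wd td Kd.
  have dd : der G d by apply/derE.
  have [t vt] := der_emb dd; have [ED ES] := der_weights D dd vt.
  rewrite -[dsum _ _]/(dsum (fun r => count predT (tms (rhs r))) d) ES.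
  have ts : t \in s.
    have : L t; last by rewrite Es.
    exists (yd D t); last by split=> //; apply/langP; exists d.
    rewrite /W /= filter_all /=; move: Kd.
    by rewrite -[dsum _ _]/(dsum (fun r => count (mem D) (tms (rhs r))) d) ED.
  by rewrite (big_rem t) //= leq_maxl.
have [n Hn] := wb (size w).
apply: (sub_finite_set _ (finite_seq (flatten (forests (enum T) n)))) => t /= [/langP[d dd vd] yt].
have [ED ES] := der_weights D dd vd; have /derE[wd td] := dd.
apply/flattenP; exists [:: t]; last exact: mem_head.
apply: mem_forests; last by move=> a _; rewrite mem_enum.
rewrite /fstr /= cats0 -ES; apply: Hn => //.
by rewrite -[dsum _ _]/(dsum (fun r => count (mem D) (tms (rhs r))) d) ED yt.
Qed.

End FiniteAmbiguity.

(** * Correctness of the decision program *)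

Lemma fstr_tmap (A B : Type) (f : A -> B) u : fstr (map (tmap f) u) = map f (fstr u).
Proof.
have str_tmap t : str (tmap f t) = map f (str t).
  elim/tree_nested_ind: t => a ts IH /=; congr cons; rewrite map_flatten -!map_comp.
  by congr flatten; apply/eq_in_map => t /IH.
by rewrite /fstr map_flatten -!map_comp; congr flatten; apply: eq_map.
Qed.

Lemma has_terminal (N T : ralph) (P : pred nat) (u : seq (ptree N T)) :
  has (fun l => (l.1 == 1) && P l.2) (fstr (map (tmap (@raw_sym N T)) u)) =
  (0 < count (fun a => P (enum_rank a)) (tms u)).
Proof.
rewrite fstr_tmap -has_count /tms; elim: (fstr u) => //= -[[C|b]|j] s IH //=.
by rewrite IH.
Qed.

Lemma raw_big_inj (N : finType) : injective (@raw_big N).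
Proof. by apply: inj_map => C C' /val_inj; exact: enum_rank_inj. Qed.

Lemma dwf_inj (R : finType) (V W : eqType) (f : V -> W) (lhs : R -> V) links (d : tree R) :
  injective f ->
  dwf (f \o lhs) (map f \o links) d = dwf lhs links d /\ dtop (f \o lhs) d = f (dtop lhs d).
Proof.
move=> f_inj; split; last by case: d.
elim/tree_nested_ind: d => r ds IH /=.
have -> : map (dtop (f \o lhs)) ds = map f (map (dtop lhs) ds).
  by rewrite -map_comp; apply: eq_map => -[].
rewrite (inj_eq (inj_map f_inj)); congr andb.
by apply: eq_in_all => d /IH.
Qed.

Theorem decideP x : reflect (finite_ambiguity (in_gram x) (in_sub x)) (decide (raw x)).
Proof.
case: x => T G D; set N := nt G.
(* The program sees the grammar with its big nonterminals renamed to lists of numbers. The renaming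
   is injective, so it preserves derivation trees and their weights. *)
pose f := @raw_big N; pose clhs := f \o @lhs T G; pose clinks := map f \o @links T G.
have f_inj : injective f by exact: raw_big_inj.
have cP : reflect (pumpable clhs clinks (dweight D) (@tweight T G) (f [:: start G]))
    (~~ decide (raw (@Input T G D))).
  rewrite negbK; set rs := map _ _.
  have -> : rs = [seq (clhs r, (clinks r, (0 < dweight D r, 0 < tweight r)))
                 | r <- enum (rule G)].
    rewrite /rs /= -map_comp; apply: eq_map => r /=; rewrite /rule_weights /=.
    congr (_, (_, (_, _))).
      rewrite (@has_terminal N T (fun n => n \in [seq nat_of_ord (enum_rank a) | a <- enum D])).
      congr (0 < _); apply: eq_count => a /=.
      rewrite (mem_map (f := fun b : T => nat_of_ord (enum_rank b))) ?mem_enum //.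
      by move=> a' b' /val_inj; exact: enum_rank_inj.
    rewrite -(@has_terminal N T predT); apply: eq_has => l /=; by rewrite andbT.
  apply: pumpsP.
  - by move=> r; rewrite map_inj_uniq // links_uniq.
  - by apply: map_f; exact: start_bignt.
  - by move=> r; apply: map_f; exact: lhs_bignt.
  - by move=> r _ /mapP[B /links_bignt HB ->]; exact: map_f.
have wbE : weight_bounded clhs clinks (dweight D) (@tweight T G) (f [:: start G]) <->
    finite_ambiguity G D.
  rewrite finite_ambiguityP; split=> H K; have [n Hn] := H K; exists n => d.
    move=> wd td; have [E1 E2] := dwf_inj (@lhs T G) (@links T G) d f_inj.
    by apply: Hn; rewrite ?E1 // E2 td.
  have [-> ->] := dwf_inj (@lhs T G) (@links T G) d f_inj.
  by move=> wd /f_inj; exact: Hn.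
apply: (iffP idP) => [|/wbE wb].
  move=> dec; apply/wbE; apply: (@unbounded_pumpable _ _ _ _ _ _ (map f (bignt G))).
    by move=> r; apply: map_f; exact: lhs_bignt.
  by move=> /cP; rewrite dec.
by case: (decide _) cP => // cP; case: (pumpable_unbounded (cP isT) wb).
Qed.

Theorem finite_ambiguity_decidable :
  decidable_pred enc_input (fun x => finite_ambiguity (in_gram x) (in_sub x)).
Proof.
have [p Hp] := computable_decide; exists p => x; rewrite -encode_raw.
by have := Hp (raw x); case: decideP.
Qed.

(** * Candidate rules of bounded size *)

(* A triple ((A, u), L) is a candidate for a rule A -> (u, L). *)
Section Realizable.
Variables (T : ralph) (G : mcftg T).
Notation N := (nt G).
Notation P := (ptree (nt G) T).
Notation rs := (rank_sum (@rk (nt G)) (@rk T)).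
Notation dwf := (dwf (@lhs T G) (@links T G)).
Notation dtop := (dtop (@lhs T G)).
Notation pd := (tree (rule G + seq (nt G))).
Implicit Types (A B : seq N) (u : seq P) (L : seq (seq N)) (p : pd).

Definition triple := ((seq N * seq P) * seq (seq N))%type.

Definition realizes p (x : triple) :=
  [/\ pwf p, ptop p = x.1.1, perm_eq (holes p) x.2 & pval p = x.1.2].

Lemma holes_bignt p : pwf p -> {subset holes p <= bignt G}.
Proof.
elim/tree_nested_ind: p => -[r|B] ps IH; last first.
  move=> /= /andP[HB /nilP ->] C; rewrite /holes /= mem_seq1.
  by move=> /eqP ->.
move=> /andP[_ /allP wps] C; rewrite holes_node => /flattenP[_ /mapP[q Hq ->]].
exact: IH (wps q Hq) C.
Qed.

Lemma size_split_labels (s : seq (N + T + nat)) :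
  size s = size (lefts (lefts s)) + size (rights (lefts s)) + size (rights s).
Proof. by elim: s => //= -[[C|b]|j] s /= ->; lia. Qed.

Lemma fpat_vars A u : fpat A u ->
  size (rights (fstr u)) = sumn (map (@rk N) A) /\
  {in rights (fstr u), forall j, j < sumn (map (@rk N) A)}.
Proof.
have rcat (X Y : Type) (s t : seq (X + Y)) : rights (s ++ t) = rights s ++ rights t.
  exact: pmap_cat.
elim: A u => [|C A IH] [|t u] // /andP[/andP[_ vt] /IH[sz lt]] /=.
rewrite /fstr /= -/(fstr u) rcat size_cat sz (perm_size vt) size_iota; split=> // j.
rewrite mem_cat (perm_mem vt) mem_iota => /orP[|/lt]; last by lia.
by move=> /andP[_]; rewrite add0n => H; apply: ltn_addr.
Qed.

(** A repetition-free [L] has finitely many choices. Then [A] determines the number of variables of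
    [u], [L] the number of nonterminals, and [n] bounds the terminals, so [u] is one of finitely
    many forests. Realizability is selected classically. *)
Lemma finite_realizable n : exists X : seq triple, forall x,
  x \in X <->
  (exists p, realizes p x) /\ (count predT (tms x.1.2) <= n /\ uniq x.2).
Proof.
pose Q (x : triple) := (exists p, realizes p x) /\ (count predT (tms x.1.2) <= n /\ uniq x.2).
pose m A L := n + size (flatten L) + sumn (map (@rk N) A).
pose al k := [seq inl (inl C) | C <- enum N] ++ [seq inl (inr a) | a <- enum T] ++
  [seq inr j | j <- iota 0 k] : seq (N + T + nat).
pose E : seq triple := flatten [seq flatten [seq [seq ((A, u), L)
  | u <- forests (al (m A L)) (m A L)] | L <- words (bignt G) (size (bignt G))] | A <- bignt G].
exists [seq x <- E | `[< Q x >]] => x; rewrite mem_filter; split=> [/andP[/asboolP]//|Qx].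
apply/andP; split; first exact/asboolP.
case: x Qx => [[A u] L] [[p [wp /= tA hL vu]] /= [le_n uL]].
have L_big : {subset L <= bignt G}.
  by move=> B; rewrite -(perm_mem hL); exact: holes_bignt.
have fu : fpat A u by rewrite -tA -vu; exact: fpat_pval.
have nu : size (nts u) = size (flatten L).
  by rewrite -vu (perm_size (nts_pval wp)); apply: perm_size; exact: perm_flatten.
have [vsz vlt] := fpat_vars fu.
have bA : A \in bignt G by rewrite -tA; exact: ptop_bignt.
apply/flattenP; eexists; first exact: (map_f _ bA).
have bL : L \in words (bignt G) (size (bignt G)).
  by apply: mem_words => //; exact: uniq_leq_size.
apply/flattenP; eexists; first exact: (map_f _ bL).
apply: (map_f (fun u => (A, u, L))); apply: mem_forests.
  rewrite size_split_labels vsz -/(nts u) -/(tms u) nu.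
  by rewrite /m leq_add2r addnC leq_add2r -count_predT.
move=> a; rewrite !mem_cat; case: a => [[C|b]|j] Ha.
- by rewrite map_f ?mem_enum.
- by rewrite (map_f (fun a => inl (inr a))) ?mem_enum ?orbT.
apply/orP; right; apply/orP; right; apply: map_f; rewrite mem_iota /=.
suff : j < sumn (map (@rk N) A) by rewrite /m; lia.
apply: vlt; rewrite rightsE; apply/flattenP; exists [:: j]; last exact: mem_head.
by apply/mapP; exists (inr j).
Qed.

Lemma ground_of p : pwf p -> holes p = [::] -> exists d, p = ground d.
Proof.
elim/tree_nested_ind: p => -[r|B] ps IH //= /andP[_]; rewrite holes_node => wps h0.
suff [ds ->] : exists ds, ps = map (@ground T G) ds by exists (Node r ds).
elim: ps IH wps h0 => [|p ps IHps] IH /=; first by exists [::].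
move=> /andP[wp wps] /(introT nilP); rewrite cat_nilp => /andP[/nilP h0 /nilP hs0].
have [d ->] := IH p (mem_head _ _) wp h0.
have [|ds ->] := IHps _ wps hs0; first by move=> q Hq; apply: IH; rewrite in_cons Hq orbT.
by exists (d :: ds).
Qed.

Lemma count_tms_bind (R : pred T) (g : seq N -> pd) p : pwf p ->
  {in holes p, forall B, pwf (g B) /\ ptop (g B) = B} ->
  count R (tms (pval (bind g p))) =
  count R (tms (pval p)) + sumn [seq count R (tms (pval (g B))) | B <- holes p].
Proof.
move=> wp Hg; rewrite !count_tms_pval ?pwf_bind //.
rewrite (perm_sumn (perm_map _ (prules_bind g wp))) map_cat sumn_cat; congr addn.
elim: (holes p) Hg => //= B Bs IH Hg; rewrite map_cat sumn_cat IH.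
  by rewrite count_tms_pval //; case: (Hg B (mem_head _ _)).
by move=> C HC; apply: Hg; rewrite in_cons HC orbT.
Qed.

Variable D : {set T}.
Notation reach := (reachable (@lhs T G) (@links T G) (dweight D) (@tweight T G) [:: start G]).
Notation prod := (productive (@lhs T G) (@links T G)).
Notation dl u := (count (mem D) (tms u)).
Notation sg u := (count predT (tms u)).

Lemma count_tms_ground d : dwf d ->
  dl (pval (ground d)) = dsum (dweight D) d /\ sg (pval (ground d)) = dsum (@tweight T G) d.
Proof. by move=> wd; rewrite !count_tms_dval. Qed.

Hypothesis fa : finite_ambiguity G D.

(** A context from the initial nonterminal turns a tree for [A] into a complete derivation tree at a
    fixed extra weight. The context depends on [A], so a maximum over the big nonterminals is
    taken. *)
Lemma reachable_bound K : exists n, forall d, dwf d -> reach (dtop d) ->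
  dsum (dweight D) d <= K -> dsum (@tweight T G) d <= n.
Proof.
have wb := (finite_ambiguityP G D).1 fa.
suff H (s : seq (seq N)) : exists n, forall d, dwf d -> reach (dtop d) -> dtop d \in s ->
    dsum (dweight D) d <= K -> dsum (@tweight T G) d <= n.
  have [n Hn] := H (bignt G); exists n => d wd rd; apply: Hn => //.
  by case: d wd {rd} => r ds _; exact: lhs_bignt.
elim: s => [|A s [n Hn]]; first by exists 0.
have [[x [y c]]|nr] := pselect (reach A); last first.
  exists n => d wd rd; rewrite in_cons => /predU1P[eA|]; last exact: Hn.
  by case: nr; rewrite -eA.
have [n' Hn'] := wb (x + K); exists (maxn n n') => d wd rd.
rewrite in_cons => /predU1P[eA|Hs] Kd; last by rewrite leq_max Hn.
rewrite -eA in c; have [e [we te De Se]] := ctx_plug c wd.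
have := Hn' e we te; rewrite De Se leq_add2l => /(_ Kd) H.
by rewrite leq_max (leq_trans _ H) ?orbT // leq_addl.
Qed.

(** Each productive big nonterminal gets one fixed derivation tree. Filling at most [K] holes with
    them adds at most [K * k] to the Delta-weight and cannot lower the number of terminals, so the
    bound for complete trees applies. *)
Lemma partial_bound K : exists n, forall p, pwf p -> reach (ptop p) ->
  {in holes p, forall B, prod B} -> size (holes p) <= K -> dl (pval p) <= K ->
  sg (pval p) <= n.
Proof.
have /choice[g Hg] : forall B, exists p, prod B -> [/\ pwf p, ptop p = B & holes p = [::]].
  move=> B; have [[d wd td]|np] := pselect (prod B); last by exists (Node (inr B) [::]).
  by exists (ground d) => _; rewrite pwf_ground ptop_ground holes_ground.
pose k := \max_(B <- bignt G) dl (pval (g B)).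
have [n Hn] := reachable_bound (K + K * k); exists n => p wp rp pp szp dp.
have gp : {in holes p, forall B, pwf (g B) /\ ptop (g B) = B}.
  by move=> B /pp /Hg[].
have wb := pwf_bind wp gp.
have [|d Ed] := ground_of wb.
  rewrite holes_bind //.
  have : {in holes p, forall B, holes (g B) = [::]} by move=> B /pp /Hg[].
  elim: (holes p) => //= B Bs IH H; rewrite H ?mem_head // IH // => C HC.
  by apply: H; rewrite in_cons HC orbT.
have wd : dwf d by rewrite -pwf_ground -Ed.
have [ED ES] := count_tms_ground wd.
have tp : ptop (bind g p) = ptop p by apply: ptop_bind => // B /gp[].
have := Hn d wd; rewrite -ptop_ground -Ed tp -ED -ES -Ed !count_tms_bind // => /(_ rp).
move=> H; apply: leq_trans (leq_addr _ _) (H _); apply: leq_add => //.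
apply: leq_trans (leq_mul szp (leqnn k)).
have : {subset holes p <= bignt G} by exact: holes_bignt.
elim: (holes p) => //= B Bs IH sub; rewrite mulSn leq_add //.
  rewrite /k (big_rem B) ?leq_maxl //=; apply: sub; exact: mem_head.
by apply: IH => C HC; apply: sub; rewrite in_cons HC orbT.
Qed.

End Realizable.

(** * Transducers whose look-ahead is a deterministic tree automaton *)

(* The rule for a state, a symbol and the automaton states of the subtrees is
   computed by [z]. *)
Section TransducerConstruction.
Variables (O O' : ralph) (St Q : finType) (step : O -> seq St -> St).
Variable z : Q -> O -> seq St -> option (tree (O' + Q * nat)).

Definition lookahead := Dfta step pred0.
Notation run := (arun lookahead).

Hypothesis z_wr : forall q a s zeta, size s = rk a -> z q a s = Some zeta ->
  wr (rank_sum (@rk O') (fun=> 0)) zeta.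
Hypothesis z_arg : forall q a s zeta, size s = rk a -> z q a s = Some zeta ->
  all (fun c => c.2 < rk a) (rights (str zeta)).
Hypothesis z_linear : forall q a s zeta, size s = rk a -> z q a s = Some zeta ->
  uniq (map snd (rights (str zeta))).

Definition lookahead_rule (q : Q) (a : O) (s : seq St) zeta : trule Q O O' :=
  Trule q a (T_ O :: [seq [set t | T_ O t /\ run t = x]%classic | x <- s]) zeta.

Definition lookahead_rules : seq (trule Q O O') :=
  flatten [seq flatten [seq flatten [seq
    (if z q a s is Some zeta then [:: lookahead_rule q a s zeta] else [::])
    | s <- [seq tval t | t <- enum {: (rk a).-tuple St}]] | a <- enum O] | q <- enum Q].

Lemma In_flatten_map (X : eqType) (Y : Type) (f : X -> seq Y) (s : seq X) y :
  List.In y (flatten (map f s)) <-> exists2 x, x \in s & List.In y (f x).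
Proof.
elim: s => [|x s IH] /=; first by split=> // -[].
rewrite List.in_app_iff IH; split=> [[H|[x' Hx' H]]|[x']].
- by exists x; rewrite ?mem_head.
- by exists x'; rewrite // in_cons Hx' orbT.
by rewrite in_cons => /predU1P[->|Hx'] H; [left|right; exists x'].
Qed.

Lemma In_lookahead_rules r : List.In r lookahead_rules <->
  exists q a s zeta, [/\ size s = rk a, z q a s = Some zeta & r = lookahead_rule q a s zeta].
Proof.
split.
  move=> /In_flatten_map[q _ /In_flatten_map[a _ /In_flatten_map[_ /mapP[t _ ->]]]].
  case Ez: (z q a t) => [zeta|] //= [<-|//].
  by exists q, a, t, zeta; rewrite size_tuple.
move=> [q [a [s [zeta [sz Ez ->]]]]].
apply/In_flatten_map; exists q; first by rewrite mem_enum.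
apply/In_flatten_map; exists a; first by rewrite mem_enum.
apply/In_flatten_map; exists s; last by rewrite Ez; left.
have Hs : size s == rk a by exact/eqP.
by apply/mapP; exists (Tuple Hs); rewrite ?mem_enum.
Qed.

Lemma arun_final F F' (t : tree O) : arun (Dfta step F) t = arun (Dfta step F') t.
Proof.
by elim/tree_nested_ind: t => a ts IH /=; congr step; apply/eq_in_map => t /IH.
Qed.

Lemma nth_look s i x0 : i < size s ->
  nth set0 [seq [set t | T_ O t /\ run t = x]%classic | x <- s] i =
  [set t | T_ O t /\ run t = nth x0 s i]%classic.
Proof. by move=> lt_i; rewrite (nth_map x0). Qed.

Lemma lookahead_rules_ok r : List.In r lookahead_rules -> trule_ok r.
Proof.
move=> /In_lookahead_rules[q [a [s [zeta [sz Ez ->]]]]]; split=> /=.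
- by rewrite size_map sz.
- case=> [|i] le_i /=.
    (* The language L_0 consists of all trees, so one automaton state suffices. *)
    by exists (@Dfta O unit (fun _ _ => tt) predT) => t; split=> [|[]].
  have lt_i : i < size s by rewrite sz.
  case: s lt_i {Ez sz} => // x0 s lt_i; rewrite (nth_look x0) //.
  exists (Dfta step (pred1 (nth x0 (x0 :: s) i))) => t.
  by rewrite (arun_final _ pred0); split=> [[Ht /eqP]|[Ht /eqP]].
- exact: z_wr Ez.
- exact: z_arg Ez.
- exact: z_linear Ez.
Qed.

(** As [z] is a function, distinct rules for the same state and symbol differ in the automaton state
    of some subtree, and a deterministic run reaches only one of the two. *)
Lemma lookahead_rules_det r r' :
  List.In r lookahead_rules -> List.In r' lookahead_rules -> r <> r' ->
  tstate r = tstate r' -> tsym r = tsym r' ->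
  exists2 i, i <= rk (tsym r) & (nth set0 (look r) i `&` nth set0 (look r') i = set0)%classic.
Proof.
move=> /In_lookahead_rules[q [a [s [zeta [sz Ez ->]]]]].
move=> /In_lookahead_rules[q' [a' [s' [zeta' [sz' Ez' ->]]]]] ne /= eq ea.
subst q' a'; have ne_s : s <> s' by move=> es; apply: ne; subst s'; move: Ez'; rewrite Ez => -[->].
have [i lt_i [x0 ne_i]] : exists2 i, i < rk a & exists x0, nth x0 s i <> nth x0 s' i.
  case: s sz ne_s {ne Ez} => [|x0 s] sz ne_s.
    by move: sz'; rewrite -sz => /size0nil es'; case: ne_s.
  have /existsNP[i /not_implyP[lt_i ne_i]] :
      ~ forall i, i < size (x0 :: s) -> nth x0 (x0 :: s) i = nth x0 s' i.
    by move=> H; apply: ne_s; apply: (@eq_from_nth _ x0); [rewrite sz sz'|exact: H].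
  by exists i; [rewrite -sz|exists x0].
exists i.+1; first exact: lt_i.
rewrite /= !(nth_look x0) ?sz ?sz' //; apply/seteqP; split=> // t [[_ e1] [_ e2]].
by case: ne_i; rewrite -e1 -e2.
Qed.

Definition transducer (q0 : Q) : ldtr O O' :=
  @Ldtr O O' Q q0 lookahead_rules lookahead_rules_ok lookahead_rules_det.

Lemma transducerP q0 q a ss zeta (g : Q * nat -> tree O') : T_ O (Node a ss) ->
  z q a (map run ss) = Some zeta ->
  {in rights (str zeta), forall c,
    trans_from (M := transducer q0) c.1 (nth (Node a ss) ss c.2) (g c)} ->
  trans_from (M := transducer q0) q (Node a ss) (plug g zeta).
Proof.
move=> Tt Ez Hg; have /andP[/eqP sz /allP wss] : wr (@rk O) (Node a ss) by [].
have lt i : i < rk a -> i < size ss by rewrite sz.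
apply: (@trans_rule _ _ (transducer q0) (lookahead_rule q a (map run ss) zeta)) => //=.
- by apply/In_lookahead_rules; exists q, a, (map run ss), zeta; rewrite size_map.
- move=> i /lt lt_i.
  rewrite (nth_look (run (Node a ss))) ?size_map // (nth_map (Node a ss)) //.
  by split=> //; apply: wss; exact: mem_nth.
Qed.

End TransducerConstruction.

(** * The growing grammar *)

Lemma pairwise_disjoint_flatten (N : finType) (L : seq (seq N)) :
  uniq (flatten L) -> pairwise (fun B C : seq N => [disjoint B & C]) L.
Proof.
elim: L => //= B L IH; rewrite cat_uniq => /and3P[_ /hasPn dB /IH ->]; rewrite andbT.
apply/allP => C HC; rewrite disjoint_sym disjoint_has; apply/hasPn => x xC.
by apply: dB; apply/flattenP; exists C.
Qed.

Lemma uniq_flatten_filter (X : eqType) (a : pred (seq X)) L :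
  uniq (flatten L) -> uniq (flatten (filter a L)).
Proof.
elim: L => //= B L IH; rewrite cat_uniq => /and3P[uB dB /IH uL].
case: (a B) => //=; rewrite cat_uniq uB uL andbT /=; apply: contra dB => /hasP[x].
move=> /flattenP[C]; rewrite mem_filter => /andP[_ HC] xC xB.
by apply/hasP; exists x => //; apply/flattenP; exists C.
Qed.

Lemma uniq_flatten_lookup (N T : ralph) (F : seq N -> seq (ptree N T)) L B :
  uniq (flatten L) -> {in L, forall B, size (F B) = size B} -> B \in L ->
  map (lookup (flatten L) (flatten (map F L))) B = F B.
Proof.
elim: L => //= B' L IH; rewrite cat_uniq => /and3P[uB' /hasPn dB' uL] szF.
rewrite in_cons => /predU1P[->|HB].
  rewrite -[RHS](map_lookup uB') ?szF ?mem_head //.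
  apply/eq_in_map => C HC; rewrite /lookup index_cat HC nth_cat szF ?mem_head //.
  by rewrite index_mem HC.
rewrite -[RHS](IH uL _ HB) => [|B1 HB1]; last by rewrite szF // in_cons HB1 orbT.
apply/eq_in_map => C HC; rewrite /lookup index_cat.
have /negPf -> : C \notin B' by apply: dB'; apply/flattenP; exists B.
by rewrite nth_cat szF ?mem_head // ltnNge leq_addr /= addKn.
Qed.

Section Grammar.
Variables (T : ralph) (G : mcftg T).
Notation N := (nt G).
Notation P := (ptree (nt G) T).
Notation pd := (tree (rule G + seq (nt G))).
Notation dwf := (dwf (@lhs T G) (@links T G)).
Notation dtop := (dtop (@lhs T G)).

Lemma bind_bind (h g : seq N -> pd) (p : pd) :
  bind h (bind g p) = bind (fun B => bind h (g B)) p.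
Proof.
elim/tree_nested_ind: p => -[r|B] ps IH //=; congr Node; rewrite -map_comp.
by apply/eq_in_map => q /IH.
Qed.

Lemma bind_ground (h : seq N -> pd) d : bind h (ground d) = ground d.
Proof.
elim/tree_nested_ind: d => r ds IH /=; congr Node; rewrite -map_comp.
by apply/eq_in_map => d /IH.
Qed.

Lemma ground_node r ds : @ground T G (Node r ds) = Node (inl r) (map (@ground T G) ds).
Proof. by []. Qed.

Lemma eq_in_bind (g h : seq N -> pd) (p : pd) : {in holes p, g =1 h} -> bind g p = bind h p.
Proof.
elim/tree_nested_ind: p => -[r|B] ps IH; last by move=> H; apply: H; exact: mem_head.
rewrite holes_node => H /=; congr Node; apply/eq_in_map => q Hq; apply: IH => // B HB.
by apply: H; apply/flattenP; exists (holes q) => //; exact: map_f.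
Qed.

(** This makes a realized triple sound as a rule: applying it to the values of the fillings gives
    the value of the filled tree. *)
Lemma pval_bind_links (g : seq N -> pd) p L : pwf p -> perm_eq (holes p) L ->
  uniq (flatten L) -> {in L, forall B, pwf (g B) /\ ptop (g B) = B} ->
  pval (bind g p) = subst_links L (map (fun B => pval (g B)) L) (pval p).
Proof.
move=> wp hp uL Hg.
have fL : fpat (flatten L) (flatten (map (fun B => pval (g B)) L)).
  have {1}-> : L = map (@ptop T G) (map g L).
    by rewrite -map_comp -[LHS]map_id; apply/eq_in_map => B /Hg[].
  rewrite (map_comp (@pval T G) g); apply: fpat_flatten => _ /mapP[B /Hg[wg _] ->].
  exact: fpat_pval.
rewrite subst_links_sb //; last by apply/allP => t; exact: fpat_wr (fpat_pval wp).
symmetry; apply: pval_bind => //.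
- by move=> B; rewrite (perm_mem hp) => /Hg.
- exact: lookup_patterns.
move=> B; rewrite (perm_mem hp) => HB; apply: uniq_flatten_lookup => // C /Hg[wg tg].
by rewrite /= (fpat_size (fpat_pval wg)) tg.
Qed.

Lemma count_tms_node (R : pred T) (r : rule G) (ps : seq pd) :
  pwf (Node (inl r) ps) -> count R (tms (pval (Node (inl r) ps))) =
  count R (tms (rhs r)) + sumn [seq count R (tms (pval p)) | p <- ps].
Proof.
move=> wp; rewrite count_tms_pval // prules_node /=; congr addn.
move: wp => /andP[_ /allP]; elim: ps => //= p ps IH wps.
rewrite map_cat sumn_cat; congr addn.
  by rewrite count_tms_pval //; apply: wps; exact: mem_head.
by apply: IH => q Hq; apply: wps; rewrite in_cons Hq orbT.
Qed.

Lemma hole_wf B : B \in bignt G -> pwf (Node (inr B) [::] : pd).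
Proof. by move=> /= ->. Qed.

End Grammar.

Section GrowingGrammar.
Variables (T : ralph) (G : mcftg T) (D : {set T}).
Notation N := (nt G).
Notation P := (ptree (nt G) T).
Notation pd := (tree (rule G + seq (nt G))).
Notation dl u := (count (mem D) (tms u)).
Notation sg u := (count predT (tms u)).

Variables (n : nat) (X : seq (triple G)).
Hypothesis XP : forall x, x \in X <->
  (exists p, realizes p x) /\ (sg x.1.2 <= n /\ uniq x.2).

(** [rule_inj] identifies rules that differ only in the order of their links, so links are always
    listed in the order of [bignt G]. *)
Definition canonical (L : seq (seq N)) : seq (seq N) := [seq B <- bignt G | B \in L].

Definition growing_triple (x : triple G) : bool :=
  [&& canonical x.2 == x.2, uniq (flatten x.2), start G \notin flatten x.2,
      (x.1.1 == [:: start G]) || (x.2 != [::]) || (2 <= dl x.1.2) &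
      (size x.2 != 1) || (1 <= dl x.1.2)].

Definition growing_rules : seq (triple G) := [seq x <- X | growing_triple x].
Definition growing_rule : finType := seq_sub growing_rules.

Lemma growing_ruleP (r : growing_rule) :
  growing_triple (val r) /\ exists p, realizes p (val r).
Proof. by have := valP r; rewrite mem_filter => /andP[gr /XP[]]. Qed.

Lemma growing_rule_uniq (r : growing_rule) : uniq (flatten (val r).2).
Proof. by have [/and5P[]] := growing_ruleP r. Qed.

Lemma perm_growing_rule (r : growing_rule) : perm_eq (nts (val r).1.2) (flatten (val r).2).
Proof.
have [_ [p [wp _ hp <-]]] := growing_ruleP r.
by apply: perm_trans (nts_pval wp) _; exact: perm_flatten.
Qed.

Fact growing_rule_inj (r r' : growing_rule) : (val r).1.1 = (val r').1.1 ->
  (val r).1.2 = (val r').1.2 -> perm_eq (val r).2 (val r').2 -> r = r'.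
Proof.
have [/and5P[/eqP c _ _ _ _] _] := growing_ruleP r.
have [/and5P[/eqP c' _ _ _ _] _] := growing_ruleP r'.
move=> e1 e2 /perm_mem e3; apply: val_inj.
case: (val r) (val r') c c' e1 e2 e3 => [[A u] L] [[A' u'] L'] /= c c' -> -> e3.
by congr pair; rewrite -c -c'; apply: eq_filter => B; exact: e3.
Qed.

Fact growing_rule_lhs (r : growing_rule) : (val r).1.1 \in bignt G.
Proof. by have [_ [p [wp <- _ _]]] := growing_ruleP r; exact: ptop_bignt. Qed.

Fact growing_rule_pattern (r : growing_rule) :
  all2 (fun A t => pattern (rank_sum (@rk N) (@rk T)) (rk A) t) (val r).1.1 (val r).1.2.
Proof. by have [_ [p [wp <- _ <-]]] := growing_ruleP r; exact: fpat_pval. Qed.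

Fact growing_rule_nts (r : growing_rule) : uniq (nts (val r).1.2).
Proof. by rewrite (perm_uniq (perm_growing_rule r)) growing_rule_uniq. Qed.

Fact growing_rule_links_uniq (r : growing_rule) : uniq (val r).2.
Proof.
have [/and5P[/eqP <- _ _ _ _] _] := growing_ruleP r.
by apply: filter_uniq; exact: bignt_uniq.
Qed.

Fact growing_rule_links_bignt (r : growing_rule) : {subset (val r).2 <= bignt G}.
Proof.
have [/and5P[/eqP <- _ _ _ _] _] := growing_ruleP r.
by move=> B; rewrite mem_filter => /andP[].
Qed.

Fact growing_rule_disjoint (r : growing_rule) :
  pairwise (fun B C : seq N => [disjoint B & C]) (val r).2.
Proof. by apply: pairwise_disjoint_flatten; exact: growing_rule_uniq. Qed.

Fact growing_rule_cover (r : growing_rule) : flatten (val r).2 =i nts (val r).1.2.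
Proof. by move=> C; rewrite (perm_mem (perm_growing_rule r)). Qed.

Fact growing_rule_start (r : growing_rule) : start G \notin nts (val r).1.2.
Proof. by rewrite (perm_mem (perm_growing_rule r)); have [/and5P[]] := growing_ruleP r. Qed.

Definition growing_grammar : mcftg T :=
  @Mcftg T (nt G) (bignt G) (start G) growing_rule
    (fun r => (val r).1.1) (fun r => (val r).1.2) (fun r => (val r).2)
    (terminal_rank G) (bignt_uniq G) (@bignt_neq0 T G) (@bignt_repfree T G) (@bignt_occ T G)
    (start_bignt G) (start_rank G) growing_rule_inj growing_rule_lhs growing_rule_pattern
    growing_rule_nts growing_rule_links_uniq growing_rule_links_bignt growing_rule_disjoint
    growing_rule_cover growing_rule_start.

Notation G' := growing_grammar.

Lemma growing_growing_grammar : growing G' D.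
Proof.
move=> r; have [/and5P[_ _ _ g1 g2] _] := growing_ruleP r; split=> [nS L0|L1].
  move: g1; rewrite (_ : (val r).2 = [::]) //= orbF => /orP[/eqP eS|//].
  by case: nS.
by move: g2; rewrite (_ : size (val r).2 = 1).
Qed.

Definition expansion (r : growing_rule) : pd := projT1 (cid (growing_ruleP r).2).

Lemma expansionP r : realizes (expansion r) (val r).
Proof. exact: projT2 (cid (growing_ruleP r).2). Qed.

(** * From the growing grammar to the given one: expanding rules *)

Definition number_holes (L : seq (seq N)) (a : rule G + seq N) : rule G + unit * nat :=
  match a with inl r => inl r | inr B => inr (tt, index B L) end.

Definition expand (_ : unit) (r : rules_ralph G') (_ : seq unit) :
  option (tree (rules_ralph G + unit * nat)) :=
  Some (tmap (number_holes (val r).2) (expansion r)).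

Lemma number_holes_rights L p :
  rights (str (tmap (number_holes L) p)) = [seq (tt, index B L) | B <- holes p].
Proof.
have := fstr_tmap (number_holes L) [:: p]; rewrite /fstr /= !cats0 => ->; rewrite /holes.
by elim: (str p) => //= -[r|B] s IH //=; rewrite IH.
Qed.

Lemma expansion_links (r : growing_rule) : holes (expansion r) =i (val r).2.
Proof. by have [_ _ /perm_mem] := expansionP r. Qed.

Lemma wr_number_holes L p : pwf p ->
  wr (rank_sum (@rk (rules_ralph G)) (fun=> 0)) (tmap (number_holes L) p).
Proof.
elim/tree_nested_ind: p => -[r|B] ps IH; last by move=> /= /andP[_ /nilP ->].
move=> /= /andP[/eqP e1 /allP wps]; rewrite size_map -e1 size_map eqxx /=.
by apply/allP => _ /mapP[p Hp ->]; apply: IH => //; exact: wps.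
Qed.

Lemma ground_plug (g : unit * nat -> tree (rules_ralph G)) L p :
  ground (plug g (tmap (number_holes L) p)) = bind (fun B => ground (g (tt, index B L))) p.
Proof.
elim/tree_nested_ind: p => -[r|B] ps IH //=; congr Node.
by rewrite -!map_comp; apply/eq_in_map => p /IH.
Qed.

Lemma expand_wr q a s zeta : size s = rk a -> expand q a s = Some zeta ->
  wr (rank_sum (@rk (rules_ralph G)) (fun=> 0)) zeta.
Proof. by move=> _ [<-]; apply: wr_number_holes; have [] := expansionP a. Qed.

Lemma expand_arg q (a : rules_ralph G') s zeta : size s = rk a -> expand q a s = Some zeta ->
  all (fun c => c.2 < rk a) (rights (str zeta)).
Proof.
move=> _ [<-]; rewrite number_holes_rights; apply/allP => _ /mapP[B HB ->] /=.
by rewrite index_mem -expansion_links.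
Qed.

Lemma expand_linear q a s zeta : size s = rk a -> expand q a s = Some zeta ->
  uniq (map snd (rights (str zeta))).
Proof.
move=> _ [<-]; rewrite number_holes_rights -map_comp /=.
have [_ _ hp _] := expansionP a; rewrite map_inj_in_uniq.
  by rewrite (perm_uniq hp) growing_rule_links_uniq.
move=> B C; rewrite !(perm_mem hp) => HB HC /= e.
by rewrite -(nth_index [::] HB) e nth_index.
Qed.

Lemma simulated_growing_grammar : ldtr_simulated G' G.
Proof.
pose M := transducer (fun (_ : rules_ralph G') (_ : seq unit) => tt)
  expand_wr expand_arg expand_linear tt.
exists M; suff H (d : tree (rules_ralph G')) :
    dwf (@lhs T G') (@links T G') d -> exists d', [/\ trans_from (M := M) tt d d',
      dwf (@lhs T G) (@links T G) d', dtop (@lhs T G) d' = dtop (@lhs T G') d &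
      dval d' = dval d].
  move=> d dd; have [t vt] := der_emb dd; have /derE[wd td] := dd.
  have [d' [Md wd' td' vd']] := H d wd; exists d'; split=> //.
    by apply/derE; rewrite td' td.
  by exists t; rewrite vd'.
elim/tree_nested_ind: d => r ds IH wd; have Td := T_dwf wd.
move: wd => /= /andP[/eqP e1 /allP wds].
have [wp tp hp vp] := expansionP r.
(* A default tree for indices out of range. Without subtrees, the expansion of [r] has no holes and
   is itself a derivation tree. *)
have [d0 _] : exists d0 : tree (rules_ralph G), True.
  case: ds {Td} IH e1 wds => [|d ds] IH e1 wds; last first.
    by have [d' _] := IH d (mem_head _ _) (wds d (mem_head _ _)); exists d'.
  have h0 : holes (expansion r) = [::] by apply/perm_nilP; rewrite (perm_trans hp) // -e1.
  by have [d' _] := ground_of wp h0; exists d'.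
have /choice[g Hg] : forall i, exists d', i < size ds ->
    let d := nth (Node r ds) ds i in
    [/\ trans_from (M := M) tt d d', dwf (@lhs T G) (@links T G) d',
      dtop (@lhs T G) d' = dtop (@lhs T G') d & dval d' = dval d].
  move=> i; have [lt_i|] := ltnP i (size ds); last by exists d0.
  have Hi : nth (Node r ds) ds i \in ds by exact: mem_nth.
  by have [d' Hd'] := IH _ Hi (wds _ Hi); exists d'.
pose g' (c : unit * nat) := g c.2.
pose zeta := tmap (number_holes (val r).2) (expansion r).
have lt_link B : B \in (val r).2 -> index B (val r).2 < size ds.
  by rewrite -index_mem -e1 size_map.
have top_link B : B \in (val r).2 ->
    dtop (@lhs T G') (nth (Node r ds) ds (index B (val r).2)) = B.
  by move=> HB; rewrite -(nth_map _ [::]) ?lt_link // e1 nth_index.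
exists (plug g' zeta).
have gP B : B \in (val r).2 -> pwf (ground (g (index B (val r).2))) /\
    ptop (ground (g (index B (val r).2))) = B.
  move=> HB; have [_ w t _] := Hg _ (lt_link B HB).
  by rewrite pwf_ground ptop_ground t top_link.
split.
- apply: (@transducerP _ _ _ _ _ _ expand_wr expand_arg expand_linear) => //.
  move=> c; rewrite number_holes_rights => /mapP[B HB ->].
  rewrite expansion_links in HB.
  by have [] := Hg _ (lt_link B HB).
- rewrite -pwf_ground ground_plug; apply: pwf_bind => // B.
  by rewrite expansion_links => /gP.
- rewrite -ptop_ground ground_plug ptop_bind // => B.
  by rewrite expansion_links => /gP[].
rewrite dval_ground ground_plug (pval_bind_links wp hp (growing_rule_uniq r)) //.
rewrite vp /=; congr subst_links.
have -> : ds = map (fun B => nth (Node r ds) ds (index B (val r).2)) (val r).2.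
  apply: (@eq_from_nth _ (Node r ds)); first by rewrite size_map -e1 size_map.
  move=> i lt_i; have lt_i' : i < size (val r).2 by rewrite -e1 size_map.
  by rewrite (nth_map [::]) // index_uniq // growing_rule_links_uniq.
rewrite -map_comp; apply/eq_in_map => B HB /=.
by have [_ _ _ <-] := Hg _ (lt_link B HB); rewrite dval_ground.
Qed.

(** * From the given grammar to the growing one: contracting derivation trees *)

Notation reach := (reachable (@lhs T G) (@links T G) (dweight D) (@tweight T G) [:: start G]).
Notation prod := (productive (@lhs T G) (@links T G)).
Notation dwf' := (dwf (@lhs T G') (@links T G')).
Notation dtop' := (dtop (@lhs T G')).
Notation dwf := (dwf (@lhs T G) (@links T G)).
Notation dtop := (dtop (@lhs T G)).
(** A composed forest arises from a Delta-free context, one rule [r], and subtrees of Delta-weight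
    at most 1 at some of its links. So its Delta-weight and its number of holes are at most
    [dweight D r + size (links r)]. The successor ensures [1 <= K], as required in [run_big]. *)
Notation K := (\max_(r : rule G) (dweight D r + size (links r))).+1.

Hypothesis n_bound : forall p, pwf p -> reach (ptop p) -> {in holes p, forall B, prod B} ->
  size (holes p) <= K -> dl (pval p) <= K -> sg (pval p) <= n.

(* [None] stands for the values with at least two symbols of Delta, and for
   oversized values, which do not occur below a reachable nonterminal unless
   they have two symbols of Delta. *)
Definition small_step (r : rules_ralph G) (qs : seq (option (seq_sub X))) :
    option (seq_sub X) :=
  if all isSome qs then
    let v := subst_links (links r) [seq if q is Some y then (val y).1.2 else [::] | q <- qs]
               (rhs r) in
    if dl v <= 1 then insub ((lhs r, v), [::]) else None
  else None.

Notation run := (arun (lookahead small_step)).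

(** Both counts of a subtree are at most those of the whole tree, so a tree with a small value has
    only small subtrees and the run does not lose track of it. *)
Lemma run_small (d : tree (rules_ralph G)) : dwf d ->
  omap val (run d) = if (dl (pval (ground d)) <= 1) && (sg (pval (ground d)) <= n)
                     then Some ((dtop d, pval (ground d)), [::]) else None.
Proof.
elim/tree_nested_ind: d => r ds IH wd.
have wp : pwf (ground (Node r ds)) by rewrite pwf_ground.
have /andP[/eqP e1 /allP wds] := wd.
have le_child R d : d \in ds ->
    count R (tms (pval (ground d))) <= count R (tms (pval (ground (Node r ds)))).
  move=> Hd; rewrite ground_node in wp *; rewrite count_tms_node // -map_comp.
  apply: leq_trans (leq_addl _ _).
  exact: (sumn_map_le (fun d => count R (tms (pval (ground d)))) Hd).
rewrite [run _]/= /small_step; case: ifP => [/allP small|/negbT nsmall]; last first.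
  have /allPn[_ /mapP[d Hd ->] nd] := nsmall.
  case: ifP => // /andP[dl1 sgn]; have := IH d Hd (wds d Hd).
  by rewrite (leq_trans (le_child _ _ Hd) dl1) (leq_trans (le_child _ _ Hd) sgn);
    case: (run d) nd.
have -> : [seq (if q is Some y then (val y).1.2 else [::]) | q <- map run ds] =
    map (fun d => pval (ground d)) ds.
  rewrite -map_comp; apply/eq_in_map => d Hd /=; have := IH d Hd (wds d Hd).
  have : isSome (run d) by apply: small; exact: map_f.
  by case: (run d) => // y _; case: ifP => // _ [->].
have -> : subst_links (links r) (map (fun d => pval (ground d)) ds) (rhs r) =
    pval (ground (Node r ds)) by rewrite /= -map_comp.
case: leqP => //= dl1; case: insubP => [y|] /=.
  move=> /XP[_ [sgn _]] ->; by rewrite sgn.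
case: leqP => // sgn; case/negP; apply/XP; split=> //.
by exists (ground (Node r ds)); split; rewrite // ?ptop_ground // holes_ground.
Qed.

Lemma run_big (d : tree (rules_ralph G)) : dwf d -> reach (dtop d) ->
  run d = None -> 2 <= dl (pval (ground d)).
Proof.
move=> wd rd rn; have := run_small wd; rewrite rn ltnNge; case: leqP => //= dl1.
suff -> : sg (pval (ground d)) <= n by [].
apply: n_bound; rewrite ?pwf_ground ?ptop_ground ?holes_ground //.
exact: leq_trans dl1 _.
Qed.

Lemma hole_in_X B : B \in bignt G -> ((B, map idt B), [:: B]) \in X.
Proof.
move=> HB; apply/XP; split; last by rewrite tms_idt.
exists (Node (inr B) [::]); split=> //; exact: hole_wf.
Qed.

Definition start_state : seq_sub X := SeqSub (hole_in_X (start_bignt G)).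

(* In the state ((A, u), [:: B]), u is the value of a context from A to B that
   has been read but not yet output. *)
Definition contract (x : seq_sub X) (r : rules_ralph G) (qs : seq (option (seq_sub X))) :
    option (tree (rules_ralph G' + seq_sub X * nat)) :=
  let: ((A, u), L0) := val x in
  let fills := [seq if Bq.2 is Some y then (val y).1.2 else map idt Bq.1
               | Bq <- zip (links r) qs] in
  let v := subst_links L0 [:: subst_links (links r) fills (rhs r)] u in
  let Ls := [seq Bq.1 | Bq <- zip (links r) qs & ~~ isSome Bq.2] in
  if L0 != [:: lhs r] then None else
  if (size Ls == 1) && (dl v == 0) then
    omap (fun y => Node (inr (y, index (head [::] Ls) (links r))) [::]) (insub ((A, v), Ls))
  else
    omap (fun rho : growing_rule =>
      Node (inl rho) [seq Node (inr (insubd x ((B, map idt B), [:: B]), index B (links r))) [::]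
                     | B <- canonical Ls]) (insub ((A, v), canonical Ls)).

Lemma big_links (r : rule G) (qs : seq (option (seq_sub X))) :
  {subset [seq Bq.1 | Bq <- zip (links r) qs & ~~ isSome Bq.2] <= links r}.
Proof.
move=> B /mapP[[B' q]]; rewrite mem_filter => /andP[_ H] ->.
elim: (links r) qs H => [|C Cs IH] [|q' qs] //=; rewrite !in_cons => /predU1P[[-> _]|/IH ->].
  by rewrite eqxx.
by rewrite orbT.
Qed.

Lemma contract_cases x r qs zeta : contract x r qs = Some zeta ->
  (exists y B, B \in links r /\ zeta = Node (inr (y, index B (links r))) [::]) \/
  (exists (rho : growing_rule) L, [/\ uniq L, {subset L <= links r}, (val rho).2 = L &
     zeta = Node (inl rho)
       [seq Node (inr (insubd x ((B, map idt B), [:: B]), index B (links r))) [::] | B <- L]]).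
Proof.
rewrite /contract; case: (val x) => [[A u] L0].
case: ifP => // _; set v := subst_links _ _ _; set Ls := map _ _.
have sub : {subset Ls <= links r} by exact: big_links.
case: ifP => [/andP[sz1 _]|_]; case: insubP => //= y.
  move=> _ _ [<-]; left; exists y, (head [::] Ls); split=> //; apply: sub.
  by case: (Ls) sz1 => //= B s _; exact: mem_head.
move=> _ Ey [<-]; right; exists y, (canonical Ls); rewrite Ey; split=> //.
  by apply: filter_uniq; exact: bignt_uniq.
by move=> B; rewrite mem_filter => /andP[/sub].
Qed.

Lemma rights_calls (rho : growing_rule) (f : seq N -> seq_sub X * nat) L :
  rights (str (Node (inl rho) [seq Node (inr (f B)) [::] | B <- L] :
    tree (rules_ralph G' + seq_sub X * nat))) = map f L.
Proof. by rewrite /=; elim: L => //= B L ->. Qed.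

Lemma contract_wr q a s zeta : size s = rk a -> contract q a s = Some zeta ->
  wr (rank_sum (@rk (rules_ralph G')) (fun=> 0)) zeta.
Proof.
move=> _ /contract_cases[[y [B [_ ->]]]//|[rho [L [_ _ EL ->]]]] /=.
by rewrite size_map EL eqxx /= all_map; apply/allP.
Qed.

Lemma contract_arg q (a : rules_ralph G) s zeta : size s = rk a -> contract q a s = Some zeta ->
  all (fun c => c.2 < rk a) (rights (str zeta)).
Proof.
move=> _ /contract_cases[[y [B [HB ->]]]|[rho [L [_ sub EL ->]]]].
  by rewrite /= index_mem HB.
by rewrite rights_calls; apply/allP => _ /mapP[B /sub HB ->] /=; rewrite index_mem.
Qed.

Lemma contract_linear q a s zeta : size s = rk a -> contract q a s = Some zeta ->
  uniq (map snd (rights (str zeta))).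
Proof.
move=> _ /contract_cases[[y [B [_ ->]]]//|[rho [L [uL sub EL ->]]]].
rewrite rights_calls -map_comp map_inj_in_uniq // => B C /sub HB /sub HC /= e.
by rewrite -(nth_index [::] HB) e nth_index.
Qed.

Notation M := (transducer small_step contract_wr contract_arg contract_linear start_state).

(** The state [x] holds a Delta-free context realized by [p], and the output must evaluate to [e]
    plugged into [p]. The last hypothesis pays for terminal rules: if no link remains, all of [e]
    has been evaluated into the rule, which then is initial or has two symbols of Delta.
    Reachability of [A] serves the size bound, that of [dtop e] the look-ahead on the children. *)
Lemma contract_der e (x : seq_sub X) A u p :
  dwf e -> val x = ((A, u), [:: dtop e]) -> realizes p (val x) -> dl u = 0 ->
  reach A -> reach (dtop e) -> A = [:: start G] \/ 2 <= dl (pval (ground e)) ->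
  exists d', [/\ trans_from (M := M) x e d', dwf' d',
    dtop' d' = A & dval d' = pval (bind (fun=> ground e) p)].
Proof.
elim/tree_nested_ind: e x A u p => r ds IH x A u p we Ex rp u0 rA rB HA.
set e := Node r ds in we rB HA *.
have e1 : map dtop ds = links r by case/andP: we => /eqP.
have wds : {in ds, forall d, dwf d} by case/andP: we => _ /allP.
have Te := T_dwf we; move: rp; rewrite Ex => -[/= wp tp /perm_small_eq hp1 vp].
have {}hp1 : holes p = [:: lhs r] by exact: hp1.
(* Small subtrees are evaluated into the rule [r]; each of the others leaves a hole. *)
pose c d : pd := if run d is Some _ then ground d else Node (inr (dtop d)) [::].
pose q : pd := Node (inl r) (map c ds).
pose Ls := [seq Bq.1 | Bq <- zip (links r) (map run ds) & ~~ isSome Bq.2].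
have top_child d : d \in ds -> dtop d \in links r by move=> Hd; rewrite -e1 map_f.
have tc d : ptop (c d) = dtop d by rewrite /c; case: (run d) => // y; exact: ptop_ground.
have wc d : d \in ds -> pwf (c d).
  move=> Hd; rewrite /c; case: (run d) => [y|]; first by rewrite pwf_ground wds.
  by apply: hole_wf; apply: (@links_bignt _ _ r); exact: top_child.
have wq : pwf q.
  rewrite /= -map_comp (eq_map (g := dtop)) // e1 eqxx /=.
  by apply/allP => _ /mapP[d Hd ->]; exact: wc.
have ELs : Ls = [seq dtop d | d <- ds & ~~ isSome (run d)].
  by rewrite /Ls -e1; elim: (ds) => //= d ds' IHds; case: (run d) => [y|] //=; rewrite IHds.
have hq : holes q = Ls.
  rewrite /q holes_node -map_comp ELs; elim: (ds) => //= d ds' ->.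
  by rewrite /c; case: (run d) => [y|] //=; rewrite holes_ground.
have Efill : [seq (if Bq.2 is Some y then (val y).1.2 else map idt Bq.1)
     | Bq <- zip (links r) (map run ds)] = map (@pval T G) (map c ds).
  rewrite -e1; elim: (ds) wds => //= d ds' IHds wds'.
  rewrite IHds => [|d' Hd']; last by apply: wds'; rewrite in_cons Hd' orbT.
  congr cons; have := run_small (wds' d (mem_head _ _)).
  by rewrite /c; case: (run d) => [y|] //=; case: ifP => // _ [->].
pose p' := bind (fun=> q) p; pose v := subst_links [:: lhs r] [:: pval q] u.
have Hq : {in holes p, forall B, pwf q /\ ptop q = B}.
  by rewrite hp1 => B; rewrite mem_seq1 => /eqP ->.
have wp' : pwf p' by exact: pwf_bind.
have tp' : ptop p' = A by rewrite ptop_bind // => B /Hq[].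
have hp' : holes p' = Ls by rewrite holes_bind // hp1 /= cats0.
have vp' : pval p' = v.
  rewrite /p' (@pval_bind_links _ _ _ _ [:: lhs r]) ?hp1 ?vp //=.
    by rewrite cats0; exact: bignt_repfree (lhs_bignt r).
  by rewrite -hp1.
have dlv : dl v = dl (pval q).
  by rewrite -vp' count_tms_bind // vp u0 hp1 /= addn0.
have reach_child d : d \in ds -> reach (dtop d).
  move=> Hd; have [ds1 [ds2 eds]] : exists ds1 ds2, ds = ds1 ++ d :: ds2.
    by case/splitPr: Hd => ds1 ds2; exists ds1, ds2.
  by move: we rB; rewrite /e eds; exact: reachable_child.
have memLs B : B \in Ls -> exists d, [/\ d \in ds, run d = None & dtop d = B].
  rewrite ELs => /mapP[d]; rewrite mem_filter => /andP[nd Hd] ->; exists d; split=> //.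
  by case: (run d) nd.
have szds : size ds = size (links r) by rewrite -e1 size_map.
have leK : dweight D r + size (links r) <= K.
  by apply: leqW; exact: (leq_bigmax (F := fun r => dweight D r + size (links r))).
(* The holes of [p'] are productive because the subtrees of [e] that belong there derive them. *)
have sgv : sg v <= n.
  rewrite -vp'; apply: n_bound => //; rewrite ?tp' ?hp' ?vp' ?dlv //.
  - by move=> B /memLs[d [Hd _ <-]]; exists d => //; exact: wds.
  - rewrite ELs size_map size_filter; apply: leq_trans (count_size _ _) _.
    by rewrite szds; apply: leq_trans leK; exact: leq_addl.
  rewrite count_tms_node //; apply: leq_trans leK; rewrite leq_add2l -szds -map_comp.
  elim: (ds) wds => //= d ds' IHds wds'; rewrite -[(size ds').+1]add1n leq_add //.
    have := run_small (wds' d (mem_head _ _)); rewrite /c.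
    by case: (run d) => [y|_] /=; [case: ifP => // /andP[]|rewrite tms_idt].
  by apply: IHds => d' Hd'; apply: wds'; rewrite in_cons Hd' orbT.
pose child B := nth e ds (index B (links r)).
pose gd B := ground (child B).
have childE d : d \in ds -> child (dtop d) = d.
  move=> /(nthP e)[i lt_i <-]; rewrite /child -(nth_map _ [::]) // e1 index_uniq //.
  - by rewrite -szds.
  - exact: links_uniq.
have bq : bind gd q = ground e.
  rewrite /q /e ground_node /= -map_comp; congr Node; apply/eq_in_map => d Hd /=.
  by rewrite /c; case: (run d) => [y|] /=; [exact: bind_ground|rewrite /gd childE].
have Ebind : bind gd p' = bind (fun=> ground e) p by rewrite /p' bind_bind bq.
have bigP B : B \in Ls -> [/\ child B \in ds, dtop (child B) = B, reach B &
    2 <= dl (pval (ground (child B)))].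
  move=> /memLs[d [Hd nd <-]]; rewrite childE //; split=> //; first exact: reach_child.
  by apply: run_big => //; [exact: wds|exact: reach_child].
have EC : contract x r (map run ds) =
    if (size Ls == 1) && (dl v == 0) then
      omap (fun y => Node (inr (y, index (head [::] Ls) (links r))) [::]) (insub ((A, v), Ls))
    else omap (fun rho : growing_rule =>
      Node (inl rho) [seq Node (inr (insubd x ((B, map idt B), [:: B]), index B (links r))) [::]
                     | B <- canonical Ls]) (insub ((A, v), canonical Ls)).
  by rewrite /contract Ex eqxx /= Efill.
have uLs : uniq Ls.
  have sub : subseq Ls (links r) by rewrite -e1 ELs; apply/map_subseq/filter_subseq.
  exact: subseq_uniq sub (links_uniq r).
(* A Delta-free forest with one link would be a forbidden monic rule, so nothing is output and [v]
   becomes the context kept for the one big subtree. *)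
have [/andP[sz1 v0]|nmove] := boolP ((size Ls == 1) && (dl v == 0)).
  rewrite sz1 v0 /= in EC.
  have [B0 EB] : exists B0, Ls = [:: B0].
    by case: (Ls) sz1 => [|B0 [|B1 s]] // _; exists B0.
  have inX : ((A, v), [:: B0]) \in X.
    by apply/XP; split=> //; exists p'; split; rewrite //= ?hp' EB ?perm_refl.
  have [Hc tB rB0 big0] : [/\ child B0 \in ds, dtop (child B0) = B0, reach B0 &
    2 <= dl (pval (ground (child B0)))] by apply: bigP; rewrite EB mem_head.
  rewrite EB /= (insubT (mem X) inX) /= in EC.
  have [|||||||d' [Md wd' td' vd']] := IH (child B0) Hc (SeqSub inX) A v p'.
  - exact: wds.
  - by rewrite /= tB.
  - by split; rewrite //= ?hp' ?EB ?perm_refl.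
  - exact/eqP.
  - exact: rA.
  - by rewrite tB.
  - by right.
  exists d'; split=> //.
    apply: (transducerP (g := fun=> d') Te EC) => c' /=; rewrite mem_seq1 => /eqP -> /=.
    exact: Md.
  rewrite vd' -Ebind; congr pval; apply: eq_in_bind => B; rewrite hp' EB mem_seq1.
  by move=> /eqP ->.
(* Otherwise [v] is output as a rule, and every link starts anew with the empty context. *)
rewrite (negbTE nmove) in EC; pose L := canonical Ls.
have sub_links : {subset Ls <= links r} by exact: big_links.
have memL B : (B \in L) = (B \in Ls).
  rewrite mem_filter andb_idr // => /sub_links; exact: links_bignt.
have permL : perm_eq Ls L.
  by apply: uniq_perm; [|apply/filter_uniq/bignt_uniq|move=> B; rewrite memL].
have uflat : uniq (flatten L).
  rewrite -(perm_uniq (perm_flatten permL)).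
  have sub : Ls = [seq B <- links r | B \in Ls].
    apply: subseq_uniqP; first exact: links_uniq.
    by rewrite -e1 ELs; apply/map_subseq/filter_subseq.
  by rewrite sub; apply: uniq_flatten_filter; exact: uniq_flatten_links.
have inX : ((A, v), L) \in X.
  apply/XP; split; last by split=> //; apply/filter_uniq/bignt_uniq.
  by exists p'; split; rewrite ?hp'.
have inR : ((A, v), L) \in growing_rules.
  rewrite mem_filter inX andbT; apply/and5P; split=> //=.
  - by apply/eqP/eq_filter => B; rewrite memL.
  - apply/negP => /flattenP[B]; rewrite memL => /sub_links HB SB.
    have := start_separated r; rewrite -links_cover => /negP; apply.
    by apply/flattenP; exists B.
  - case: HA => [->|le2]; first by rewrite eqxx.
    case EL: L => [|B0 L']; last by rewrite orbT.
    have Ls0 : Ls = [::] by apply/perm_nilP; rewrite -EL.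
    have -> : dl v = dl (pval (ground e)).
      by rewrite dlv -bq count_tms_bind ?hq ?Ls0 //= addn0.
    by rewrite le2 orbT.
  - by rewrite -(perm_size permL); move: nmove; rewrite negb_and lt0n.
rewrite (insubT (mem growing_rules) inR) /= in EC.
pose rho : growing_rule := SeqSub inR.
have /choice[h Hh] : forall B, exists d', B \in L ->
    [/\ trans_from (M := M) (insubd x ((B, map idt B), [:: B])) (child B) d',
       dwf' d', dtop' d' = B & dval d' = pval (gd B)].
  move=> B; have [|] := boolP (B \in L); last by exists (Node rho [::]).
  rewrite memL => HB; have [Hc tB rB0 big0] := bigP B HB.
  (* The empty context of a link belongs to [X], so [insubd] does not fall back on its default
     [x]. *)
  have BX := hole_in_X (links_bignt (sub_links B HB)).
  have Ey : val (insubd x ((B, map idt B), [:: B])) = ((B, map idt B), [:: B]).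
    by rewrite insubdK.
  have [|||||||d' [Md wd' td' vd']] := IH (child B) Hc (insubd x ((B, map idt B), [:: B]))
    B (map idt B) (Node (inr B) [::]).
  - exact: wds.
  - by rewrite Ey tB.
  - by rewrite Ey; split=> //; apply: hole_wf; apply: links_bignt (sub_links B HB).
  - by rewrite tms_idt.
  - exact: rB0.
  - by rewrite tB.
  - by right.
  by exists d'.
exists (Node rho (map h L)); split.
- have -> : Node rho (map h L) = plug (fun c : seq_sub X * nat => h (nth [::] (links r) c.2))
      (Node (inl rho) [seq Node (inr (insubd x ((B, map idt B), [:: B]), index B (links r))) [::]
                     | B <- L]).
    rewrite /= -map_comp; congr Node; apply/eq_in_map => B; rewrite memL => /sub_links HB /=.
    by rewrite nth_index.
  refine (transducerP (g := fun c => h (nth [::] (links r) c.2)) Te EC _) => c'.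
  rewrite rights_calls => /mapP[B HB ->] /=.
  have [Md _ _ _] := Hh B HB.
  by rewrite nth_index //; apply: sub_links; rewrite -memL.
- rewrite /= -map_comp; apply/andP; split.
    by rewrite -[X in _ == X]map_id; apply/eqP/eq_in_map => B /Hh[].
  by apply/allP => _ /mapP[B /Hh[_ w _ _] ->].
- by [].
rewrite -Ebind (pval_bind_links wp' _ uflat) ?hp' //.
  rewrite vp' /=; congr subst_links; rewrite -map_comp; apply/eq_in_map => B HB /=.
  by have [_ _ _ ->] := Hh B HB.
move=> B; rewrite memL => HB; have [Hc tB _ _] := bigP B HB.
by rewrite pwf_ground ptop_ground tB wds.
Qed.

Lemma simulates_growing_grammar : ldtr_simulated G G'.
Proof.
exists M => d dd; have [t vt] := der_emb dd; have /derE[wd td] := dd.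
have rS : reach [:: start G] by exists 0, 0; exact: ctx_refl.
have [|||||||d' [Md wd' td' vd']] := @contract_der d start_state [:: start G]
  (map idt [:: start G]) (Node (inr [:: start G]) [::]).
- exact: wd.
- by rewrite td.
- by split=> //; apply: hole_wf; exact: start_bignt.
- by rewrite tms_idt.
- exact: rS.
- by rewrite td.
- by left.
exists d'; split=> //; first exact/derE.
by exists t; rewrite vd' /= -dval_ground.
Qed.

End GrowingGrammar.

Lemma growing_grammar_exists (T : ralph) (G : mcftg T) (D : {set T}) :
  finite_ambiguity G D ->
  exists G' : mcftg T,
    [/\ growing G' D, ldtr_equivalent G G',
        width G' = width G & multiplicity G' = multiplicity G].
Proof.
move=> fa.
have [n Hn] := partial_bound fa (\max_(r : rule G) (dweight D r + size (links r))).+1.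
have [X XP] := finite_realizable G n.
(* Width and multiplicity agree by computation, since [growing_grammar] keeps [nt G] and
   [bignt G]. *)
exists (growing_grammar D XP); split=> //; first exact: growing_growing_grammar.
by split; [exact: simulates_growing_grammar|exact: simulated_growing_grammar].
Qed.

Theorem theorem37 :
  decidable_pred enc_input (fun x => finite_ambiguity (in_gram x) (in_sub x)) /\
  (forall (T : ralph) (G : mcftg T) (D : {set T}),
     finite_ambiguity G D ->
     exists G' : mcftg T,
       [/\ growing G' D, ldtr_equivalent G G',
           width G' = width G & multiplicity G' = multiplicity G]).
Proof.
by split; [exact: finite_ambiguity_decidable|exact: growing_grammar_exists].
Qed.
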